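(* For any $\varepsilon>0$ and $x\geqslant e$ sufficiently large, $$\sum_{n \leqslant x} \omega\left(\left\lfloor \frac{x}{n}\right\rfloor\right) = x\sum_{n=1}^\infty \frac{\omega(n)}{n(n+1)} + O_\varepsilon\left(x^{\frac{455}{914}+\varepsilon}\right).$$
   Context: $\omega(n)$ is the number of distinct prime factors of $n$, with $\omega(1)=0$. $\lfloor\cdot\rfloor$ is the integer part. *)

(* Defs.v *)
From HB Require Import structures.
From mathcomp Require Import all_boot all_order all_algebra.
From mathcomp Require Import all_classical all_reals all_analysis.

Set Implicit Arguments.
Unset Strict Implicit.
Unset Printing Implicit Defensive.

Definition omega (n : nat) : nat := size (primes n).

(* Main.v *)
Require Import Defs.
From HB Require Import structures.
From mathcomp Require Import all_boot all_order all_algebra.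
From mathcomp Require Import all_classical all_reals all_analysis.
From mathcomp Require Import complex ring lra zify.

Set Implicit Arguments.
Unset Strict Implicit.
Unset Printing Implicit Defensive.

Import Order.TTheory GRing.Theory Num.Theory.
Import numFieldNormedType.Exports Normc.

Local Open Scope classical_set_scope.
Local Open Scope ring_scope.

(** Let z = x^(1/914): the error allowed is z^455 up to x^eps, and sqrt x = z^457.
    Group the n by the quotient m = floor (x / n). The n with m > z^459 are fewer
    than z^455 and count trivially. For the others [sum_by_quotient] replaces the sum
    over n by a sum over m <= z^459 of omega m times
    floor (x / m) - floor (x / (m + 1)). The main part x / (m (m + 1)) of this
    difference builds the series, whose tail [limn_partial_sum] is small enough, and
    what is left is a difference of two fractional parts. The m <= z^455 are again
    trivial. So everything rests on the range z^455 < m <= z^459, on both sides of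
    sqrt x: there the fractional parts of x / m and of x / (m + 1), weighted by
    omega m, must have mean 1/2 up to a proportion z^(-4).

    By Fejer approximation of the sawtooth ([fracpart_weighted_sum]) this follows
    from a bound z^450 for the exponential sums of omega m e(h x / (m + kap)) with
    1 <= h < z^16 and kap = 0, 1 ([exp_sum_omega]). To reach sums over free variables,
    the prime factors p of m are sorted by size. Small p give sums over long
    arithmetic progressions; medium p make m = p (m / p) a bilinear form. At most one
    prime factor is large, and whether it exists is one minus whether m is free of
    large primes. A number free of large primes factors in one way as s r, where s is
    the shortest product of its smallest primes that exceeds z^100
    ([prefix_fact_exists_unique]): this is a bilinear form again, subject to the
    condition that the primes of s precede those of r, and additive characters
    separate that condition at the price of a logarithm ([le_separation]). In every
    form the coefficients are bounded by 1.

    Bilinear sums ([bilinear_sum]) are cut into dyadic blocks. Cauchy--Schwarz over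
    the longer variable a leads to sums of e (X / (a b1 + kap) - X / (a b2 + kap)) over
    an interval of length A. When both variables have length near sqrt m the second
    derivative test would be void, whereas the third derivative test saves a power.
    The latter ([third_derivative_test_pow]) comes from two Weyl differencings and
    the Kusmin--Landau inequality, the derivatives being explicit.

    All sizes are powers of z with integer exponents, and each logarithm is bounded by
    a multiple of z: the saving z^12 in the bilinear sums leaves enough room. *)

(** * The additive character *)

Section Character.
Context {R : realType}.
Implicit Types (t a b : R).

Lemma normc_ge0 (z : R[i]) : 0 <= normc z.
Proof. by case: z => a b; rewrite /normc sqrtr_ge0. Qed.

Lemma normc_sum (I : Type) (r : seq I) (P : pred I) (F : I -> R[i]) :
  normc (\sum_(i <- r | P i) F i) <= \sum_(i <- r | P i) normc (F i).
Proof.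
elim/big_rec2: _ => [|i y x _ h]; first by rewrite normc0.
by apply: le_trans (le_normcD _ _) _; rewrite lerD2l.
Qed.

Lemma normc_conj (z : R[i]) : normc z^*%C = normc z.
Proof. by case: z => a b; rewrite /normc /= sqrrN. Qed.

Lemma normc_sqr (z : R[i]) : ((normc z ^+ 2)%:C)%C = z * z^*%C.
Proof.
case: z => a b; rewrite /normc /= sqr_sqrtr ?addr_ge0 ?sqr_ge0 //.
by simpc; congr (_ +i* _)%C; ring.
Qed.

Lemma normc_re (z : R[i]) : `|complex.Re z| <= normc z.
Proof. by case: z => a b; rewrite /normc /= -sqrtr_sqr ler_wsqrtr // lerDl sqr_ge0. Qed.

Lemma normc_real a : normc (a%:C)%C = `|a|.
Proof. by rewrite /normc /= expr0n /= addr0 sqrtr_sqr. Qed.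

Lemma normc_nat (n : nat) : normc (n%:R : R[i]) = n%:R.
Proof. by rewrite -(rmorph_nat (@real_complex R)) normc_real ger0_norm. Qed.

(** The additive character e(t) = exp(2 i pi t). *)
Definition cexp t : R[i] := (cos (2 * pi * t) +i* sin (2 * pi * t))%C.

Lemma cexp0 : cexp 0 = 1.
Proof. by rewrite /cexp mulr0 cos0 sin0. Qed.

Lemma cexpD a b : cexp (a + b) = cexp a * cexp b.
Proof.
rewrite /cexp mulrDr cosD sinD; simpc; congr (_ +i* _)%C.
by rewrite addrC.
Qed.

Lemma cexpN t : cexp (- t) = (cexp t)^*%C.
Proof. by rewrite /cexp mulrN cosN sinN. Qed.

Lemma cexpB a b : cexp (a - b) = cexp a * (cexp b)^*%C.
Proof. by rewrite cexpD cexpN. Qed.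

Lemma normc_cexp t : normc (cexp t) = 1.
Proof. by rewrite /normc /cexp cos2Dsin2 sqrtr1. Qed.

Lemma cexp1 : cexp 1 = 1.
Proof. by rewrite /cexp mulr1 mulrC mulr_natr cos2pi sin2pi. Qed.

Lemma cexp_nat (n : nat) : cexp n%:R = 1.
Proof.
elim: n => [|n ih]; first by rewrite cexp0.
by rewrite -natr1 cexpD ih cexp1 mulr1.
Qed.

Lemma cexp_int (n : int) : cexp n%:~R = 1.
Proof.
case: n => n; first exact: cexp_nat.
by rewrite NegzE mulrNz cexpN cexp_nat conjc1.
Qed.

Lemma normc_1Bcexp t : normc (1 - cexp t) = 2 * `|sin (pi * t)|.
Proof.
rewrite /cexp /normc /=.
have -> : 2 * pi * t = (pi * t) *+ 2 by rewrite mulr2n; ring.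
rewrite cos_mulr2n sin_mulr2n.
have h := cos2Dsin2 (pi * t).
set c := cos _ in h *; set s := sin _ in h *.
have -> : (1 - (c ^+ 2 *+ 2 - 1)) ^+ 2 + (0 - (c * s) *+ 2) ^+ 2 = (2 * s) ^+ 2.
  have -> : c ^+ 2 = 1 - s ^+ 2 by rewrite -h addrK.
  rewrite !mulr2n.
  have -> : (0 - (c * s + c * s)) ^+ 2 = 4 * c ^+ 2 * s ^+ 2 by ring.
  have -> : c ^+ 2 = 1 - s ^+ 2 by rewrite -h addrK.
  ring.
by rewrite sqrtr_sqr normrM ger0_norm.
Qed.

(** This form of the mean value theorem turns derivative bounds into bounds on
    differences. *)
Lemma mvt_bounds (f df : R -> R) a b (l m : R) : a <= b ->
  (forall x, a <= x <= b -> is_derive x 1 f (df x)) ->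
  (forall x, a <= x <= b -> l <= df x <= m) ->
  l * (b - a) <= f b - f a <= m * (b - a).
Proof.
move=> ab hd hb.
have hd' x : x \in `]a, b[%R -> is_derive x 1 f (df x).
  by rewrite in_itv /= => /andP[h1 h2]; apply: hd; rewrite !ltW.
have hc : {within `[a, b], continuous f}.
  apply: derivable_within_continuous => x; rewrite in_itv /= => h.
  exact: (@ex_derive _ _ _ _ _ _ _ (hd x h)).
have [c] := MVT_segment ab hd' hc.
rewrite in_itv /= => /hb/andP[h1 h2] ->.
have ba : 0 <= b - a by rewrite subr_ge0.
by rewrite !ler_wpM2r.
Qed.

Lemma sin_le_id t : 0 <= t -> sin t <= t.
Proof.
move=> t0; have := @mvt_bounds sin cos 0 t (-1) 1 t0.
rewrite sin0 !subr0 mul1r => h; have /h : forall x : R, 0 <= x <= t -> is_derive x 1 sin (cos x).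
  by move=> x _; exact: is_derive_sin.
move=> /(_ _)/andP[] // x _.
by rewrite cos_geN1 cos_le1.
Qed.

Lemma abs_sin_le t : `|sin t| <= `|t|.
Proof.
wlog t0 : t / 0 <= t => [wl|].
  have [/wl//|/ltW t0] := leP 0 t.
  by rewrite -(normrN (sin t)) -(normrN t) -sinN; apply: wl; rewrite oppr_ge0.
rewrite (ger0_norm t0).
have [t1|t1] := leP t 1; last by apply: le_trans (ltW t1); rewrite ler_norml sin_geN1 sin_le1.
rewrite ger0_norm ?sin_le_id// sin_ge0_pi// t0 /=.
by apply: le_trans t1 _; have := @pi_ge2 R; lra.
Qed.

Lemma cexp_lip a b : normc (cexp a - cexp b) <= 2 * pi * `|a - b|.
Proof.
have -> : cexp a - cexp b = - (cexp b * (1 - cexp (a - b))).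
  by rewrite mulrBr -cexpD mulr1 opprB; congr (cexp _ - _); ring.
rewrite normcN normcM normc_cexp mul1r normc_1Bcexp -mulrA ler_pM2l//.
by apply: le_trans (abs_sin_le _) _; rewrite normrM (ger0_norm (pi_ge0 _)).
Qed.

(** Halving the angle twice keeps the argument of the cosine below pi/4, where its
    square is at least 1/2. *)
Lemma sin_ge_half t : 0 <= t <= pi / 2 -> t / 2 <= sin t.
Proof.
move=> /andP[t0 t1].
have cp : cos (pi / 4 : R) ^+ 2 = 1 / 2.
  have := @cos_mulr2n R (pi / 4).
  have -> : (pi / 4 : R) *+ 2 = pi / 2 by rewrite mulr2n; field.
  by rewrite cos_pihalf mulr2n; lra.
have piP := @pi_gt0 R.
have cP (v : R) : 0 <= v <= pi / 4 -> cos (pi/4) <= cos v.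
  move=> /andP[v0 v1]; rewrite leNgt.
  have -> : (cos v < cos (pi / 4)) = (pi / 4 < v) by apply: ltr_cos; rewrite in_itv /=; lra.
  by rewrite -leNgt.
have c0 : 0 <= cos (pi / 4 : R) by apply: cos_ge0_pihalf; lra.
set v := t / 2.
have v0 : 0 <= v by rewrite /v; lra.
have v1 : v <= pi / 4 by rewrite /v; lra.
have sv : cos (pi / 4) * v <= sin v.
  have := @mvt_bounds sin cos 0 v (cos (pi/4)) 1 v0; rewrite sin0 !subr0 => h.
  have /h : forall x : R, 0 <= x <= v -> is_derive x 1 sin (cos x).
    by move=> x _; exact: is_derive_sin.
  move=> /(_ _)/andP[] // x /andP[x0 xv].
  by rewrite cos_le1 cP // x0 (le_trans xv).
have -> : t = v *+ 2 by rewrite /v mulr2n; field.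
rewrite sin_mulr2n mulr2n.
have cv := cP v; rewrite v0 v1 in cv; have {}cv := cv isT.
rewrite mulrC in sv.
have : v * cos (pi / 4) * cos (pi/4) <= sin v * cos v.
  by apply: ler_pM => //; rewrite mulr_ge0.
rewrite -mulrA -expr2 cp; lra.
Qed.

(** A chord of the unit circle is comparable with its arc. This is how a phase
    increment that stays away from the integers produces cancellation. *)
Lemma normc_1Bcexp_ge t : `|t| <= 1 / 2 -> pi * `|t| <= normc (1 - cexp t).
Proof.
move=> ht; rewrite normc_1Bcexp.
have piP := @pi_gt0 R.
have -> : `|sin (pi * t)| = `|sin (pi * `|t|)|.
  have [t0|t0] := leP 0 t; first by rewrite (ger0_norm t0).
  by rewrite (ltr0_norm t0) mulrN sinN normrN.
have := @sin_ge_half (pi * `|t|).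
have t0 := normr_ge0 t.
have -> : 0 <= pi * `|t| <= pi / 2.
  by rewrite mulr_ge0 ?(ltW piP)//= ler_pM2l //; lra.
move=> /(_ isT) h; have := ler_norm (sin (pi * `|t|)); lra.
Qed.

End Character.

(** * Kusmin--Landau and Cauchy--Schwarz *)

Section KusminLandau.
Context {R : realType}.

Lemma normcD (z w : R[i]) : normc (z + w) <= normc z + normc w.
Proof. exact: le_normcD. Qed.

Lemma normcB (z w : R[i]) : normc (z - w) <= normc z + normc w.
Proof. by apply: le_trans (normcD _ _) _; rewrite normcN. Qed.

Lemma sum_le_const (m k : nat) (F : nat -> R) (c : R) :
  (forall n, (m <= n < k)%N -> F n <= c) -> \sum_(m <= n < k) F n <= (k - m)%:R * c.
Proof.
move=> h; apply: le_trans (_ : \sum_(m <= n < k) c <= _); first exact: ler_sum_nat.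
by rewrite big_const_nat iter_addr_0 mulr_natl.
Qed.

Lemma abel_sum (u v : nat -> R[i]) (N : nat) :
  \sum_(0 <= n < N.+1) u n * (v n.+1 - v n) =
  u N * v N.+1 - u 0%N * v 0%N - \sum_(0 <= n < N) (u n.+1 - u n) * v n.+1.
Proof.
elim: N => [|N ih]; first by rewrite big_nat1 big_geq // subr0 mulrBr.
rewrite big_nat_recr //= ih [in RHS]big_nat_recr //=; ring.
Qed.

(** Kusmin--Landau inequality. Each term is a difference of consecutive terms
    divided by e(f(n+1) - f(n)) - 1, so the sum collapses after summation by parts.
    The classical version asks for monotone increments; a bound on the second
    differences controls the variation of the divisors as well, and it is what the
    fourth derivative gives later on. *)
Lemma kusmin_landau (f : nat -> R) (N : nat) (d et : R) :
  0 < d <= 1 / 2 -> 0 <= et ->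
  (forall n, (n.+1 < N)%N -> d <= f n.+1 - f n <= 1 / 2) ->
  (forall n, (n.+2 < N)%N -> `|f n.+2 - f n.+1 - (f n.+1 - f n)| <= et) ->
  normc (\sum_(0 <= n < N) cexp (f n)) <= 3 / d + N%:R * et / d ^+ 2.
Proof.
move=> /andP[d0 d1] et0 h1 h2.
have piP := @pi_ge2 R.
have dd : 0 < d ^+ 2 by rewrite exprn_gt0.
have d2 : 2 <= 1 / d by rewrite ler_pdivlMr //; lra.
have dE (c : R) : c / d = c * (1 / d) by rewrite mul1r.
case: N h1 h2 => [|[|N]] h1 h2.
- by rewrite big_geq // normc0 mul0r mul0r addr0 divr_ge0 // ltW.
- rewrite big_nat1 normc_cexp dE.
  have : 0 <= 1%:R * et / d ^+ 2 by rewrite mul1r divr_ge0 // ltW.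
  lra.
pose de n := f n.+1 - f n.
(* cexp (f n) = u n * (cexp (f n.+1) - cexp (f n)), to be summed by parts. *)
pose u n := (cexp (de n) - 1)^-1.
have lb n : (n < N.+1)%N -> 2 * d <= normc (cexp (de n) - 1).
  move=> hn; have /andP[a1 a2] := h1 n hn.
  have dp : 0 <= de n by apply: le_trans a1; exact: ltW.
  have := @normc_1Bcexp_ge R (de n); rewrite -normcN opprB ger0_norm // => /(_ a2).
  apply: le_trans; apply: le_trans (_ : 2 * de n <= _); first by rewrite ler_pM2l.
  by rewrite ler_wpM2r.
have nz n : (n < N.+1)%N -> cexp (de n) - 1 != 0.
  move=> /lb h; apply/eqP => h0; move: h; rewrite h0 normc0; lra.
have ub n : (n < N.+1)%N -> normc (u n) <= 1 / d / 2.
  move=> hn; have -> : 1 / d / 2 = (2 * d)^-1 by field; rewrite gt_eqF.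
  have d2p : 0 < 2 * d by lra.
  by rewrite /u normcV lef_pV2 ?posrE ?lb // (lt_le_trans d2p) ?lb.
rewrite big_nat_recr //=.
have -> : \sum_(0 <= n < N.+1) cexp (f n) =
    \sum_(0 <= n < N.+1) u n * (cexp (f n.+1) - cexp (f n)).
  rewrite !big_mkord; apply: eq_bigr => n _.
  have -> : f n.+1 = f n + de n by rewrite /de addrC subrK.
  rewrite cexpD -{3}(mulr1 (cexp (f n))) -mulrBr mulrC -mulrA divff ?mulr1 //.
  exact: nz.
rewrite abel_sum.
have hs : normc (\sum_(0 <= n < N) (u n.+1 - u n) * cexp (f n.+1)) <= N%:R * (et / d ^+ 2).
  apply: le_trans (normc_sum _ _ _) _.
  rewrite -[N in leRHS]subn0; apply: sum_le_const => n /andP[_ hn]; rewrite normcM normc_cexp mulr1.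
  have hn1 : (n < N.+1)%N by rewrite ltnW // ltnS.
  have hn2 : (n.+1 < N.+1)%N by rewrite ltnS.
  have -> : u n.+1 - u n = (cexp (de n) - cexp (de n.+1)) * (u n.+1 * u n).
    rewrite /u; field; by rewrite !nz.
  rewrite normcM normcM.
  have h3 : normc (cexp (de n) - cexp (de n.+1)) <= 2 * pi * et.
    apply: le_trans (cexp_lip _ _) _; rewrite ler_wpM2l //; first by lra.
    by rewrite distrC; apply: h2.
  have lb' k : (k < N.+1)%N -> normc (u k) <= 1 / (pi * d).
    move=> hk; have /andP[a1 a2] := h1 k hk.
    have dp : 0 <= de k by apply: le_trans a1; exact: ltW.
    have := @normc_1Bcexp_ge R (de k); rewrite -normcN opprB ger0_norm // => /(_ a2) hh.
    have pd : 0 < pi * d :> R by rewrite mulr_gt0 //; lra.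
    rewrite /u normcV mul1r lef_pV2 ?posrE //.
      by apply: le_trans hh; rewrite ler_pM2l //; lra.
    by apply: lt_le_trans (lb k hk); lra.
  apply: le_trans (_ : 2 * pi * et * (1 / (pi * d) * (1 / (pi * d))) <= _).
    apply: ler_pM; rewrite ?mulr_ge0 ?normc_ge0 //.
    by apply: ler_pM; rewrite ?normc_ge0 ?lb'.
  have -> : 2 * pi * et * (1 / (pi * d) * (1 / (pi * d))) = 2 / pi * (et / d ^+ 2).
    by field; rewrite !gt_eqF //; lra.
  rewrite -[leRHS]mul1r ler_wpM2r ?divr_ge0 ?(ltW dd) //.
  by rewrite ler_pdivrMr; lra.
apply: le_trans (normcD _ _) _; rewrite normc_cexp.
have : normc (u N * cexp (f N.+1) - u 0%N * cexp (f 0%N) -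
    \sum_(0 <= n < N) (u n.+1 - u n) * cexp (f n.+1)) <= 1/d/2 + 1/d/2 + N%:R * (et / d ^+ 2).
  apply: le_trans (normcB _ _) _; apply: lerD => //.
  by apply: le_trans (normcB _ _) _; rewrite !normcM !normc_cexp !mulr1 lerD ?ub.
have : N%:R * (et / d ^+ 2) <= N.+2%:R * et / d ^+ 2.
  by rewrite -mulrA ler_wpM2r ?divr_ge0 ?(ltW dd) // ler_nat; lia.
rewrite (dE 3); lra.
Qed.

Lemma normc_sqr_sum_diag (I : Type) (r : seq I) (z : I -> R[i]) :
  ((normc (\sum_(i <- r) z i) ^+ 2)%:C)%C = \sum_(i <- r) \sum_(j <- r) z i * (z j)^*%C.
Proof.
rewrite normc_sqr rmorph_sum big_distrl /=; apply: eq_bigr => i _.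
by rewrite big_distrr.
Qed.

(** Cauchy--Schwarz against the constant sequence 1. *)
Lemma cauchy_sum (I : Type) (r : seq I) (x : I -> R) :
  (\sum_(i <- r) x i) ^+ 2 <= (size r)%:R * \sum_(i <- r) x i ^+ 2.
Proof.
rewrite expr2 big_distrl /=.
have -> : (size r)%:R * \sum_(i <- r) x i ^+ 2 =
    \sum_(i <- r) \sum_(j <- r) ((x i ^+ 2 + x j ^+ 2) / 2).
  have c (a : R) : \sum_(j <- r) a = (size r)%:R * a.
    by rewrite big_const_seq count_predT iter_addr_0 mulr_natl.
  under [RHS]eq_bigr => i _ do rewrite -mulr_suml big_split /= c.
  by rewrite -mulr_suml big_split /= c -big_distrr /=; field.
apply: ler_sum => i _; rewrite big_distrr /=; apply: ler_sum => j _.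
by have := sqr_ge0 (x i - x j); rewrite sqrrB mulr2n; lra.
Qed.

(** Opening the square and exchanging the sums turns a mean square over i into
    correlations of the rows j1 and j2. *)
Lemma sum_sqr_norm_le (I J : Type) (r : seq I) (s : seq J) (G : I -> J -> R[i]) :
  \sum_(i <- r) normc (\sum_(j <- s) G i j) ^+ 2 <=
  \sum_(j1 <- s) \sum_(j2 <- s) normc (\sum_(i <- r) G i j1 * (G i j2)^*%C).
Proof.
have -> : \sum_(i <- r) normc (\sum_(j <- s) G i j) ^+ 2 =
   complex.Re (\sum_(j1 <- s) \sum_(j2 <- s) \sum_(i <- r) G i j1 * (G i j2)^*%C).
  rewrite -[LHS]/(complex.Re (_%:C)%C) rmorph_sum; congr complex.Re.
  under eq_bigr => i _ do rewrite /= normc_sqr_sum_diag.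
  by rewrite exchange_big /=; apply: eq_bigr => j _; rewrite exchange_big.
apply: le_trans (ler_norm _) _; apply: le_trans (normc_re _) _.
apply: le_trans (normc_sum _ _ _) _; apply: ler_sum => j1 _; exact: normc_sum.
Qed.

End KusminLandau.

(** * Weyl--van der Corput differencing *)

Section Differencing.
Context {R : realType}.

(** In each row of a Toeplitz array every nonzero distance occurs at most twice. *)
Lemma sum_dist_le (T : nat -> R) (k Q : nat) : (forall q, 0 <= T q) -> (k < Q)%N ->
  \sum_(0 <= l < Q) T ((k - l) + (l - k))%N <= T 0%N + 2 * \sum_(1 <= q < Q) T q.
Proof.
move=> T0 kQ.
rewrite (@big_cat_nat _ _ _ k) //=; last exact: ltnW.
rewrite (big_ltn kQ) subnn addn0 /=.
have mono a b : (a <= b)%N -> \sum_(1 <= q < a) T q <= \sum_(1 <= q < b) T q.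
  case: a => [_|a ab]; first by rewrite big_geq // sumr_ge0.
  by rewrite [leRHS](@big_cat_nat _ _ _ a.+1) //= lerDl sumr_ge0.
have h1 : \sum_(0 <= l < k) T (k - l + (l - k))%N <= \sum_(1 <= q < Q) T q.
  rewrite big_nat_rev /= add0n.
  apply: le_trans (mono k.+1 Q kQ); rewrite big_add1 /=.
  by apply: ler_sum_nat => i /andP[_ ik]; rewrite le_eqVlt; apply/orP; left; apply/eqP; congr T; lia.
have h2 : \sum_(k.+1 <= l < Q) T (k - l + (l - k))%N <= \sum_(1 <= q < Q) T q.
  apply: le_trans (mono (Q - k)%N Q (leq_subr _ _)).
  rewrite -{1}(addn1 k) addnC big_addn.
  by apply: ler_sum_nat => i /andP[i1 ik]; rewrite le_eqVlt; apply/orP; left; apply/eqP; congr T; lia.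
lra.
Qed.

Lemma sum_shift_support (w : nat -> R[i]) (a b k M : nat) :
  (forall i, ~~ (a <= i < b)%N -> w i = 0) -> (k <= a)%N -> (b <= M + k)%N ->
  \sum_(0 <= m < M) w (m + k)%N = \sum_(a <= i < b) w i.
Proof.
move=> h ka bM.
have -> : \sum_(0 <= m < M) w (m + k)%N = \sum_(k <= i < M + k) w i.
  by rewrite -{2}(add0n k) big_addn addnK.
have [ab|ba] := leqP a b.
  rewrite (@big_cat_nat _ _ _ a) //=; last exact: leq_trans bM.
  rewrite (@big_cat_nat _ _ _ b _ (M + k)) //=.
  rewrite big_nat big1 ?add0r => [|i ?]; last by rewrite h //; lia.
  rewrite [X in _ + X]big_nat [X in _ + X]big1 ?addr0 // => i ?; rewrite h //; lia.
rewrite [RHS]big_geq ?(ltnW ba) // big_nat big1 // => i ?; rewrite h //; lia.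
Qed.

(** Weyl--van der Corput differencing: Q times the sum is the sum of the averages
    of z over windows of length Q, and Cauchy--Schwarz over the at most N + Q windows
    leaves the correlations of z with its shifts by q < Q. *)
Lemma weyl_vdc (z : nat -> R[i]) (N N' Q : nat) :
  (forall n, normc (z n) <= 1) -> (N' <= N)%N -> (0 < Q <= N)%N ->
  normc (\sum_(0 <= n < N') z n) ^+ 2 <=
  2 * N%:R / Q%:R * (N%:R + 2 * \sum_(1 <= q < Q)
     normc (\sum_(0 <= n < N' - q) z (n + q)%N * (z n)^*%C)).
Proof.
move=> z1 N'N /andP[Q0 QN].
set S := \sum_(0 <= n < N') z n.
pose T q := normc (\sum_(0 <= n < N' - q) z (n + q)%N * (z n)^*%C).
(* z moved to [Q, Q + N') and extended by 0, so that all the shifts by k <= Q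
   below stay within the natural numbers. *)
pose w i := if (Q <= i < Q + N')%N then z (i - Q)%N else 0.
have wS k : (k <= Q)%N -> \sum_(0 <= m < N' + Q) w (m + k)%N = S.
  move=> kQ; rewrite (@sum_shift_support w Q (Q + N')); last 3 first.
  - by move=> i /negbTE hi; rewrite /w hi.
  - by [].
  - lia.
  rewrite -{1}(add0n Q) big_addn addKn; apply: eq_big_nat => i /andP[_ hi].
  by rewrite /w addnK ifT //; lia.
have T0 q : 0 <= T q by apply: normc_ge0.
have corr l k : (l <= k < Q)%N ->
    normc (\sum_(0 <= m < N' + Q) w (m + k)%N * (w (m + l)%N)^*%C) = T (k - l)%N.
  move=> /andP[lk kQ].
  pose w2 i := w (i + (k - l))%N * (w i)^*%C.
  have -> : \sum_(0 <= m < N' + Q) w (m + k)%N * (w (m + l)%N)^*%C =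
      \sum_(0 <= m < N' + Q) w2 (m + l)%N.
    apply: eq_bigr => m _; rewrite /w2; congr (w _ * _); lia.
  rewrite (@sum_shift_support w2 Q (Q + (N' - (k - l)))); last 3 first.
  - move=> i hi; rewrite /w2 /w; case: ifP => h1; case: ifP => h2; rewrite ?mul0r ?conjc0 ?mulr0 //.
    by move: hi h1 h2; lia.
  - lia.
  - lia.
  rewrite -{1}(add0n Q) big_addn addKn; congr normc; apply: eq_big_nat => i /andP[_ hi].
  rewrite /w2 /w addnK !ifT; [|lia|lia].
  by congr (z _ * _); lia.
have corr2 k l : (k < Q)%N -> (l < Q)%N ->
    normc (\sum_(0 <= m < N' + Q) w (m + k)%N * (w (m + l)%N)^*%C) = T ((k - l) + (l - k))%N.
  move=> kQ lQ; have [lk|kl] := leqP l k.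
    by rewrite corr ?lk //; congr T; lia.
  rewrite -normc_conj rmorph_sum /=.
  under eq_bigr => m _ do rewrite rmorphM /= conjcK mulrC.
  rewrite corr ?(ltnW kl) //; congr T; lia.
have QS : Q%:R * normc S <= \sum_(0 <= m < N' + Q) normc (\sum_(0 <= k < Q) w (m + k)%N).
  have -> : Q%:R * normc S = normc (\sum_(0 <= k < Q) \sum_(0 <= m < N' + Q) w (m + k)%N).
    have -> : \sum_(0 <= k < Q) \sum_(0 <= m < N' + Q) w (m + k)%N = \sum_(0 <= k < Q) S.
      by apply: eq_big_nat => k /andP[_ kQ]; rewrite wS // ltnW.
    by rewrite big_const_nat iter_addr_0 subn0 -[S *+ _]mulr_natl normcM normc_nat.
  by rewrite exchange_big /=; apply: normc_sum.
have sq : \sum_(0 <= m < N' + Q) normc (\sum_(0 <= k < Q) w (m + k)%N) ^+ 2 <=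
    Q%:R * (N%:R + 2 * \sum_(1 <= q < Q) T q).
  apply: le_trans (sum_sqr_norm_le _ _ _) _.
  rewrite -[Q in Q%:R]subn0; apply: sum_le_const => k /andP[_ kQ].
  have -> : \sum_(0 <= l < Q) normc (\sum_(0 <= m < N' + Q) w (m + k)%N * (w (m + l)%N)^*%C)
      = \sum_(0 <= l < Q) T ((k - l) + (l - k))%N.
    by apply: eq_big_nat => l /andP[_ lQ]; rewrite corr2.
  apply: le_trans (sum_dist_le T0 kQ) _; rewrite lerD2r.
  apply: le_trans (normc_sum _ _ _) _.
  apply: le_trans (_ : (N' - 0 - 0)%:R * 1 <= _); last by rewrite mulr1 !subn0 ler_nat.
  apply: sum_le_const => n _; rewrite normcM normc_conj -[leRHS]mulr1.
  by apply: ler_pM; rewrite ?normc_ge0.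
have Qp : 0 < Q%:R :> R by rewrite ltr0n.
set X := N%:R + _ in sq *.
have X0 : 0 <= X by rewrite addr_ge0 // mulr_ge0 // sumr_ge0.
have main : (Q%:R * normc S) ^+ 2 <= (N' + Q)%:R * (Q%:R * X).
  apply: le_trans (_ : (\sum_(0 <= m < N' + Q) normc (\sum_(0 <= k < Q) w (m + k)%N)) ^+ 2 <= _).
    by rewrite ler_sqr ?nnegrE ?QS // ?mulr_ge0 ?normc_ge0 // sumr_ge0 // => i _; exact: normc_ge0.
  apply: le_trans (cauchy_sum _ _) _.
  by rewrite size_iota subn0 ler_wpM2l.
have main2 : (N' + Q)%:R * (Q%:R * X) <= (2 * N%:R) * (Q%:R * X).
  rewrite ler_wpM2r ?mulr_ge0 // ?(ltW Qp) // -natrM ler_nat; lia.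
rewrite -(@ler_pM2l _ (Q%:R ^+ 2)) ?exprn_gt0 // -exprMn.
apply: le_trans main _; apply: le_trans main2 _.
rewrite le_eqVlt; apply/orP; left; apply/eqP; field.
by rewrite gt_eqF.
Qed.

End Differencing.

Section DifferenceTest.
Context {R : realType}.

Definition harm (n : nat) : R := \sum_(1 <= r < n) r%:R^-1.

Definition mixed_diff (f : nat -> R) (q r n : nat) : R :=
  f (n + r + q)%N - f (n + r)%N - (f (n + q)%N - f n).

(** Third derivative test in difference form. Two Weyl differencings, with shifts
    q < Q and r < P, turn the phase f into its mixed second difference, whose own
    increments lie between q r lam and q r mu; these are at most 1/2 as soon as
    Q P mu <= 1/2, and the Kusmin--Landau inequality then bounds the innermost sum by
    a constant over q r lam. The mean square over q makes a fourth power natural. *)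
Lemma third_difference_test (f : nat -> R) (N N' Q P : nat) (lam mu et L : R) :
  0 < lam <= mu -> 0 <= et -> (N' <= N)%N -> (0 < Q <= N)%N -> (0 < P <= N)%N ->
  Q%:R * P%:R * mu <= 1 / 2 -> harm Q <= L -> harm P <= L ->
  (forall q r n, (0 < q)%N -> (0 < r)%N -> (n + r + q + 1 < N')%N ->
     q%:R * r%:R * lam <= mixed_diff f q r n.+1 - mixed_diff f q r n <= q%:R * r%:R * mu) ->
  (forall q r n, (0 < q)%N -> (0 < r)%N -> (n + r + q + 2 < N')%N ->
     `|mixed_diff f q r n.+2 - mixed_diff f q r n.+1 - (mixed_diff f q r n.+1 - mixed_diff f q r n)|
       <= q%:R * r%:R * et) ->
  normc (\sum_(0 <= n < N') cexp (f n)) ^+ 4 <=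
  8 * N%:R ^+ 4 * (1 / Q%:R ^+ 2 + 8 / P%:R
     + 16 * (3 / lam + N%:R * et / lam ^+ 2) * L ^+ 2 / (N%:R * Q%:R * P%:R)).
Proof.
move=> /andP[lam0 lammu] et0 N'N QN PN QPmu hQ hP h3 h4.
set K := 3 / lam + N%:R * et / lam ^+ 2.
have K0 : 0 <= K by rewrite addr_ge0 ?divr_ge0 ?mulr_ge0 ?sqr_ge0 // ltW.
have Qp : 0 < Q%:R :> R by rewrite ltr0n; case/andP: QN.
have Pp : 0 < P%:R :> R by rewrite ltr0n; case/andP: PN.
have Np : 0 < N%:R :> R by rewrite ltr0n; case/andP: QN => /leq_trans h /h.
have L0 : 0 <= L by apply: le_trans hQ; apply: sumr_ge0 => r _; rewrite invr_ge0.
pose S q := normc (\sum_(0 <= n < N' - q) cexp (f (n + q)%N - f n)).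
have hSqr q r : (0 < q < Q)%N -> (0 < r < P)%N ->
    normc (\sum_(0 <= n < N' - q - r) cexp (mixed_diff f q r n)) <= K / q%:R * r%:R^-1.
  move=> /andP[q0 qQ] /andP[r0 rP].
  have qp : 0 < q%:R :> R by rewrite ltr0n.
  have rp : 0 < r%:R :> R by rewrite ltr0n.
  have qrm : q%:R * r%:R * mu <= 1 / 2.
    apply: le_trans QPmu; rewrite ler_wpM2r //; first by lra.
    by rewrite -!natrM ler_nat leq_mul // ltnW.
  apply: le_trans (@kusmin_landau R (mixed_diff f q r) _ (q%:R * r%:R * lam) (q%:R * r%:R * et) _ _ _ _) _.
  - rewrite !mulr_gt0 //=; apply: le_trans qrm; rewrite ler_wpM2l // mulr_ge0 // ltW.
  - by rewrite !mulr_ge0 // ltW.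
  - move=> n hn; have hn' : (n + r + q + 1 < N')%N by move: hn; clear; lia.
    have /andP[a1 a2] := h3 q r n q0 r0 hn'.
    by rewrite a1 (le_trans a2).
  - by move=> n hn; apply: h4 => //; move: hn; clear; lia.
  have -> : K / q%:R * r%:R^-1 = 3 / (q%:R * r%:R * lam) +
       N%:R * (q%:R * r%:R * et) / (q%:R * r%:R * lam) ^+ 2.
    by rewrite /K; field; rewrite !gt_eqF.
  rewrite lerD2l ler_wpM2r ?invr_ge0 ?sqr_ge0 // ler_wpM2r ?mulr_ge0 ?(ltW qp) ?(ltW rp) //.
  by rewrite ler_nat; move: N'N; clear; lia.
have hSq q : (0 < q < Q)%N -> S q ^+ 2 <= 2 * N%:R / P%:R * (N%:R + 2 * (K / q%:R * L)).
  move=> hq; have q0 : (0 < q)%N by case/andP: hq.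
  apply: le_trans (@weyl_vdc R (fun n => cexp (f (n + q)%N - f n)) N (N' - q) P _ _ PN) _.
  - by move=> n; rewrite normc_cexp.
  - by move: N'N; clear; lia.
  rewrite ler_wpM2l ?divr_ge0 ?mulr_ge0 ?(ltW Pp) //.
  rewrite lerD2l ler_pM2l //.
  apply: le_trans (_ : \sum_(1 <= r < P) K / q%:R * r%:R^-1 <= _); last first.
    by rewrite -big_distrr /= ler_wpM2l // divr_ge0.
  apply: ler_sum_nat => r hr; apply: le_trans (hSqr q r hq hr).
  rewrite le_eqVlt; apply/orP; left; apply/eqP; congr normc; apply: eq_bigr => n _.
  by rewrite /= -cexpB; congr cexp; rewrite /mixed_diff.
have hsum : (\sum_(1 <= q < Q) S q) ^+ 2 <=
    Q%:R * (2 * N%:R / P%:R * (Q%:R * N%:R + 2 * (K * L * L))).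
  apply: le_trans (cauchy_sum _ _) _; rewrite size_iota.
  have c0 : 0 <= 2 * N%:R / P%:R :> R by rewrite divr_ge0 ?mulr_ge0 // ltW.
  apply: ler_pM => //; first by apply: sumr_ge0 => q _; rewrite sqr_ge0.
    by rewrite ler_nat leq_subr.
  apply: le_trans (_ : \sum_(1 <= q < Q) 2 * N%:R / P%:R * (N%:R + 2 * (K / q%:R * L)) <= _).
    by apply: ler_sum_nat => q hq; apply: hSq.
  rewrite -big_distrr /= ler_wpM2l // big_split /= lerD //.
    apply: le_trans (_ : (Q - 1)%:R * N%:R <= _); first exact: sum_le_const.
    by rewrite ler_wpM2r ?(ltW Np) // ler_nat leq_subr.
  rewrite -big_distrr /= ler_pM2l //.
  under eq_bigr => q _ do rewrite mulrAC.
  by rewrite -big_distrr /= ler_wpM2l // mulr_ge0.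
have := @weyl_vdc R (fun n => cexp (f n)) N N' Q.
move=> /(_ _ N'N QN).
have -> : \sum_(1 <= q < Q) normc (\sum_(0 <= n < N' - q) cexp (f (n + q)%N) * (cexp (f n))^*%C)
    = \sum_(1 <= q < Q) S q.
  apply: eq_bigr => q _; congr normc; apply: eq_bigr => n _.
  by rewrite -cexpB.
set T := \sum_(1 <= q < Q) S q in hsum *.
have T0 : 0 <= T by apply: sumr_ge0 => q _; apply: normc_ge0.
set s := normc _.
move=> /(_ _) hs.
have {}hs : s ^+ 2 <= 2 * N%:R / Q%:R * (N%:R + 2 * T).
  by apply: hs => n; rewrite normc_cexp.
have -> : s ^+ 4 = (s ^+ 2) ^+ 2 by rewrite -exprM.
apply: le_trans (_ : (2 * N%:R / Q%:R * (N%:R + 2 * T)) ^+ 2 <= _).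
  by rewrite ler_sqr ?nnegrE ?sqr_ge0 // mulr_ge0 ?divr_ge0 ?addr_ge0 ?mulr_ge0 // ltW.
apply: le_trans (_ : (2 * N%:R / Q%:R) ^+ 2 * (2 * N%:R ^+ 2 + 8 * T ^+ 2) <= _).
  rewrite exprMn ler_wpM2l ?sqr_ge0 //.
  by have := sqr_ge0 (N%:R - 2 * T); nra.
apply: le_trans (_ : (2 * N%:R / Q%:R) ^+ 2 * (2 * N%:R ^+ 2 +
    8 * (Q%:R * (2 * N%:R / P%:R * (Q%:R * N%:R + 2 * (K * L * L))))) <= _).
  by rewrite ler_wpM2l ?sqr_ge0 // lerD2l ler_pM2l.
rewrite le_eqVlt; apply/orP; left; apply/eqP; field.
by rewrite !gt_eqF.
Qed.

End DifferenceTest.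

(** * From derivatives to differences, and the third derivative test *)

Section ThirdDerivative.
Context {R : realType}.

Fixpoint iter_diff (hs : seq R) (g : R -> R) : R -> R :=
  if hs is h :: hs' then iter_diff hs' (fun t => g (t + h) - g t) else g.

(** Each difference with step h trades one derivative for a factor h. *)
Lemma iter_diff_bounds (hs : seq R) (F : nat -> R -> R) (u v l m : R) :
  all (>= 0) hs ->
  (forall i t, (i < size hs)%N -> u <= t <= v -> is_derive t 1 (F i) (F i.+1 t)) ->
  (forall t, u <= t <= v -> l <= F (size hs) t <= m) ->
  forall t, u <= t -> t + \sum_(h <- hs) h <= v ->
  (\prod_(h <- hs) h) * l <= iter_diff hs (F 0%N) t <= (\prod_(h <- hs) h) * m.
Proof.
elim: hs F v l m => [|h hs ih] F v l m /=.
  move=> _ _ hb t ut; rewrite !big_nil addr0 !mul1r => tv; apply: hb.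
  by rewrite ut tv.
move=> /andP[h0 hs0] hd hb t ut; rewrite !big_cons => tv.
have := @ih (fun i t => F i (t + h) - F i t) (v - h) (h * l) (h * m) hs0.
rewrite mulrCA mulrA mulrCA mulrA; apply => //.
- move=> i x hi /andP[ux xv].
  have h1 : is_derive x 1 (F i) (F i.+1 x) by apply: hd; [exact: ltnW|lra].
  have h2 : is_derive (x + h) 1 (F i) (F i.+1 (x + h)) by apply: hd; [exact: ltnW|lra].
  have h3 : is_derive x 1 (fun t => t + h) 1.
    by apply: is_derive_eq; rewrite addr0.
  have h4 := @is_derive1_comp R (F i) (fun t => t + h) x _ _ h2 h3; rewrite mulr1 in h4.
  exact: is_deriveB.
- move=> x /andP[ux xv].
  have xh : x <= x + h by lra.
  have := @mvt_bounds R (F (size hs)) (F (size hs).+1) x (x + h) l m xh.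
  rewrite addrAC subrr add0r (mulrC l) (mulrC m); apply.
  + by move=> y /andP[y1 y2]; apply: hd => //; lra.
  + by move=> y /andP[y1 y2]; apply: hb; lra.
- lra.
Qed.

Lemma harm_ge0 n : 0 <= harm n :> R.
Proof. by apply: sumr_ge0 => r _; rewrite invr_ge0. Qed.

(** 1 / (n + 1) <= ln (n + 1) - ln n, by concavity of the logarithm. *)
Lemma harm_le n : (0 < n)%N -> harm n <= 1 + ln n%:R :> R.
Proof.
case: n => // -[|n] _; first by rewrite /harm big_geq // ln1 addr0.
apply: le_trans (_ : 1 + ln n.+1%:R <= _); last first.
  by rewrite lerD2l ler_ln ?posrE // ler_nat.
elim: n => [|n ih]; first by rewrite /harm big_nat1 invr1 ln1 addr0.
rewrite /harm big_nat_recr //=; apply: le_trans (lerD ih (lexx _)) _.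
rewrite -addrA lerD2l.
have h := @le_ln1Dx R (- n.+2%:R^-1).
have n2 : 0 < n.+2%:R^-1 :> R by rewrite invr_gt0.
have n3 : n.+2%:R^-1 < 1 :> R by rewrite invf_lt1 // ltr1n.
have n4 : -1 < - n.+2%:R^-1 :> R by rewrite ltrN2.
have {}h := h n4.
have e : 1 - n.+2%:R^-1 = n.+1%:R / n.+2%:R :> R.
  have : n.+2%:R != 0 :> R by [].
  by rewrite -(natr1 n.+1); set a := n.+1%:R => a0; field.
rewrite e ln_div ?posrE // in h.
by rewrite -lerBrDl -[leRHS]opprB lerNr.
Qed.

Lemma iter_diff3 (g : R -> R) (a q r n : nat) :
  mixed_diff (fun m => g (a + m)%:R) q r n.+1 - mixed_diff (fun m => g (a + m)%:R) q r n
  = iter_diff [:: q%:R; r%:R; 1] g (a + n)%:R.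
Proof.
rewrite /mixed_diff /= !natr1 -!natrD.
by congr (_ - _ - (_ - _) - (_ - _ - (_ - _))); congr g; congr _%:R; lia.
Qed.

Lemma iter_diff4 (g : R -> R) (a q r n : nat) :
  mixed_diff (fun m => g (a + m)%:R) q r n.+2 - mixed_diff (fun m => g (a + m)%:R) q r n.+1
  - (mixed_diff (fun m => g (a + m)%:R) q r n.+1 - mixed_diff (fun m => g (a + m)%:R) q r n)
  = iter_diff [:: q%:R; r%:R; 1; 1] g (a + n)%:R.
Proof.
rewrite !iter_diff3 /= !natr1 -!natrD.
by congr (_ - _ - (_ - _) - (_ - _ - (_ - _)) - _); congr g; congr _%:R; lia.
Qed.

(** For the phases in use the third derivative lies between low_const lam and 6 lam
    when the variable runs over [A, 2 A], and the fourth is at most 24 lam / A. *)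
Definition low_const : R := 6 / (64 * 64).
(** The Kusmin--Landau bound for increments low_const lam and second differences
    24 lam / A over A terms is kl_const / lam. *)
Definition kl_const : R := 3 / low_const + 24 / low_const ^+ 2.

Lemma third_derivative_test (F : nat -> R -> R) (A A1 A2 Q P : nat) (lam L : R) :
  (0 < A)%N -> (A <= A1)%N -> (A2 <= A + A)%N -> 0 < lam ->
  (forall i (t : R), (i < 4)%N -> A%:R <= t <= A%:R + A%:R -> is_derive t 1 (F i) (F i.+1 t)) ->
  (forall t : R, A%:R <= t <= A%:R + A%:R -> low_const * lam <= F 3%N t <= 6 * lam) ->
  (forall t : R, A%:R <= t <= A%:R + A%:R -> `|F 4%N t| <= 24 * lam / A%:R) ->
  (0 < Q <= A)%N -> (0 < P <= A)%N -> Q%:R * P%:R * lam <= 1 / 12 ->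
  harm A <= L ->
  normc (\sum_(A1 <= n < A2) cexp (F 0%N n%:R)) ^+ 4 <=
  8 * A%:R ^+ 4 * (1 / Q%:R ^+ 2 + 8 / P%:R
     + 16 * (kl_const / lam) * L ^+ 2 / (A%:R * Q%:R * P%:R)).
Proof.
move=> A0 AA1 A2A lam0 hd h3 h4 QA PA QP hL.
have Ap : 0 < A%:R :> R by rewrite ltr0n.
have c0 : 0 < low_const by rewrite /low_const; lra.
have harm_mono n : (n <= A)%N -> harm n <= L.
  move=> nA; apply: le_trans hL; rewrite /harm.
  case: n nA => [_|n nA]; first by rewrite big_geq // harm_ge0.
  by rewrite [leRHS](@big_cat_nat _ _ _ n.+1) //= lerDl sumr_ge0.
have -> : \sum_(A1 <= n < A2) cexp (F 0%N n%:R) =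
    \sum_(0 <= n < A2 - A1) cexp (F 0%N (A1 + n)%:R).
  by rewrite -{1}(add0n A1) big_addn; under eq_bigr => n _ do rewrite addnC.
have -> : kl_const / lam = 3 / (low_const * lam) + A%:R * (24 * lam / A%:R) / (low_const * lam) ^+ 2.
  by rewrite /kl_const; field; rewrite !gt_eqF.
apply: (@third_difference_test R (fun n => F 0%N (A1 + n)%:R) A (A2 - A1) Q P
  (low_const * lam) (6 * lam) (24 * lam / A%:R) L) => //.
- by rewrite mulr_gt0 //= ler_wpM2r ?(ltW lam0) // /low_const; lra.
- by rewrite divr_ge0 ?mulr_ge0 // ltW.
- by move: AA1 A2A; clear; lia.
- by move: QP; set x := _ * _%:R; lra.
- by apply: harm_mono; case/andP: QA.
- by apply: harm_mono; case/andP: PA.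
- move=> q r n q0 r0 hn; rewrite iter_diff3.
  have g1 : all (>= 0) [:: q%:R; r%:R; 1 : R] by rewrite /= !ler0n ler01.
  have g2 i (t : R) : (i < 3)%N -> A%:R <= t <= A%:R + A%:R -> is_derive t 1 (F i) (F i.+1 t).
    by move=> hi; apply: hd; apply: leq_trans hi _.
  have g3 : A%:R <= (A1 + n)%:R :> R by rewrite ler_nat; move: AA1; clear; lia.
  have := @iter_diff_bounds [:: q%:R; r%:R; 1] F _ _ _ _ g1 g2 h3 _ g3.
  rewrite !big_cons !big_nil !mulr1 addr0; apply.
  rewrite !natr1 -!natrD ler_nat; move: AA1 A2A hn; clear; lia.
- move=> q r n q0 r0 hn; rewrite iter_diff4.
  have g1 : all (>= 0) [:: q%:R; r%:R; 1 : R; 1] by rewrite /= !ler0n ler01.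
  have g3 : A%:R <= (A1 + n)%:R :> R by rewrite ler_nat; move: AA1; clear; lia.
  have h4' t : A%:R <= t <= A%:R + A%:R -> - (24 * lam / A%:R) <= F 4%N t <= 24 * lam / A%:R.
    by move=> /h4; rewrite ler_norml.
  have := @iter_diff_bounds [:: q%:R; r%:R; 1; 1] F _ _ _ _ g1 hd h4' _ g3.
  rewrite !big_cons !big_nil !mulr1 addr0 !mulrN ?mulrA => h; rewrite ler_norml ?mulrA; apply: h.
  have e2 : 1 + 1 = 2%:R :> R by rewrite -natr1.
  rewrite e2 -!natrD ler_nat; move: AA1 A2A hn; clear; lia.
Qed.

End ThirdDerivative.

Section TestInPowers.
Context {R : realType}.

Lemma kl_const_gt0 : 0 < kl_const :> R.
Proof.
have c0 : 0 < low_const :> R by rewrite /low_const; lra.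
by rewrite /kl_const addr_gt0 ?divr_gt0 ?exprn_gt0.
Qed.

Definition test_const (k : R) : R := 8 * (8 * 24 * 32 + 20 + 32 * 24 * kl_const * k).

Lemma le_of_exp4_le (a b : R) : 0 <= b -> a ^+ 4 <= b ^+ 4 -> a <= b.
Proof.
move=> b0 h; have [a0|/ltW a0] := leP 0 a; last exact: le_trans b0.
by rewrite -(@ler_pXn2r _ 4) ?nnegrE.
Qed.

Lemma test_const_ge1 (k : R) : 0 <= k -> 1 <= test_const k.
Proof.
move=> k0; have : 0 <= kl_const * k by rewrite mulr_ge0 // ltW // kl_const_gt0.
by rewrite /test_const; lra.
Qed.

Lemma truncn_half (w : R) : 1 <= w ->
  w / 2 <= (Num.truncn w)%:R <= w.
Proof.
move=> w1; have /andP[h1 h2] := truncn_itv (le_trans ler01 w1).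
rewrite h1 andbT; have : 1 <= (Num.truncn w)%:R :> R by rewrite ler1n truncn_gt0.
rewrite -natr1 in h2; lra.
Qed.

Lemma ln_le_pow (z : R) (k n : nat) : 1 <= z -> (0 < n)%N -> n%:R <= z ^+ k -> 1 + ln n%:R <= k.+1%:R * z.
Proof.
move=> z1 n0 nz; have z0 : 0 < z by lra.
have h : ln n%:R <= k%:R * z.
  apply: le_trans (_ : ln (z ^+ k) <= _).
    by rewrite ler_ln ?posrE ?exprn_gt0 ?ltr0n.
  rewrite lnXn // mulr_natl ler_wMn2r //.
  exact: ltW (ln_sublinear z0).
by rewrite -natr1 mulrDl mul1r addrC lerD.
Qed.

(** The third derivative test with all sizes expressed through one large z. With
    Q of order z^103 and P = min (A, 1 / (12 Q lam)), each of 1 / Q^2, 1 / P and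
    1 / (lam A Q P) is O(z^(-99)): the lower bound on lam serves the last one when
    P = A, the upper bound on lam serves the second one when P < A. The squared
    logarithm costs z^2, and a fourth root leaves a saving of z^24. *)
Lemma third_derivative_test_pow (z : R) (F : nat -> R -> R) (A A1 A2 : nat) (lam k : R) :
  100 <= z -> 0 <= k -> (1 + ln A%:R) ^+ 2 <= k * z ^+ 2 -> z ^+ 227 <= 2 * A%:R -> 
  1 <= lam * A%:R ^+ 2 * z ^+ 4 -> lam * z ^+ 203 <= 32 ->
  (A <= A1)%N -> (A2 <= A + A)%N ->
  (forall i (t : R), (i < 4)%N -> A%:R <= t <= A%:R + A%:R -> is_derive t 1 (F i) (F i.+1 t)) ->
  (forall t : R, A%:R <= t <= A%:R + A%:R -> low_const * lam <= F 3%N t <= 6 * lam) ->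
  (forall t : R, A%:R <= t <= A%:R + A%:R -> `|F 4%N t| <= 24 * lam / A%:R) ->
  normc (\sum_(A1 <= n < A2) cexp (F 0%N n%:R)) * z ^+ 24 <= test_const k * A%:R.
Proof.
move=> z100 k0 L2 Alo lamlo lamhi AA1 A2A hd h3 h4.
have z1 : 1 <= z by move: z100; clear; lra.
have z0 : 0 < z by move: z100; clear; lra.
have zp j : 0 < z ^+ j by rewrite exprn_gt0.
have zge1 j : 1 <= z ^+ j by rewrite exprn_ege1.
have zmono a b : (a <= b)%N -> z ^+ a <= z ^+ b by move=> ab; rewrite ler_weXn2l.
have Ap : 0 < A%:R :> R by have := zp 227%N; lra.
have A0 : (0 < A)%N by rewrite -(ltr0n R).
have lam0 : 0 < lam.
  rewrite ltNge; apply/negP => l0; have : lam * (A%:R ^+ 2 * z ^+ 4) <= 0.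
    by rewrite mulr_le0_ge0 // mulr_ge0 ?sqr_ge0 // ltW.
  by rewrite mulrA; lra.
pose Q := Num.truncn (z ^+ 103).
have /andP[Qlo Qhi] := truncn_half (zge1 103%N); rewrite -/Q in Qlo Qhi.
have Qp : 0 < Q%:R :> R by have := zp 103%N; lra.
have QA : (0 < Q <= A)%N.
  rewrite -(ltr0n R) Qp -(ler_nat R) /=; apply: le_trans Qhi _.
  have := ler_pM ler01 (ltW (zp 103%N)) z1 (zmono 103%N 226%N isT).
  rewrite mul1r -exprS => h; have : z * z ^+ 103 <= z ^+ 227 by rewrite -exprS zmono.
  have : 100 * z ^+ 103 <= z * z ^+ 103 by rewrite ler_wpM2r // ltW.
  have := zp 103%N; lra.
pose L : R := 1 + ln A%:R.
have hL : harm A <= L by exact: harm_le.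
have L0 : 0 <= L by apply: le_trans hL; exact: harm_ge0.
have K0 := kl_const_gt0.
have zE a b : z ^+ (a + b) = z ^+ a * z ^+ b by rewrite exprD.
(* It remains to choose the second differencing length P. *)
suff [P PA [PQ hP]] : exists2 P : nat, (0 < P <= A)%N & Q%:R * P%:R * lam <= 1 / 12 /\
   (1 / Q%:R ^+ 2 + 8 / P%:R + 16 * (kl_const / lam) * L ^+ 2 / (A%:R * Q%:R * P%:R)) * z ^+ 97
     <= test_const k / 8.
  have h := third_derivative_test A0 AA1 A2A lam0 hd h3 h4 QA PA PQ hL.
  set s := normc _ in h *; have s0 : 0 <= s by exact: normc_ge0.
  have C1 := test_const_ge1 k0.
  have C0 : 0 <= test_const k by exact: le_trans C1.
  apply: le_of_exp4_le; first by rewrite mulr_ge0.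
  have -> : (s * z ^+ 24) ^+ 4 = s ^+ 4 * z ^+ 96 by rewrite exprMn -exprM.
  rewrite [in leRHS]exprMn.
  apply: le_trans (_ : test_const k * A%:R ^+ 4 <= _); last first.
    rewrite ler_wpM2r ?exprn_ge0 //.
    by have := ler_weXn2l C1 (isT : (1 <= 4)%N); rewrite expr1.
  apply: le_trans (_ : s ^+ 4 * z ^+ 97 <= _).
    by rewrite ler_wpM2l ?exprn_ge0 // zmono.
  apply: le_trans (ler_wpM2r (ltW (zp 97%N)) h) _.
  rewrite -[leLHS]mulrA; apply: le_trans (_ : 8 * A%:R ^+ 4 * (test_const k / 8) <= _).
    by rewrite ler_wpM2l // mulr_ge0 ?exprn_ge0.
  by rewrite le_eqVlt; apply/orP; left; apply/eqP; field.
have T1 : 1 / Q%:R ^+ 2 * z ^+ 97 <= 4.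
  rewrite mul1r mulrC ler_pdivrMr ?exprn_gt0 //.
  have : (z ^+ 103 / 2) ^+ 2 <= Q%:R ^+ 2.
    by rewrite ler_sqr ?nnegrE ?(ltW Qp) // divr_ge0 // ltW.
  rewrite exprMn -exprM /= => h; have := zmono 97%N (103 * 2)%N isT.
  by move: h; rewrite exprVn; lra.
have T3 (B : R) : 0 <= B -> forall P : nat, (0 < P)%N -> 1 / lam / (A%:R * Q%:R * P%:R) * z ^+ 99 <= B ->
   16 * (kl_const / lam) * L ^+ 2 / (A%:R * Q%:R * P%:R) * z ^+ 97 <= 16 * kl_const * k * B.
  move=> B0 P P0 hB; have Pp : 0 < P%:R :> R by rewrite ltr0n.
  have -> : 16 * (kl_const / lam) * L ^+ 2 / (A%:R * Q%:R * P%:R) * z ^+ 97 =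
    16 * kl_const * L ^+ 2 * (1 / lam / (A%:R * Q%:R * P%:R) * z ^+ 97).
    by field; rewrite !gt_eqF.
  apply: le_trans (_ : 16 * kl_const * (k * z ^+ 2) * (1 / lam / (A%:R * Q%:R * P%:R) * z ^+ 97) <= _).
    have u0 : 0 <= 1 / lam / (A%:R * Q%:R * P%:R) * z ^+ 97.
      apply: mulr_ge0; last exact: ltW.
      by apply: divr_ge0; [apply: divr_ge0 => //; exact: ltW|rewrite !mulr_ge0].
    apply: ler_wpM2r => //.
    by apply: ler_wpM2l => //; rewrite mulr_ge0 ?(ltW K0).
  have -> : 16 * kl_const * (k * z ^+ 2) * (1 / lam / (A%:R * Q%:R * P%:R) * z ^+ 97)
    = 16 * kl_const * k * (1 / lam / (A%:R * Q%:R * P%:R) * z ^+ 99).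
    rewrite (zE 2%N 97%N); ring.
  by rewrite ler_wpM2l // !mulr_ge0 ?(ltW K0).
(* P = A if the third differences stay below 1/2 for that choice; otherwise P is
   the largest length for which they do. *)
have [small|big] := leP (Q%:R * A%:R * lam) (1 / 12).
  exists A; first by rewrite A0 leqnn.
  split=> //.
  have T2 : 8 / A%:R * z ^+ 97 <= 16.
    rewrite mulrAC ler_pdivrMr //; have := zmono 97%N 227%N isT.
    by move: Alo; set y := z ^+ 97; set y' := z ^+ 227; clear; lra.
  have h : 1 / lam / (A%:R * Q%:R * A%:R) * z ^+ 99 <= 2.
    have -> : 1 / lam / (A%:R * Q%:R * A%:R) * z ^+ 99 = z ^+ 99 / (lam * A%:R ^+ 2 * Q%:R).
      by field; rewrite !gt_eqF.
    have a2 : 0 < A%:R ^+ 2 :> R by rewrite exprn_gt0.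
    rewrite ler_pdivrMr; last by rewrite !mulr_gt0.
    rewrite -(ler_pM2r (zp 4%N)) -(zE 99%N 4%N).
    have e : 2 * (lam * A%:R ^+ 2 * Q%:R) * z ^+ 4 = (lam * A%:R ^+ 2 * z ^+ 4) * (2 * Q%:R) by ring.
    rewrite e; apply: le_trans (_ : 1 * (2 * Q%:R) <= _); first by rewrite mul1r; move: Qlo; clear; lra.
    by rewrite ler_wpM2r // mulr_ge0 // ltW.
  have h3' := T3 2 ltac:(done) A A0 h; rewrite 2!mulrDl /test_const.
  have Kk : 0 <= kl_const * k by rewrite mulr_ge0 // ltW.
  move: T1 T2 h3' Kk; clear; lra.
pose w := 1 / (12 * Q%:R * lam).
have QL : Q%:R * lam * z ^+ 100 <= 32.
  apply: le_trans lamhi; rewrite (zE 103%N 100%N) mulrA ler_wpM2r ?(ltW (zp _)) //.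
  by rewrite mulrC ler_wpM2l // ltW.
have Ql0 : 0 < Q%:R * lam by rewrite mulr_gt0.
have w1 : 1 <= w.
  rewrite /w ler_pdivlMr -?mulrA ?mulr_gt0 // mul1r.
  have h1 : 100 * 1 <= z ^+ 100 by rewrite exprS; apply: ler_pM.
  have h100 : 100 * 100 * (Q%:R * lam) <= Q%:R * lam * z ^+ 100.
    rewrite mulrC ler_wpM2l ?(ltW Ql0) //.
    by rewrite exprS; apply: ler_pM => //; rewrite exprS -[leLHS]mulr1; apply: ler_pM.
  move: h100 QL Ql0; set y := _ * lam; set y' := _ * z ^+ 100; clear; lra.
have /andP[wlo whi] := truncn_half w1.
set P := Num.truncn w in wlo whi.
have Pp : 0 < P%:R :> R by move: w1 wlo; clear; lra.
have wE : Q%:R * lam * w = 1 / 12 by rewrite /w; field; rewrite !gt_eqF.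
have QPlo : 1 / 24 <= Q%:R * P%:R * lam.
  have -> : Q%:R * P%:R * lam = Q%:R * lam * P%:R by ring.
  apply: le_trans (_ : Q%:R * lam * (w / 2) <= _); first by rewrite mulrA wE; clear; lra.
  by rewrite ler_wpM2l // ltW.
exists P.
  rewrite -(ltr0n R) Pp -(ler_nat R) /=; apply: le_trans whi _.
  rewrite /w ler_pdivrMr; last by rewrite -mulrA mulr_gt0.
  have -> : A%:R * (12 * Q%:R * lam) = 12 * (Q%:R * A%:R * lam) by ring.
  by move: big; clear; lra.
split.
  have -> : Q%:R * P%:R * lam = Q%:R * lam * P%:R by ring.
  by rewrite -wE ler_wpM2l // ltW.
have T2 : 8 / P%:R * z ^+ 97 <= 8 * 24 * 32.
  rewrite mulrAC ler_pdivrMr //.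
  have h : z ^+ 97 <= 24 * (Q%:R * P%:R * lam) * z ^+ 97.
    by rewrite -[leLHS]mul1r ler_wpM2r ?(ltW (zp _)) //; move: QPlo; clear; lra.
  have h2 : Q%:R * P%:R * lam * z ^+ 97 <= 32 * P%:R.
    have -> : Q%:R * P%:R * lam * z ^+ 97 = Q%:R * lam * z ^+ 97 * P%:R by ring.
    rewrite ler_wpM2r ?(ltW Pp) //; apply: le_trans QL.
    by rewrite ler_wpM2l ?(ltW Ql0) // zmono.
  by move: h h2; rewrite -mulrA; set y := _ * _ * _ * z ^+ 97; clear; lra.
have h : 1 / lam / (A%:R * Q%:R * P%:R) * z ^+ 99 <= 48.
  have -> : 1 / lam / (A%:R * Q%:R * P%:R) * z ^+ 99 = z ^+ 99 / (A%:R * (Q%:R * P%:R * lam)).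
    by field; rewrite !gt_eqF.
  rewrite ler_pdivrMr; last by rewrite !mulr_gt0.
  have := zmono 99%N 227%N isT => hz.
  apply: le_trans (_ : 48 * (A%:R * (1 / 24)) <= _).
    by move: hz Alo; set y := z ^+ 227; set y' := z ^+ 99; clear; lra.
  by rewrite ler_pM2l // ler_wpM2l // ltW.
have P0 : (0 < P)%N by rewrite -(ltr0n R).
have h3' := T3 48 ltac:(done) P P0 h; rewrite 2!mulrDl /test_const.
have Kk : 0 <= kl_const * k by rewrite mulr_ge0 // ltW.
move: T1 T2 h3' Kk; clear; lra.
Qed.

End TestInPowers.

(** * The phases X / (a b + kap) *)

Section Phases.
Context {R : realType}.

(** The k-th derivative of t |-> X / (t b + kap). *)
Definition recip_deriv (X kap b : R) (k : nat) (t : R) : R :=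
  X * (-1) ^+ k * k`!%:R * b ^+ k / (t * b + kap) ^+ k.+1.

Lemma is_derive_shifted_inv_pow (b kap t : R) (n : nat) : 0 < t * b + kap ->
  is_derive t 1 (fun s => ((s * b + kap) ^+ n.+1)^-1)
    (- (n.+1%:R * b) / (t * b + kap) ^+ n.+2).
Proof.
move=> h.
have nz j : (t * b + kap) ^+ j != 0 by rewrite expf_eq0 (gt_eqF h) andbF.
have d1 : is_derive t 1 (fun s => s * b + kap) b.
  by apply: is_derive_eq; rewrite scaler0 add0r addr0 -[LHS]/(b * 1) mulr1.
have d2 : is_derive t 1 (fun s => (s * b + kap) ^+ n.+1) (n.+1%:R * (t * b + kap) ^+ n * b).
  have := @is_deriveX R R (fun s : R => s * b + kap) n.+1 t 1 b d1.
  by rewrite exprfctE.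
have := @is_deriveV R (fun s : R => (s * b + kap) ^+ n.+1) t _ 1 (nz n.+1) d2.
move=> h3; apply: is_derive_eq.
rewrite -[LHS]/(_ * _) !exprS; have h0 : t * b + kap != 0 by rewrite gt_eqF.
by field; rewrite h0 nz.
Qed.

Lemma is_derive_recip_deriv (X kap b t : R) (k : nat) : 0 < t * b + kap ->
  is_derive t 1 (recip_deriv X kap b k) (recip_deriv X kap b k.+1 t).
Proof.
move=> h; have d := is_derive_shifted_inv_pow k h.
have d2 : is_derive t 1 (fun s => (X * (-1) ^+ k * k`!%:R * b ^+ k) * ((s * b + kap) ^+ k.+1)^-1)
   ((X * (-1) ^+ k * k`!%:R * b ^+ k) * (- (k.+1%:R * b) / (t * b + kap) ^+ k.+2)).
  exact: is_deriveZ.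
apply: (is_derive_eq d2).
by rewrite /recip_deriv factS natrM [(-1) ^+ k.+1]exprS [b ^+ k.+1]exprS; ring.
Qed.

Lemma invXn_le (n : nat) (a b : R) : 0 < a -> a <= b -> (b ^+ n)^-1 <= (a ^+ n)^-1.
Proof.
move=> a0 ab; have b0 : 0 < b by apply: lt_le_trans ab.
by rewrite lef_pV2 ?posrE ?exprn_gt0 // lerXn2r ?nnegrE // ltW.
Qed.

(** Up to a factor independent of b, the k-th derivative (k = j + 1) of the phase
    at t is u^k / (u + kap)^(k+1) with u = t b. Its derivative in u is comparable with
    -1 / u^2, so that two phases with different b have third derivatives that differ
    by a definite amount. *)
Lemma ratio_diff_bounds (j : nat) (kap u v c d : R) : (j < 4)%N -> 0 <= kap <= 1 ->
  8 <= c -> c <= u -> u <= v -> v <= d ->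
  (v - u) * ((2 ^+ j.+4) * d ^+ 2)^-1 <=
  u ^+ j.+1 / (u + kap) ^+ j.+2 - v ^+ j.+1 / (v + kap) ^+ j.+2 <= (v - u) * (c ^+ 2)^-1.
Proof.
move=> j4 /andP[k0 k1] c8 cu uv vd.
have j4' : j.+1%:R <= 4 :> R by rewrite ler_nat.
have j0' : 1 <= j.+1%:R :> R by rewrite ler1n.
pose g s : R := s ^+ j.+1 / (s + kap) ^+ j.+2.
pose dg s : R := - (s ^+ j * (s - j.+1%:R * kap) / (s + kap) ^+ j.+3).
have hd s : u <= s <= v -> is_derive s 1 g (dg s).
  move=> /andP[us sv]; have h : 0 < s * 1 + kap by lra.
  have d1 := is_derive_shifted_inv_pow j.+1 h.
  have d2 : is_derive s 1 (fun x : R => x ^+ j.+1) (j.+1%:R * s ^+ j).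
    have := @is_deriveX R R (fun x : R => x) j.+1 s 1 1 (is_derive_id _ _).
    by rewrite exprfctE /= -[_ *: _]/(_ * _) mulr1.
  have -> : g = (fun x : R => x ^+ j.+1 * ((x * 1 + kap) ^+ j.+2)^-1).
    by apply/funext => x; rewrite /g mulr1.
  have := is_deriveM d2 d1; move=> d3; apply: is_derive_eq.
  rewrite /dg -![_ *: _]/(_ * _) !mulr1 in h *.
  rewrite [s ^+ j.+1]exprS [(s + kap) ^+ j.+3]exprS [(s + kap) ^+ j.+2]exprS -[j.+2%:R]natr1.
  by field; rewrite expf_eq0 (gt_eqF h) andbF.
have hb s : u <= s <= v -> - (c ^+ 2)^-1 <= dg s <= - (2 ^+ j.+4 * d ^+ 2)^-1.
  move=> /andP[us sv]; rewrite /dg !lerN2.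
  have s0 : 0 < s by lra.
  have jk : j.+1%:R * kap <= s / 2.
    apply: le_trans (_ : 4 * 1 <= _); last by lra.
    by apply: ler_pM.
  have jk0 : 0 <= j.+1%:R * kap by rewrite mulr_ge0.
  have sj : 0 <= s ^+ j by rewrite exprn_ge0 // ltW.
  have h1 : s ^+ j * (s - j.+1%:R * kap) <= s ^+ j * s by rewrite ler_wpM2l //; lra.
  have h2 : s ^+ j * (s / 2) <= s ^+ j * (s - j.+1%:R * kap) by rewrite ler_wpM2l //; lra.
  have n0 : 0 <= s ^+ j * (s - j.+1%:R * kap).
    by apply: le_trans h2; rewrite mulr_ge0 //; lra.
  apply/andP; split.
  - apply: le_trans (_ : (s ^+ 2)^-1 <= _); last by apply: invXn_le; lra.
    have -> : (s ^+ 2)^-1 = s ^+ j * s * (s ^+ j.+3)^-1.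
      have e : s ^+ j.+3 = s ^+ 2 * (s * s ^+ j) by rewrite -exprS -exprD.
      by rewrite e; field; rewrite !expf_eq0 /= !gt_eqF ?andbF.
    apply: ler_pM => //; first by rewrite invr_ge0 exprn_ge0 //; lra.
    by apply: invXn_le; lra.
  - apply: le_trans (_ : (2 ^+ j.+4 * s ^+ 2)^-1 <= _).
      have d0 : 0 < d by lra.
      have sd : s ^+ 2 <= d ^+ 2 by rewrite lerXn2r ?nnegrE ?(ltW d0) ?(ltW s0) //; lra.
      have p2 : 0 < 2 ^+ j.+4 :> R by rewrite exprn_gt0.
      have p3 : 0 < 2 ^+ j.+4 * s ^+ 2 by rewrite mulr_gt0 // exprn_gt0.
      have p4 : 0 < 2 ^+ j.+4 * d ^+ 2 by rewrite mulr_gt0 // exprn_gt0.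
      by rewrite lef_pV2 // ler_pM2l.
    have -> : (2 ^+ j.+4 * s ^+ 2)^-1 = s ^+ j * (s / 2) * ((2 * s) ^+ j.+3)^-1.
      rewrite exprMn [2 ^+ j.+4]exprS; have e : s ^+ j.+3 = s ^+ 2 * (s * s ^+ j) by rewrite -exprS -exprD.
      by rewrite e; field; rewrite !expf_eq0 /= !gt_eqF ?andbF.
    apply: ler_pM => //; first by rewrite mulr_ge0 //; lra.
      by rewrite invr_ge0 exprn_ge0 //; lra.
    by apply: invXn_le; lra.
have := mvt_bounds uv hd hb; rewrite !mulNr => /andP[h1 h2].
rewrite -/(g u) -/(g v) ![(v - u) * _]mulrC; apply/andP; split; lra.
Qed.

Lemma normc_sum_cexpN (A1 A2 : nat) (f : nat -> R) :
  normc (\sum_(A1 <= n < A2) cexp (- f n)) = normc (\sum_(A1 <= n < A2) cexp (f n)).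
Proof.
rewrite -[RHS]normc_conj rmorph_sum; congr normc.
by apply: eq_bigr => n _; rewrite cexpN.
Qed.

(** A single arithmetic progression a b + kap, with b fixed. Conjugation fixes the
    sign of the third derivative. *)
Lemma single_phase_sum (z k X kap : R) (A A1 A2 b : nat) :
  let lam := X / (A%:R ^+ 4 * b%:R) in
  0 <= k -> 100 <= z ->
  0 < X -> 0 <= kap <= 1 -> (0 < b)%N ->
  (1 + ln A%:R) ^+ 2 <= k * z ^+ 2 -> z ^+ 227 <= 2 * A%:R ->
  1 <= lam * A%:R ^+ 2 * z ^+ 4 -> lam * z ^+ 203 <= 32 ->
  (A <= A1)%N -> (A2 <= A + A)%N ->
  normc (\sum_(A1 <= n < A2) cexp (X / (n%:R * b%:R + kap))) * z ^+ 24 <= test_const k * A%:R.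
Proof.
move=> lam k0 z100 X0 /andP[kap0 kap1] b0 hk Alo l1 l2 AA1 A2A.
have Ap : 0 < A%:R :> R.
  by rewrite -(@pmulr_rgt0 _ 2) // (lt_le_trans _ Alo) // exprn_gt0 //; lra.
have bp : 1 <= b%:R :> R by rewrite ler1n.
have A1r : 1 <= A%:R :> R by rewrite ler1n -(ltr0n R).
have hpos (t : R) : A%:R <= t <= A%:R + A%:R -> 0 < t * b%:R + kap.
  by move=> /andP[t1 t2]; rewrite ltr_pwDl // mulr_gt0 //; lra.
have -> : normc (\sum_(A1 <= n < A2) cexp (X / (n%:R * b%:R + kap))) =
   normc (\sum_(A1 <= n < A2) cexp (recip_deriv (- X) kap b%:R 0 n%:R)).
  rewrite -normc_sum_cexpN; congr normc; apply: eq_bigr => n _; congr cexp.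
  by rewrite /recip_deriv !expr0 expr1 fact0 !mulr1 mulNr.
have lam0 : 0 < lam by rewrite divr_gt0 // mulr_gt0 ?exprn_gt0 //; lra.
apply: (third_derivative_test_pow z100 k0 hk Alo l1 l2 AA1 A2A).
all: clear hk Alo l1 l2 AA1 A2A k0 z100.
- by move=> i t _ ht; apply: is_derive_recip_deriv; apply: hpos.
- move=> t ht; have tp := hpos t ht; have /andP[t1 t2] := ht.
  have t0 : 0 < t by lra.
  have tb0 : 0 < t * b%:R by rewrite mulr_gt0 //; lra.
  have tb1 : 1 <= t * b%:R by rewrite -[leLHS]mulr1; apply: ler_pM; lra.
  have -> : recip_deriv (- X) kap b%:R 3 t = 6 * X * b%:R ^+ 3 / (t * b%:R + kap) ^+ 4.
    by rewrite /recip_deriv; have -> : 3`! = 6%N by []; congr (_ / _); ring.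
  have p3 : 0 <= 6 * X * b%:R ^+ 3 by rewrite mulr_ge0 ?exprn_ge0 // mulr_ge0 // ltW.
  have bn : b%:R != 0 :> R by rewrite gt_eqF //; lra.
  apply/andP; split.
  - apply: le_trans (_ : 6 * X * b%:R ^+ 3 / ((2 * (2 * A%:R)) * b%:R) ^+ 4 <= _).
      have -> : 6 * X * b%:R ^+ 3 / ((2 * (2 * A%:R)) * b%:R) ^+ 4 = 6 / (4 * 64) * lam.
        by rewrite /lam; field; rewrite bn gt_eqF.
      have c3l : low_const <= 6 / (4 * 64) :> R by rewrite /low_const; lra.
      by apply: ler_wpM2r => //; exact: ltW.
    apply: ler_wpM2l => //; apply: invXn_le => //.
    apply: le_trans (_ : 2 * (t * b%:R) <= _); first by lra.
    rewrite -mulrA ler_pM2l // ler_wpM2r //; lra.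
  - apply: le_trans (_ : 6 * X * b%:R ^+ 3 / (A%:R * b%:R) ^+ 4 <= _).
      apply: ler_wpM2l => //; apply: invXn_le; first by rewrite mulr_gt0 //; lra.
      by rewrite ler_wpDr // ler_wpM2r //; lra.
    rewrite /lam le_eqVlt; apply/orP; left; apply/eqP; field.
    by rewrite bn gt_eqF.
- move=> t ht; have tp := hpos t ht; have /andP[t1 t2] := ht.
  have t0 : 0 < t by lra.
  have bn : b%:R != 0 :> R by rewrite gt_eqF //; lra.
  have -> : recip_deriv (- X) kap b%:R 4 t = - (24 * X * b%:R ^+ 4 / (t * b%:R + kap) ^+ 5).
    by rewrite /recip_deriv; have -> : 4`! = 24%N by []; rewrite -mulNr; congr (_ / _); ring.
  have p3 : 0 <= 24 * X * b%:R ^+ 4 by rewrite mulr_ge0 ?exprn_ge0 // mulr_ge0 // ltW.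
  rewrite normrN ger0_norm; last by rewrite divr_ge0 // exprn_ge0 // ltW.
  apply: le_trans (_ : 24 * X * b%:R ^+ 4 / (A%:R * b%:R) ^+ 5 <= _).
    apply: ler_wpM2l => //; apply: invXn_le; first by rewrite mulr_gt0 //; lra.
    by rewrite ler_wpDr // ler_wpM2r //; lra.
  rewrite /lam le_eqVlt; apply/orP; left; apply/eqP; field.
  by rewrite bn gt_eqF.
Qed.

End Phases.

Section PairPhases.
Context {R : realType}.

(** The phase that appears when two values b1 > b2 of one variable of a bilinear sum
    are correlated: its derivatives are those of a single phase, differenced in b. *)
Lemma pair_phase_sum (z k X kap : R) (A A1 A2 B b1 b2 : nat) :
  let lam := X * (b1%:R - b2%:R) / (A%:R ^+ 4 * B%:R ^+ 2) in
  0 <= k -> 100 <= z ->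
  0 < X -> 0 <= kap <= 1 -> (8 <= A * B)%N -> (B <= b2)%N -> (b2 < b1)%N -> (b1 <= 2 * B)%N ->
  (1 + ln A%:R) ^+ 2 <= k * z ^+ 2 -> z ^+ 227 <= 2 * A%:R ->
  1 <= lam * A%:R ^+ 2 * z ^+ 4 -> lam * z ^+ 203 <= 32 ->
  (A <= A1)%N -> (A2 <= A + A)%N ->
  normc (\sum_(A1 <= n < A2) cexp (X / (n%:R * b1%:R + kap) - X / (n%:R * b2%:R + kap))) * z ^+ 24
    <= test_const k * A%:R.
Proof.
move=> lam k0 z100 X0 hkap AB8 Bb2 b21 b1B hk Alo l1 l2 AA1 A2A.
have /andP[kap0 kap1] := hkap.
have [A0 B0] : (0 < A)%N /\ (0 < B)%N by move: AB8; clear; lia.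
have Ar : 1 <= A%:R :> R by rewrite ler1n.
have Br : 1 <= B%:R :> R by rewrite ler1n.
have An : A%:R != 0 :> R by rewrite gt_eqF //; lra.
have Bn : B%:R != 0 :> R by rewrite gt_eqF //; lra.
have b2r : B%:R <= b2%:R :> R by rewrite ler_nat.
have b12r : b2%:R < b1%:R :> R by rewrite ltr_nat.
have b1r : b1%:R <= 2 * B%:R :> R by rewrite -natrM ler_nat.
have ABr : 8 <= A%:R * B%:R :> R by rewrite -natrM ler_nat.
pose F i t := recip_deriv X kap b1%:R i t - recip_deriv X kap b2%:R i t.
have hpos (b t : R) : B%:R <= b -> A%:R <= t -> 0 < t * b + kap.
  by clear hk Alo l1 l2 => hb ht; rewrite ltr_pwDl // mulr_gt0 //; lra.
have -> : \sum_(A1 <= n < A2) cexp (X / (n%:R * b1%:R + kap) - X / (n%:R * b2%:R + kap)) =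
   \sum_(A1 <= n < A2) cexp (F 0%N n%:R).
  apply: eq_bigr => n _; congr cexp.
  by rewrite /F /recip_deriv !expr0 !expr1 fact0 !mulr1.
have lam0 : 0 < lam.
  apply: divr_gt0; first by apply: mulr_gt0 => //; rewrite subr_gt0.
  by apply: mulr_gt0; apply: exprn_gt0; [move: Ar|move: Br]; clear; lra.
have bounds (t : R) : A%:R <= t <= A%:R + A%:R -> [/\ 0 < t, A%:R * B%:R <= t * b2%:R,
     t * b2%:R <= t * b1%:R & t * b1%:R <= 4 * (A%:R * B%:R)].
  clear hk Alo l1 l2 => /andP[t1 t2]; split; first by lra.
  - by apply: ler_pM => //; lra.
  - by apply: ler_wpM2l; lra.
  - apply: le_trans (_ : (2 * A%:R) * (2 * B%:R) <= _); first by apply: ler_pM; lra.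
    by rewrite le_eqVlt; apply/orP; left; apply/eqP; ring.
have phE (b t : R) i : 0 < t -> 0 < t * b + kap -> recip_deriv X kap b i t =
   X * (-1) ^+ i * i`!%:R / t ^+ i * ((t * b) ^+ i / (t * b + kap) ^+ i.+1).
  move=> t0 tb; rewrite /recip_deriv exprMn.
  have tn : t ^+ i != 0 by rewrite expf_eq0 (gt_eqF t0) andbF.
  have kn : (t * b + kap) ^+ i.+1 != 0 by rewrite expf_eq0 (gt_eqF tb).
  by field; rewrite tn kn.
apply: (third_derivative_test_pow z100 k0 hk Alo l1 l2 AA1 A2A).
all: clear hk Alo l1 l2 AA1 A2A k0 z100.
- move=> i t _ /andP[t1 t2]; apply: is_deriveB; apply: is_derive_recip_deriv; apply: hpos => //; lra.
- move=> t ht; have [t0 u1 u2 u3] := bounds t ht; have /andP[t1 t2] := ht.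
  have /andP[r1 r2] := ratio_diff_bounds (isT : (2 < 4)%N) hkap ABr u1 u2 u3.
  have -> : F 3%N t = 6 * X / t ^+ 3 * ((t * b2%:R) ^+ 3 / (t * b2%:R + kap) ^+ 4 -
      (t * b1%:R) ^+ 3 / (t * b1%:R + kap) ^+ 4).
    rewrite /F (phE _ _ _ t0 (hpos _ _ (le_trans b2r (ltW b12r)) t1)).
    rewrite (phE _ _ _ t0 (hpos _ _ b2r t1)).
    have -> : 3`! = 6%N by []. ring.
  have c0 : 0 <= 6 * X / t ^+ 3 by rewrite divr_ge0 ?exprn_ge0 ?mulr_ge0 // ltW.
  have c1 : 0 <= 6 * X * (b1%:R - b2%:R) :> R by rewrite !mulr_ge0 ?subr_ge0 // ltW.
  have tn : t != 0 by rewrite gt_eqF.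
  apply/andP; split.
  - apply: le_trans (ler_wpM2l c0 r1).
    have -> : 6 * X / t ^+ 3 * ((t * b1%:R - t * b2%:R) * (2 ^+ 6 * (4 * (A%:R * B%:R)) ^+ 2)^-1) =
      6 * X * (b1%:R - b2%:R) * ((2 ^+ 6 * (4 * (A%:R * B%:R)) ^+ 2)^-1 * (t ^+ 2)^-1).
      by field; rewrite tn An Bn.
    apply: le_trans (_ : 6 * X * (b1%:R - b2%:R) * ((2 ^+ 6 * (4 * (A%:R * B%:R)) ^+ 2)^-1 * ((2 * A%:R) ^+ 2)^-1) <= _).
      rewrite le_eqVlt; apply/orP; left; apply/eqP; rewrite /lam /low_const; field.
      by rewrite An Bn.
    apply: ler_wpM2l => //; apply: ler_wpM2l; first by rewrite invr_ge0 mulr_ge0 ?sqr_ge0 // exprn_ge0.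
    by apply: invXn_le => //; lra.
  - apply: le_trans (ler_wpM2l c0 r2) _.
    have -> : 6 * X / t ^+ 3 * ((t * b1%:R - t * b2%:R) * ((A%:R * B%:R) ^+ 2)^-1) =
      6 * X * (b1%:R - b2%:R) * (((A%:R * B%:R) ^+ 2)^-1 * (t ^+ 2)^-1).
      by field; rewrite tn An Bn.
    apply: le_trans (_ : 6 * X * (b1%:R - b2%:R) * (((A%:R * B%:R) ^+ 2)^-1 * (A%:R ^+ 2)^-1) <= _).
      apply: ler_wpM2l => //; apply: ler_wpM2l; first by rewrite invr_ge0 sqr_ge0.
      by apply: invXn_le; lra.
    rewrite le_eqVlt; apply/orP; left; apply/eqP; rewrite /lam; field.
    by rewrite An Bn.
- move=> t ht; have [t0 u1 u2 u3] := bounds t ht; have /andP[t1 t2] := ht.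
  have /andP[r1 r2] := ratio_diff_bounds (isT : (3 < 4)%N) hkap ABr u1 u2 u3.
  have -> : F 4%N t = - (24 * X / t ^+ 4 * ((t * b2%:R) ^+ 4 / (t * b2%:R + kap) ^+ 5 -
      (t * b1%:R) ^+ 4 / (t * b1%:R + kap) ^+ 5)).
    rewrite /F (phE _ _ _ t0 (hpos _ _ (le_trans b2r (ltW b12r)) t1)).
    rewrite (phE _ _ _ t0 (hpos _ _ b2r t1)).
    have -> : 4`! = 24%N by []. ring.
  have c0 : 0 <= 24 * X / t ^+ 4 by rewrite divr_ge0 ?exprn_ge0 ?mulr_ge0 // ltW.
  have c1 : 0 <= 24 * X * (b1%:R - b2%:R) :> R by rewrite !mulr_ge0 ?subr_ge0 // ltW.
  have tn : t != 0 by rewrite gt_eqF.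
  rewrite normrN ger0_norm; last first.
    apply: mulr_ge0 => //; apply: le_trans r1; apply: mulr_ge0; first by rewrite subr_ge0.
    by rewrite invr_ge0 mulr_ge0 ?sqr_ge0 // exprn_ge0.
  apply: le_trans (ler_wpM2l c0 r2) _.
  have -> : 24 * X / t ^+ 4 * ((t * b1%:R - t * b2%:R) * ((A%:R * B%:R) ^+ 2)^-1) =
      24 * X * (b1%:R - b2%:R) * (((A%:R * B%:R) ^+ 2)^-1 * (t ^+ 3)^-1).
    by field; rewrite tn An Bn.
  apply: le_trans (_ : 24 * X * (b1%:R - b2%:R) * (((A%:R * B%:R) ^+ 2)^-1 * (A%:R ^+ 3)^-1) <= _).
    apply: ler_wpM2l => //; apply: ler_wpM2l; first by rewrite invr_ge0 sqr_ge0.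
    by apply: invXn_le; lra.
  rewrite le_eqVlt; apply/orP; left; apply/eqP; rewrite /lam; field.
  by rewrite An Bn.
Qed.

End PairPhases.

(** * Bilinear and linear sums over dyadic blocks *)

Section Blocks.
Context {R : realType}.

Lemma sum_block_le_const (m : nat) (F : nat -> R) (c : R) :
  (forall n, (m <= n < m + m)%N -> F n <= c) -> \sum_(m <= n < m + m) F n <= m%:R * c.
Proof. by move=> h; have := sum_le_const h; rewrite addKn. Qed.

Lemma sum_nat_subinterval (m n m' n' : nat) (P : pred nat) (F : nat -> R[i]) :
  (m <= m')%N -> (n' <= n)%N -> (forall i, (m <= i < n)%N -> P i = (m' <= i < n')%N) ->
  \sum_(m <= i < n | P i) F i = \sum_(m' <= i < n') F i.
Proof.
move=> mm nn hP; rewrite (big_nat_widen _ _ _ _ _ nn) (big_nat_widenl _ _ _ _ _ mm).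
rewrite [LHS]big_nat_cond [RHS]big_nat_cond; apply: eq_bigl => i.
by case h: (m <= i < n)%N => //=; rewrite hP // andbC.
Qed.

Definition log_sqr_bounded (z k : R) := [/\ 0 <= k, 100 <= z &
  forall n : nat, (0 < n)%N -> n%:R <= z ^+ 459 -> (1 + ln n%:R) ^+ 2 <= k * z ^+ 2].

(** Cauchy--Schwarz over the longer variable a removes its coefficients; the
    correlations with b1 = b2 contribute a proportion 1 / B <= 2 z^(-90) of the trivial
    bound, those with b1 <> b2 a proportion z^(-24). The square root is z^(-12). *)
Lemma bilinear_block_long_first (z k X kap : R) (D1 D2 A B : nat) (al be : nat -> R[i]) :
  log_sqr_bounded z k -> z ^+ 914 <= X -> X <= z ^+ 930 -> 0 <= kap <= 1 ->
  z ^+ 455 <= D1.+1%:R -> D2%:R <= z ^+ 459 ->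
  (forall n, normc (al n) <= 1) -> (forall n, normc (be n) <= 1) ->
  (B <= A)%N -> z ^+ 90 <= 2 * B%:R ->
  normc (\sum_(A <= a < A + A) \sum_(B <= b < B + B | (D1 < a * b <= D2)%N)
     al a * be b * cexp (X / ((a * b)%:R + kap))) * z ^+ 12 <= (2 + test_const k) * (A * B)%:R.
Proof.
move=> [k0 z100 hk] Xlo Xhi hkap hD1 hD2 al1 be1 BA Blo.
have z1 : 1 <= z by move: z100; clear; lra.
have zp j : 0 < z ^+ j by rewrite exprn_gt0 //; move: z100; clear; lra.
have zmono a b : (a <= b)%N -> z ^+ a <= z ^+ b by move=> ab; rewrite ler_weXn2l.
have C1 := test_const_ge1 k0.
have Bp : 0 < B%:R :> R by rewrite -(@pmulr_rgt0 _ 2) // (lt_le_trans _ Blo).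
have B0 : (0 < B)%N by rewrite -(ltr0n R).
have A0 : (0 < A)%N by apply: leq_trans BA.
have Ap : 0 < A%:R :> R by rewrite ltr0n.
have ABr : B%:R <= A%:R :> R by rewrite ler_nat.
have rhs0 : 0 <= (2 + test_const k) * (A * B)%:R.
  apply: mulr_ge0; [move: C1; clear; lra|exact: ler0n].
pose cond a b := (D1 < a * b <= D2)%N.
set T := \sum_(_ <= _ < _) _.
(* An empty block is trivial; a pair in the block determines the order of A * B. *)
have [/hasP[a ha /hasP[b hb hab]]|hno] := boolP
   (has (fun a => has (cond a) (index_iota B (B + B))) (index_iota A (A + A))); last first.
  have -> : T = 0.
    rewrite /T big_nat big1 // => a ha; rewrite big_nat_cond big1 // => b /andP[hb hc].
    move/hasPn: hno => /(_ a); rewrite mem_index_iota ha => /(_ isT)/hasPn/(_ b).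
    by rewrite mem_index_iota hb => /(_ isT); rewrite /cond hc.
  by rewrite normc0 mul0r.
have {}ha : (A <= a < A + A)%N by rewrite mem_index_iota in ha.
have {}hb : (B <= b < B + B)%N by rewrite mem_index_iota in hb.
have AB4 : z ^+ 455 <= 4 * (A%:R * B%:R).
  apply: le_trans hD1 _; rewrite -!natrM ler_nat; move: hab ha hb; rewrite /cond; clear; nia.
have ABhi : A%:R * B%:R <= z ^+ 459.
  apply: le_trans hD2; rewrite -!natrM ler_nat; move: hab ha hb; rewrite /cond; clear; nia.
have Alo : z ^+ 227 <= 2 * A%:R.
  have : z ^+ 227 ^+ 2 <= (2 * A%:R) ^+ 2.
    rewrite -exprM; apply: le_trans (zmono (227 * 2)%N 455%N isT) _; apply: le_trans AB4 _.
    have : A%:R * B%:R <= A%:R * A%:R :> R by rewrite ler_pM2l.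
    by rewrite exprMn [A%:R ^+ 2]expr2; clear; lra.
  by rewrite ler_sqr ?nnegrE ?(ltW (zp _)) // mulr_ge0 // ltW.
have hA : (1 + ln A%:R) ^+ 2 <= k * z ^+ 2.
  by apply: hk => //; apply: le_trans ABhi; rewrite ler_peMr ?(ltW Ap) // ler1n.
have AB8 : (8 <= A * B)%N.
  rewrite -(ler_nat R) natrM; have := zmono 1%N 455%N isT; rewrite expr1 => h.
  by move: h AB4 z100; set y := z ^+ 455; set w := A%:R * B%:R; clear; lra.
have X0 : 0 < X by apply: lt_le_trans Xlo.
pose G a b : R[i] := if cond a b then be b * cexp (X / ((a * b)%:R + kap)) else 0.
have TE : T = \sum_(A <= a < A + A) al a * \sum_(B <= b < B + B) G a b.
  apply: eq_bigr => a' _; rewrite big_mkcond /= big_distrr /=; apply: eq_bigr => b' _.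
  by rewrite /G /cond; case: ifP => _; rewrite ?mulr0 // mulrA.
have T1 : normc T <= \sum_(A <= a < A + A) normc (\sum_(B <= b < B + B) G a b).
  rewrite TE; apply: le_trans (normc_sum _ _ _) _; apply: ler_sum => a' _.
  by rewrite normcM ler_piMl ?normc_ge0.
(* For two fixed values of the short variable, the long variable runs over an
   interval: the range of a * b1 and that of a * b2 cut out an interval of a. *)
have corr b1 b2 : (B <= b1 < B + B)%N -> (B <= b2 < B + B)%N -> (b2 < b1)%N ->
    normc (\sum_(A <= a < A + A) G a b1 * (G a b2)^*%C) * z ^+ 24 <= test_const k * A%:R.
  move=> hb1 hb2 b21.
  have b1p : (0 < b1)%N by move: hb1 B0; clear; lia.
  have b2p : (0 < b2)%N by move: hb2 B0; clear; lia.
  pose A1 := maxn A (maxn (D1 %/ b1).+1 (D1 %/ b2).+1).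
  pose A2 := minn (A + A) (minn (D2 %/ b1).+1 (D2 %/ b2).+1).
  have -> : \sum_(A <= a < A + A) G a b1 * (G a b2)^*%C = be b1 * (be b2)^*%C *
      \sum_(A1 <= a < A2) cexp (X / (a%:R * b1%:R + kap) - X / (a%:R * b2%:R + kap)).
    rewrite -(@sum_nat_subinterval A (A + A) A1 A2 (fun a => cond a b1 && cond a b2)); last 3 first.
    - by rewrite leq_max leqnn.
    - by rewrite geq_min leqnn.
    - move=> i /andP[i1 i2]; rewrite /cond /A1 /A2 !geq_max !leq_min i1 i2 /= !ltnS.
      rewrite !leq_divRL // !ltn_divLR //.
      by case: (D1 < i * b1)%N; case: (D1 < i * b2)%N; rewrite //= ?andbT ?andbF.
    rewrite big_distrr /= [RHS]big_mkcond /=; apply: eq_bigr => i _.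
    rewrite /G; case: ifP => _; case: ifP => _; rewrite ?mul0r ?conjc0 ?mulr0 //.
    by rewrite cexpB !natrM rmorphM /=; ring.
  have b1r : b1%:R <= 2 * B%:R :> R by rewrite -natrM ler_nat; move: hb1; clear; lia.
  have b2r : B%:R <= b2%:R :> R by rewrite ler_nat; move: hb2; clear; lia.
  have b12 : b2%:R + 1 <= b1%:R :> R by rewrite natr1 ler_nat.
  have := @pair_phase_sum R z k X kap A A1 A2 B b1 b2 k0 z100 X0 hkap AB8.
  set S := normc (\sum_(A1 <= a < A2) _) => hS.
  have {}hS : S * z ^+ 24 <= test_const k * A%:R.
    apply: hS => //.
    - by case/andP: hb2.
    - by move: hb1; clear; lia.
    - have -> : X * (b1%:R - b2%:R) / (A%:R ^+ 4 * B%:R ^+ 2) * A%:R ^+ 2 * z ^+ 4 =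
        (X * z ^+ 4 * (b1%:R - b2%:R)) / (A%:R * B%:R) ^+ 2.
        by field; rewrite !gt_eqF.
      rewrite ler_pdivlMr ?exprn_gt0 ?mulr_gt0 // mul1r.
      apply: le_trans (_ : X * z ^+ 4 * 1 <= _); last first.
        by apply: ler_wpM2l; [rewrite mulr_ge0 // ltW|rewrite lerBrDl].
      rewrite mulr1; apply: le_trans (_ : z ^+ 914 * z ^+ 4 <= _); last first.
        by rewrite ler_wpM2r // ltW.
      rewrite -exprD -[(914 + 4)%N]/(459 * 2)%N exprM.
      by rewrite ler_sqr ?nnegrE ?(ltW (zp _)) // mulr_ge0 // ltW.
    - have -> : X * (b1%:R - b2%:R) / (A%:R ^+ 4 * B%:R ^+ 2) * z ^+ 203 =
        (X * z ^+ 203 * (b1%:R - b2%:R)) / (A%:R ^+ 4 * B%:R ^+ 2).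
        by rewrite mulrAC [X * _ * z ^+ 203]mulrAC.
      rewrite ler_pdivrMr ?mulr_gt0 ?exprn_gt0 //.
      apply: le_trans (_ : z ^+ 930 * z ^+ 203 * B%:R <= _).
        have b120 : 0 <= b1%:R - b2%:R :> R by rewrite subr_ge0 ler_nat ltnW.
        have b12B : b1%:R - b2%:R <= B%:R :> R by move: b1r b2r; clear; lra.
        by apply: ler_pM => //; [rewrite mulr_ge0 // ltW|rewrite ler_wpM2r // ltW].
      have h1 : z ^+ 681 <= 8 * A%:R ^+ 3.
        have -> : 8 * A%:R ^+ 3 = (2 * A%:R) ^+ 3 :> R by ring.
        by rewrite -[681%N]/(227 * 3)%N exprM lerXn2r ?nnegrE ?(ltW (zp _)) // mulr_ge0 // ltW.
      have h2 : z ^+ 681 * z ^+ 455 <= (8 * A%:R ^+ 3) * (4 * (A%:R * B%:R)).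
        by apply: ler_pM => //; exact: ltW.
      have -> : 32 * (A%:R ^+ 4 * B%:R ^+ 2) = (8 * A%:R ^+ 3) * (4 * (A%:R * B%:R)) * B%:R :> R by ring.
      rewrite ler_wpM2r ?(ltW Bp) //; apply: le_trans h2.
      by rewrite -!exprD zmono.
    - by rewrite leq_max leqnn.
    - by rewrite geq_min leqnn.
  rewrite !normcM normc_conj; apply: le_trans hS.
  rewrite ler_wpM2r ?(ltW (zp _)) // ler_piMl ?normc_ge0 // -[leRHS]mulr1.
  by apply: ler_pM; rewrite ?normc_ge0.
have corr' b1 b2 : (B <= b1 < B + B)%N -> (B <= b2 < B + B)%N -> b1 != b2 ->
    normc (\sum_(A <= a < A + A) G a b1 * (G a b2)^*%C) <= test_const k * A%:R / z ^+ 24.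
  move=> h1 h2; rewrite neq_ltn ler_pdivlMr // => /orP[h|h]; last exact: corr.
  rewrite -normc_conj rmorph_sum /=.
  by under eq_bigr => i _ do rewrite rmorphM /= conjcK mulrC; exact: corr.
have G1 a' b' : normc (G a' b') <= 1.
  by rewrite /G; case: ifP => _; rewrite ?normc0 // normcM normc_cexp mulr1.
have Ssq : \sum_(A <= a < A + A) normc (\sum_(B <= b < B + B) G a b) ^+ 2 <=
    B%:R * (A%:R + B%:R * (test_const k * A%:R / z ^+ 24)).
  apply: le_trans (sum_sqr_norm_le _ _ _) _.
  apply: sum_block_le_const => b1 hb1.
  rewrite (bigD1_seq b1) ?mem_index_iota ?iota_uniq //=; apply: lerD.
    apply: le_trans (normc_sum _ _ _) _; rewrite -[leRHS]mulr1.
    apply: sum_block_le_const => a' _; rewrite normcM normc_conj -[leRHS]mulr1.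
    by apply: ler_pM; rewrite ?normc_ge0.
  have c0 : 0 <= test_const k * A%:R / z ^+ 24.
    by apply: divr_ge0; [apply: mulr_ge0; [move: C1; clear; lra|exact: ltW]|exact: ltW].
  rewrite big_mkcond /=; apply: sum_block_le_const => b2 hb2; case: ifP => // h.
  by apply: corr' => //; rewrite eq_sym.
have Tsq : normc T ^+ 2 <= A%:R * (B%:R * (A%:R + B%:R * (test_const k * A%:R / z ^+ 24))).
  apply: le_trans (_ : (\sum_(A <= a < A + A) normc (\sum_(B <= b < B + B) G a b)) ^+ 2 <= _).
    rewrite ler_sqr ?nnegrE ?normc_ge0 //; by apply: sumr_ge0 => i _; exact: normc_ge0.
  apply: le_trans (cauchy_sum _ _) _; rewrite size_iota addKn.
  by apply: ler_wpM2l => //; exact: ltW.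
have fin : (normc T * z ^+ 12) ^+ 2 <= ((2 + test_const k) * (A * B)%:R) ^+ 2.
  rewrite exprMn -exprM -[(12 * 2)%N]/24%N.
  apply: le_trans (ler_wpM2r (ltW (zp 24%N)) Tsq) _.
  have -> : A%:R * (B%:R * (A%:R + B%:R * (test_const k * A%:R / z ^+ 24))) * z ^+ 24 =
     A%:R ^+ 2 * B%:R * (z ^+ 24 + test_const k * B%:R).
    have : z ^+ 24 != 0 by rewrite gt_eqF.
    by set y := z ^+ 24 => y0; field.
  apply: le_trans (_ : A%:R ^+ 2 * B%:R * ((2 + test_const k) * B%:R) <= _).
    apply: ler_wpM2l; first by rewrite mulr_ge0 ?exprn_ge0 // ltW.
    rewrite mulrDl lerD2r; apply: le_trans Blo; exact: zmono.
  rewrite natrM exprMn.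
  have -> : A%:R ^+ 2 * B%:R * ((2 + test_const k) * B%:R) = (2 + test_const k) * (A%:R * B%:R) ^+ 2 by ring.
  apply: ler_wpM2r; first exact: sqr_ge0.
  rewrite expr2; apply: ler_peMl => //; move: C1; clear; lra.
rewrite -ler_sqr ?nnegrE //.
by apply: mulr_ge0; [exact: normc_ge0|exact: ltW].
Qed.

End Blocks.

Section DyadicSums.
Context {R : realType}.

Lemma sum_dyadic (V : zmodType) (L : nat) (F : nat -> V) :
  \sum_(1 <= a < 2 ^ L) F a = \sum_(0 <= i < L) \sum_(2 ^ i <= a < 2 ^ i + 2 ^ i) F a.
Proof.
elim: L => [|L ih]; first by rewrite !big_geq.
rewrite big_nat_recr //= -ih -big_cat_nat ?expn_gt0 ?leq_addr //.
by rewrite expnS mul2n addnn.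
Qed.

Definition in_range (D1 D2 a b : nat) := (D1 < a * b <= D2)%N.

Lemma in_rangeC D1 D2 a b : in_range D1 D2 a b = in_range D1 D2 b a.
Proof. by rewrite /in_range mulnC. Qed.

(** The form is symmetric in its two variables, so the longer one may come first. *)
Lemma bilinear_block (z k X kap : R) (D1 D2 A B : nat) (al be : nat -> R[i]) :
  log_sqr_bounded z k -> z ^+ 914 <= X -> X <= z ^+ 930 -> 0 <= kap <= 1 ->
  z ^+ 455 <= D1.+1%:R -> D2%:R <= z ^+ 459 ->
  (forall n, normc (al n) <= 1) -> (forall n, normc (be n) <= 1) ->
  (forall a b, al a != 0 -> be b != 0 -> in_range D1 D2 a b ->
     z ^+ 90 <= a%:R /\ z ^+ 90 <= b%:R) ->
  (0 < A)%N -> (0 < B)%N ->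
  normc (\sum_(A <= a < A + A) \sum_(B <= b < B + B | in_range D1 D2 a b)
     al a * be b * cexp (X / ((a * b)%:R + kap))) * z ^+ 12 <= (2 + test_const k) * z ^+ 459.
Proof.
move=> hk Xlo Xhi hkap hD1 hD2 al1 be1 supp A0 B0.
have [k0 z100 _] := hk.
have zp j : 0 < z ^+ j by rewrite exprn_gt0 //; move: z100; clear; lra.
have C1 := test_const_ge1 k0.
set T := \sum_(_ <= _ < _) _.
pose cond a b := [&& in_range D1 D2 a b, al a != 0 & be b != 0].
have [/hasP[a ha /hasP[b hb /and3P[hab ala beb]]]|hno] := boolP
   (has (fun a => has (cond a) (index_iota B (B + B))) (index_iota A (A + A))); last first.
  have -> : T = 0.
    rewrite /T big_nat big1 // => a ha; rewrite big_nat_cond big1 // => b /andP[hb hc].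
    move/hasPn: hno => /(_ a); rewrite mem_index_iota ha => /(_ isT)/hasPn/(_ b).
    rewrite mem_index_iota hb => /(_ isT); rewrite /cond hc /= negb_and !negbK.
    by move=> /orP[/eqP ->|/eqP ->]; rewrite ?mulr0 ?mul0r.
  rewrite normc0 mul0r; apply: mulr_ge0; [move: C1; clear; lra|exact: ltW].
have {}ha : (A <= a < A + A)%N by rewrite mem_index_iota in ha.
have {}hb : (B <= b < B + B)%N by rewrite mem_index_iota in hb.
have [za zb] := supp a b ala beb hab.
have Az : z ^+ 90 <= 2 * A%:R.
  by apply: le_trans za _; rewrite -natrM ler_nat; move: ha; clear; lia.
have Bz : z ^+ 90 <= 2 * B%:R.
  by apply: le_trans zb _; rewrite -natrM ler_nat; move: hb; clear; lia.
have ABz : (A * B)%:R <= z ^+ 459.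
  apply: le_trans hD2; rewrite ler_nat; move: hab ha hb; rewrite /in_range; clear; nia.
apply: le_trans (_ : (2 + test_const k) * (A * B)%:R <= _); last first.
  by apply: ler_wpM2l => //; move: C1; clear; lra.
have [BA|/ltnW AB] := leqP B A.
  exact: (bilinear_block_long_first hk Xlo Xhi hkap hD1 hD2 al1 be1 BA Bz).
have -> : T = \sum_(B <= b < B + B) \sum_(A <= a < A + A | (D1 < b * a <= D2)%N)
   be b * al a * cexp (X / ((b * a)%:R + kap)).
  rewrite /T; under eq_bigr => i _ do rewrite big_mkcond /=.
  rewrite exchange_big /=; apply: eq_bigr => j _; rewrite [RHS]big_mkcond /=.
  apply: eq_bigr => i _; rewrite in_rangeC /in_range; case: ifP => // _.
  by rewrite mulnC [be j * _]mulrC.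
rewrite mulnC; exact: (bilinear_block_long_first hk Xlo Xhi hkap hD1 hD2 be1 al1 AB Az).
Qed.

(** Bilinear sums with arbitrary bounded coefficients save z^12, up to the number of
    dyadic blocks, as soon as both variables are at least z^90 in the range. *)
Lemma bilinear_sum (z k X kap : R) (D1 D2 L : nat) (al be : nat -> R[i]) :
  log_sqr_bounded z k -> z ^+ 914 <= X -> X <= z ^+ 930 -> 0 <= kap <= 1 ->
  z ^+ 455 <= D1.+1%:R -> D2%:R <= z ^+ 459 ->
  (forall n, normc (al n) <= 1) -> (forall n, normc (be n) <= 1) ->
  (forall a b, al a != 0 -> be b != 0 -> in_range D1 D2 a b ->
     z ^+ 90 <= a%:R /\ z ^+ 90 <= b%:R) ->
  normc (\sum_(1 <= a < 2 ^ L) \sum_(1 <= b < 2 ^ L | in_range D1 D2 a b)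
     al a * be b * cexp (X / ((a * b)%:R + kap))) * z ^+ 12 <=
  (2 + test_const k) * L%:R ^+ 2 * z ^+ 459.
Proof.
move=> hk Xlo Xhi hkap hD1 hD2 al1 be1 supp.
have [k0 z100 _] := hk.
have zp j : 0 < z ^+ j by rewrite exprn_gt0 //; move: z100; clear; lra.
have -> : \sum_(1 <= a < 2 ^ L) \sum_(1 <= b < 2 ^ L | in_range D1 D2 a b)
     al a * be b * cexp (X / ((a * b)%:R + kap)) =
   \sum_(0 <= i < L) \sum_(0 <= j < L) \sum_(2 ^ i <= a < 2 ^ i + 2 ^ i)
     \sum_(2 ^ j <= b < 2 ^ j + 2 ^ j | in_range D1 D2 a b)
     al a * be b * cexp (X / ((a * b)%:R + kap)).
  rewrite sum_dyadic; apply: eq_bigr => i _.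
  rewrite exchange_big /=; apply: eq_bigr => a _.
  rewrite big_mkcond /= sum_dyadic; apply: eq_bigr => j _.
  by rewrite [RHS]big_mkcond.
rewrite -ler_pdivlMr //.
have -> : (2 + test_const k) * L%:R ^+ 2 * z ^+ 459 / z ^+ 12 =
    (L - 0)%:R * ((L - 0)%:R * ((2 + test_const k) * z ^+ 459 / z ^+ 12)).
  by rewrite subn0; ring.
apply: le_trans (normc_sum _ _ _) _; apply: sum_le_const => i _.
apply: le_trans (normc_sum _ _ _) _; apply: sum_le_const => j _.
rewrite ler_pdivlMr //.
by apply: (bilinear_block hk Xlo Xhi hkap hD1 hD2 al1 be1 supp); rewrite expn_gt0.
Qed.

(** The multiples of a small b: no coefficients, hence no loss by Cauchy--Schwarz. *)
Lemma progression_sum (z k X kap : R) (D1 D2 L b : nat) :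
  log_sqr_bounded z k -> z ^+ 914 <= X -> X <= z ^+ 930 -> 0 <= kap <= 1 ->
  z ^+ 455 <= D1.+1%:R -> D2%:R <= z ^+ 459 -> (0 < b)%N -> b%:R <= z ^+ 100 ->
  normc (\sum_(1 <= a < 2 ^ L | in_range D1 D2 a b) cexp (X / ((a * b)%:R + kap))) * z ^+ 24
   <= test_const k * L%:R * z ^+ 459 / b%:R.
Proof.
move=> hk Xlo Xhi hkap hD1 hD2 b0 bz.
have [k0 z100 hlog] := hk.
have z1 : 1 <= z by move: z100; clear; lra.
have zp j : 0 < z ^+ j by rewrite exprn_gt0 //; move: z100; clear; lra.
have zmono i j : (i <= j)%N -> z ^+ i <= z ^+ j by move=> ij; rewrite ler_weXn2l.
have C1 := test_const_ge1 k0.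
have bp : 0 < b%:R :> R by rewrite ltr0n.
have X0 : 0 < X by apply: lt_le_trans Xlo.
have C0 : 0 <= test_const k * z ^+ 459 / b%:R.
  by apply: divr_ge0; [apply: mulr_ge0; [move: C1; clear; lra|exact: ltW]|exact: ltW].
rewrite big_mkcond sum_dyadic -ler_pdivlMr //.
have -> : test_const k * L%:R * z ^+ 459 / b%:R / z ^+ 24 =
    (L - 0)%:R * (test_const k * z ^+ 459 / b%:R / z ^+ 24).
  by rewrite subn0; ring.
apply: le_trans (normc_sum _ _ _) _; apply: sum_le_const => i _.
rewrite ler_pdivlMr // -big_mkcond /=.
have : (0 < 2 ^ i)%N by rewrite expn_gt0.
move: (2 ^ i)%N => A A0; have Ap : 0 < A%:R :> R by rewrite ltr0n.
set T := \sum_(_ <= _ < _ | _) _.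
have [/hasP[a ha hab]|hno] := boolP (has (fun a => in_range D1 D2 a b) (index_iota A (A + A))); last first.
  have -> : T = 0.
    rewrite /T big_nat_cond big1 // => a /andP[ha hc].
    by move/hasPn: hno => /(_ a); rewrite mem_index_iota ha => /(_ isT); rewrite hc.
  by rewrite normc0 mul0r.
have {}ha : (A <= a < A + A)%N by rewrite mem_index_iota in ha.
have Ab2 : z ^+ 455 <= 2 * (A%:R * b%:R).
  apply: le_trans hD1 _; rewrite -!natrM ler_nat; move: hab ha; rewrite /in_range; clear; nia.
have Abhi : A%:R * b%:R <= z ^+ 459.
  apply: le_trans hD2; rewrite -!natrM ler_nat; move: hab ha; rewrite /in_range; clear; nia.
have A355 : z ^+ 355 <= 2 * A%:R.
  rewrite -(ler_pM2r (zp 100%N)) -exprD; apply: le_trans Ab2 _.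
  by rewrite -mulrA ler_pM2l // ler_pM2l.
have AAb : A%:R <= A%:R * b%:R :> R by rewrite ler_peMr ?(ltW Ap) // ler1n.
pose A1 := maxn A (D1 %/ b).+1.
pose A2 := minn (A + A) (D2 %/ b).+1.
have -> : T = \sum_(A1 <= n < A2) cexp (X / (n%:R * b%:R + kap)).
  rewrite /T (@sum_nat_subinterval _ A (A + A) A1 A2); last 3 first.
  - by rewrite leq_max leqnn.
  - by rewrite geq_min leqnn.
  - move=> j /andP[i1 i2]; rewrite /in_range /A1 /A2 !geq_max !leq_min i1 i2 /= !ltnS.
    by rewrite leq_divRL // ltn_divLR.
  by apply: eq_bigr => n _; rewrite natrM.
apply: le_trans (_ : test_const k * A%:R <= _); last first.
  by rewrite -mulrA; apply: ler_wpM2l; [move: C1; clear; lra|rewrite ler_pdivlMr].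
apply: (single_phase_sum k0 z100 X0 hkap b0).
- by apply: hlog => //; apply: le_trans Abhi.
- by apply: le_trans A355; apply: zmono.
- have -> : X / (A%:R ^+ 4 * b%:R) * A%:R ^+ 2 * z ^+ 4 = (X * z ^+ 4) / (A%:R ^+ 2 * b%:R).
    by field; rewrite !gt_eqF.
  rewrite ler_pdivlMr ?mulr_gt0 ?exprn_gt0 // mul1r.
  apply: le_trans (_ : (A%:R * b%:R) ^+ 2 <= _).
    rewrite exprMn; apply: ler_wpM2l; first exact: sqr_ge0.
    by rewrite -[leLHS]mulr1 expr2 ler_pM2l // ler1n.
  apply: le_trans (_ : z ^+ 914 * z ^+ 4 <= _); last by rewrite ler_wpM2r // ltW.
  rewrite -exprD -[(914 + 4)%N]/(459 * 2)%N exprM.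
  by rewrite ler_sqr ?nnegrE ?(ltW (zp _)) // mulr_ge0 // ltW.
- rewrite mulrAC ler_pdivrMr ?mulr_gt0 ?exprn_gt0 //.
  apply: le_trans (_ : z ^+ 930 * z ^+ 203 <= _); first by rewrite ler_wpM2r // ltW.
  have h1 : z ^+ 355 ^+ 3 <= (2 * A%:R) ^+ 3.
    by rewrite lerXn2r ?nnegrE ?(ltW (zp _)) // mulr_ge0 // ltW.
  have h2 : z ^+ 355 ^+ 3 * z ^+ 455 <= (2 * A%:R) ^+ 3 * (2 * (A%:R * b%:R)).
    by apply: ler_pM => //; [apply: exprn_ge0; exact: ltW|exact: ltW].
  have e : (2 * A%:R) ^+ 3 * (2 * (A%:R * b%:R)) = 16 * (A%:R ^+ 4 * b%:R) :> R by ring.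
  rewrite -exprM -exprD in h2.
  have h3 : z ^+ 930 * z ^+ 203 <= 16 * (A%:R ^+ 4 * b%:R).
    by rewrite -e; apply: le_trans h2; rewrite -exprD; exact: zmono.
  apply: le_trans h3 _; by rewrite ler_pM2r ?mulr_gt0 ?exprn_gt0 //; clear; lra.
- by rewrite leq_max leqnn.
- by rewrite geq_min leqnn.
Qed.

End DyadicSums.

(** * Multiplicative decomposition of omega *)

Section Prefix.
Local Open Scope nat_scope.

(** Writing the prime factors of n = s r in increasing order, s is the shortest
    initial product that exceeds U. *)
Definition prefix_fact (U s r : nat) : bool :=
  [&& U < s, s %/ max_pdiv s <= U & (r == 1) || (max_pdiv s <= pdiv r)].

Lemma prime_dvd_le_max_pdiv n q : 0 < n -> prime q -> q %| n -> q <= max_pdiv n.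
Proof. by move=> n0 pq qn; apply: max_pdiv_max; rewrite mem_primes pq n0 qn. Qed.

(** The cofactor consists of the largest primes, so it contains the largest one. *)
Lemma prefix_fact_max_dvd U s r : 0 < s -> 1 < r -> prefix_fact U s r ->
  max_pdiv (s * r) %| r.
Proof.
move=> s0 r1 /and3P[_ _ /orP[/eqP r1'|sr]]; first by rewrite r1' in r1.
have n1 : 1 < s * r by apply: leq_trans r1 _; rewrite leq_pmull.
have pp := max_pdiv_prime n1; have := max_pdiv_dvd (s * r).
rewrite Euclid_dvdM // => /orP[ps|//].
have h1 := prime_dvd_le_max_pdiv s0 pp ps.
have h2 : pdiv r <= max_pdiv (s * r).
  apply: prime_dvd_le_max_pdiv; [exact: ltnW|exact: pdiv_prime|].
  by apply: dvdn_trans (pdiv_dvd r) _; rewrite dvdn_mull.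
have -> : max_pdiv (s * r) = pdiv r by apply/eqP; rewrite eqn_leq h2 andbT (leq_trans h1).
exact: pdiv_dvd.
Qed.

(** Induction on n, removing its largest prime p: if n / p <= U the whole of n is
    needed to exceed U, otherwise the initial product is the one of n / p. *)
Lemma prefix_fact_exists_unique U n : 0 < U -> U < n ->
  exists s, [/\ s %| n, prefix_fact U s (n %/ s) &
    forall s', s' %| n -> prefix_fact U s' (n %/ s') -> s' = s].
Proof.
move=> U0; have [N] := ubnP n; elim: N n => // N IH n nN Un.
have n1 : 1 < n by apply: leq_ltn_trans Un.
have n0 : 0 < n by apply: ltnW.
set p := max_pdiv n; have pp : prime p by apply: max_pdiv_prime.
have p0 : 0 < p by apply: prime_gt0.
have pn : p %| n by apply: max_pdiv_dvd.
pose m := n %/ p; have nE : n = m * p by rewrite /m divnK.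
have m0 : 0 < m by rewrite divn_gt0 // dvdn_leq.
have mn : m < n by rewrite ltn_Pdiv // prime_gt1.
(* A competitor s' <> n leaves the largest prime p of n in its cofactor, so it
   is already a divisor of n / p, where the induction hypothesis applies. *)
have comp s' : s' %| n -> prefix_fact U s' (n %/ s') -> s' <> n ->
    s' %| m /\ n %/ s' = m %/ s' * p.
  move=> sn ps sneq.
  have s0 : 0 < s' by apply: dvdn_gt0 sn.
  have r1 : 1 < n %/ s'.
    have r0 : 0 < n %/ s' by rewrite divn_gt0 // dvdn_leq.
    rewrite ltn_neqAle r0 andbT eq_sym; apply/eqP => e.
    by apply: sneq; rewrite -[RHS](divnK sn) e mul1n.
  have := prefix_fact_max_dvd s0 r1 ps; rewrite mulnC divnK // -/p => pr.
  have e : n = n %/ s' %/ p * s' * p by rewrite mulnAC divnK // divnK.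
  have em : m = n %/ s' %/ p * s' by rewrite /m {1}e mulnK.
  by rewrite em dvdn_mull // mulnK // divnK.
have [mU|Um] := leqP m U.
  exists n; split => //.
    by rewrite /prefix_fact divnn n0 Un mU.
  move=> s' sn ps; apply/eqP; apply/negPn/negP => /eqP sneq.
  have [sm _] := comp s' sn ps sneq.
  have /andP[Us _] := ps; move: (leq_ltn_trans mU Us).
  by rewrite ltnNge dvdn_leq.
have [|s [sm ps us]] := IH m _ Um; first exact: leq_trans mn _.
exists s; have s0 : 0 < s by apply: dvdn_gt0 sm.
have sn : s %| n by rewrite nE dvdn_mulr.
have nsE : n %/ s = m %/ s * p by rewrite nE divn_mulAC.
split => //.
  case/and3P: ps => h1 h2 h3; apply/and3P; split => //.
  apply/orP; right; rewrite nsE.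
  have s1 : 1 < s by apply: leq_ltn_trans h1.
  have ms0 : 0 < m %/ s by rewrite divn_gt0 // dvdn_leq.
  have k1 : 1 < m %/ s * p by apply: leq_trans (prime_gt1 pp) _; rewrite leq_pmull.
  have := pdiv_dvd (m %/ s * p); have qp := pdiv_prime k1.
  rewrite Euclid_dvdM // => /orP[q1|q1].
    case/orP: h3 => [/eqP e|h3].
      by move: q1 qp; rewrite e dvdn1 => /eqP ->.
    by apply: leq_trans h3 _; apply: pdiv_min_dvd => //; apply: prime_gt1.
  move: q1; rewrite dvdn_prime2 // => /eqP ->.
  apply: prime_dvd_le_max_pdiv => //; first exact: max_pdiv_prime.
  exact: dvdn_trans (max_pdiv_dvd s) sn.
move=> s' sn' ps'; have [e|/eqP sneq] := eqVneq s' n.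
  by case/and3P: ps' => _; rewrite e -/p -/m leqNgt Um.
have [sm' e] := comp s' sn' ps' sneq; apply: us => //.
case/and3P: ps' => h1 h2 h3; apply/and3P; split => //.
have [//|ms1] := eqVneq (m %/ s') 1; apply/orP; right.
have s0' : 0 < s' by apply: dvdn_gt0 sn'.
have ms0 : 0 < m %/ s' by rewrite divn_gt0 // dvdn_leq.
have ms2 : 1 < m %/ s' by rewrite ltn_neqAle eq_sym ms1.
case/orP: h3 => [/eqP e1|h3].
  by move: e; rewrite e1 => e2; have := leq_mul ms2 p0; rewrite muln1 -e2 ltnn.
apply: leq_trans h3 _; apply: pdiv_min_dvd; first exact: prime_gt1 (pdiv_prime _).
by rewrite e; apply: dvdn_trans (pdiv_dvd _) _; rewrite dvdn_mulr.
Qed.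

Lemma sum_prefix_fact U K n : 0 < U -> U < n -> n < K ->
  \sum_(1 <= s < K | s %| n) (prefix_fact U s (n %/ s) : nat) = 1.
Proof.
move=> U0 Un nK; have n0 : 0 < n by apply: leq_ltn_trans Un.
have [s [sn ps us]] := prefix_fact_exists_unique U0 Un.
have s0 : 0 < s by apply: dvdn_gt0 sn.
have sK : s < K by apply: leq_ltn_trans nK; apply: dvdn_leq.
rewrite big_mkcond (bigD1_seq s) ?mem_index_iota ?iota_uniq ?s0 ?sK //= sn ps.
rewrite big1 // => s' neq; case: ifP => // sn'; case h : (prefix_fact _ _ _) => //.
by move: neq; rewrite (us s' sn' h) eqxx.
Qed.

Lemma max_pdiv_mul_le s r Y : 0 < s -> 0 < r -> 0 < Y ->
  (max_pdiv (s * r) <= Y) = (max_pdiv s <= Y) && (max_pdiv r <= Y).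
Proof.
move=> s0 r0 Y0; have n0 : 0 < s * r by rewrite muln_gt0 s0.
have le d : 0 < d -> d %| s * r -> max_pdiv d <= maxn 1 (max_pdiv (s * r)).
  move=> d0 dn; have [->|d1] := eqVneq d 1; first by rewrite leq_max.
  have d2 : 1 < d by rewrite ltn_neqAle eq_sym d1.
  rewrite leq_max prime_dvd_le_max_pdiv ?orbT ?max_pdiv_prime //.
  exact: dvdn_trans (max_pdiv_dvd d) dn.
apply/idP/andP => [h|[h1 h2]].
  have hY : maxn 1 (max_pdiv (s * r)) <= Y by rewrite geq_max Y0.
  split; [apply: leq_trans (le s s0 _) hY|apply: leq_trans (le r r0 _) hY].
    exact: dvdn_mulr.
  exact: dvdn_mull.
have [->|n1] := eqVneq (s * r) 1; first by [].
have n2 : 1 < s * r by rewrite ltn_neqAle eq_sym n1.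
have pp := max_pdiv_prime n2; have := max_pdiv_dvd (s * r).
rewrite Euclid_dvdM // => /orP[] /prime_dvd_le_max_pdiv h; apply: leq_trans (h _ _) _ => //.
Qed.

Lemma omega_sum K n : 0 < n -> n < K ->
  omega n = \sum_(1 <= p < K | p %| n) (prime p : nat).
Proof.
move=> n0 nK; rewrite /omega -sum1_size.
rewrite -big_mkcondr /= -[RHS]big_filter.
apply: perm_big; apply: uniq_perm; rewrite ?primes_uniq ?filter_uniq ?iota_uniq // => p.
rewrite mem_filter mem_primes mem_index_iota n0 /=.
case pp : (prime p); rewrite /= ?andbF //; case pn : (p %| n) => //=.
by rewrite prime_gt0 //= (leq_ltn_trans _ nK) // dvdn_leq.
Qed.

(** Two distinct prime factors above Y would have a product above n. *)
Lemma sum_large_primes K n Y : 0 < n -> n < K -> n < Y.+1 * Y.+1 -> 0 < Y ->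
  \sum_(1 <= p < K | p %| n) (prime p && (Y < p) : nat) = (Y < max_pdiv n).
Proof.
move=> n0 nK nY Y0; set q := max_pdiv n.
have [n1|n1] := eqVneq n 1.
  rewrite /q n1 big1 // => [|p]; first by rewrite ltnNge Y0.
  by rewrite dvdn1 => /eqP ->.
have n2 : 1 < n by rewrite ltn_neqAle eq_sym n1.
have pq : prime q by apply: max_pdiv_prime.
have qn : q %| n by apply: max_pdiv_dvd.
have qK : q < K by apply: leq_ltn_trans nK; apply: dvdn_leq.
rewrite big_mkcond (bigD1_seq q) ?mem_index_iota ?iota_uniq ?prime_gt0 ?qK //= qn pq /=.
rewrite big1 ?addn0 // => p neq; case: ifP => // pn.
case h : (prime p && (Y < p)) => //; case/andP: h => pp Yp.
have pqle : p <= q by apply: prime_dvd_le_max_pdiv.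
have : p * q <= n.
  apply: dvdn_leq => //; rewrite Gauss_dvd ?pn ?qn //.
  by rewrite prime_coprime // dvdn_prime2.
move=> /leq_ltn_trans/(_ nY); rewrite ltnNge => /negP[].
by apply: leq_mul => //; apply: leq_trans pqle.
Qed.

(** Primes above Y are detected by their absence: their number is 0 or 1, and it is
    0 exactly when all primes of n are at most Y, in which case n has one prefix
    factorization with both factors free of primes above Y. *)
Lemma omega_decomposition U Y K n : 0 < U -> U <= Y -> U < n -> n < K -> n < Y.+1 * Y.+1 ->
  omega n + \sum_(1 <= s < K | s %| n)
      ([&& prefix_fact U s (n %/ s), max_pdiv s <= Y & max_pdiv (n %/ s) <= Y] : nat) =
  \sum_(1 <= p < K | p %| n) (prime p && (p <= U) : nat) +
  \sum_(1 <= p < K | p %| n) (prime p && (U < p <= Y) : nat) + 1.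
Proof.
move=> U0 UY Un nK nY; have n0 : 0 < n by apply: leq_ltn_trans Un.
have Y0 : 0 < Y by apply: leq_trans UY.
have -> : omega n = \sum_(1 <= p < K | p %| n) (prime p && (p <= U) : nat) +
  \sum_(1 <= p < K | p %| n) (prime p && (U < p <= Y) : nat) + (Y < max_pdiv n).
  rewrite (@omega_sum K) // -(sum_large_primes n0 nK nY Y0) -!big_split /=.
  apply: eq_bigr => p _; case: (prime p) => //=.
  have [pU|pU] := leqP p U => /=; first by rewrite ltnNge (leq_trans pU UY).
  by case: leqP.
rewrite -!addnA; congr (_ + (_ + _)).
have -> : \sum_(1 <= s < K | s %| n)
    ([&& prefix_fact U s (n %/ s), max_pdiv s <= Y & max_pdiv (n %/ s) <= Y] : nat) =
    \sum_(1 <= s < K | s %| n) (prefix_fact U s (n %/ s) : nat) * (max_pdiv n <= Y).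
  apply: eq_bigr => s sn.
  have s0 : 0 < s by apply: dvdn_gt0 sn.
  have r0 : 0 < n %/ s by rewrite divn_gt0 // dvdn_leq.
  have -> : (max_pdiv n <= Y) = (max_pdiv s <= Y) && (max_pdiv (n %/ s) <= Y).
    by rewrite -{1}(divnK sn) mulnC max_pdiv_mul_le.
  by case: prefix_fact => //=; rewrite mul1n.
rewrite -big_distrl /= sum_prefix_fact // mul1n.
by case: leqP.
Qed.

End Prefix.

(** * Finite Fourier analysis and separation of variables *)

Section Separation.
Context {R : realType}.

Lemma normc_1BcexpN (t : R) : normc (1 - cexp (- t)) = normc (1 - cexp t).
Proof. by rewrite !normc_1Bcexp mulrN sinN normrN. Qed.

Lemma geom_cexp (t : R) (J : nat) :
  (1 - cexp t) * \sum_(0 <= j < J) cexp (j%:R * t) = 1 - cexp (J%:R * t).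
Proof.
elim: J => [|J ih]; first by rewrite big_geq // mulr0 mul0r cexp0 subrr.
have -> : J.+1%:R * t = J%:R * t + t by rewrite -natr1 mulrDl mul1r.
by rewrite big_nat_recr //= mulrDr ih cexpD; ring.
Qed.

(** Orthogonality of the additive characters modulo q. *)
Lemma char_sum (q m n : nat) : (0 < q)%N -> (2 * (m - n) <= q)%N -> (2 * (n - m) <= q)%N ->
  \sum_(0 <= k < q) cexp (k%:R * ((m%:R - n%:R) / q%:R : R)) = if m == n then q%:R else 0.
Proof.
move=> q0 h1 h2; have qp : 0 < q%:R :> R by rewrite ltr0n.
case: eqVneq => [->|mn].
  rewrite subrr mul0r; under eq_bigr => k _ do rewrite mulr0 cexp0.
  by rewrite big_const_nat iter_addr_0 subn0.
set t : R := (m%:R - n%:R) / q%:R.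
have t0 : t != 0.
  by rewrite mulf_neq0 ?invr_eq0 ?(gt_eqF qp) // subr_eq0 eqr_nat.
have ht : `|t| <= 1 / 2.
  rewrite normrM normfV (ger0_norm (ltW qp)) ler_pdivrMr // mulrAC ler_pdivlMr // mul1r.
  have h1' : 2 * m%:R <= 2 * n%:R + q%:R :> R by rewrite -!natrM -natrD ler_nat; move: h1; clear; lia.
  have h2' : 2 * n%:R <= 2 * m%:R + q%:R :> R by rewrite -!natrM -natrD ler_nat; move: h2; clear; lia.
  have [h|h] := leP 0 (m%:R - n%:R : R); [rewrite (ger0_norm h)|rewrite (ltr0_norm h)].
    by move: h1'; clear; lra.
  by move: h2'; clear; lra.
have nz : 1 - cexp t != 0.
  apply/eqP => e; have := normc_1Bcexp_ge ht; rewrite e normc0 leNgt.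
  by rewrite mulr_gt0 ?pi_gt0 ?normr_gt0.
apply: (mulfI nz); rewrite geom_cexp mulr0.
have -> : q%:R * t = (m%:Z - n%:Z)%:~R.
  by rewrite /t rmorphB /=; field; rewrite gt_eqF.
by rewrite cexp_int subrr.
Qed.

(** The point k / q is at distance min (k, q - k) / q from the integers; the sum of
    the two reciprocals is easier to add up than the reciprocal of the minimum. *)
Lemma normc_1Bcexp_frac (k q : nat) : (0 < k < q)%N ->
  1 <= normc (1 - cexp (k%:R / q%:R : R)) * (q%:R * (k%:R^-1 + (q - k)%:R^-1)).
Proof.
move=> /andP[k0 kq]; have kp : 0 < k%:R :> R by rewrite ltr0n.
have q0 : 0 < q%:R :> R by rewrite ltr0n; apply: leq_ltn_trans kq.
have qkp : 0 < (q - k)%:R :> R by rewrite ltr0n subn_gt0.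
have key (j : nat) : (0 < j)%N -> (2 * j <= q)%N ->
    1 <= normc (1 - cexp (j%:R / q%:R : R)) * (q%:R * j%:R^-1).
  move=> j0 jq; have jp : 0 < j%:R :> R by rewrite ltr0n.
  have jq0 : 0 <= j%:R / q%:R :> R by rewrite divr_ge0 // ltW.
  have hh : `|j%:R / q%:R : R| <= 1 / 2.
    rewrite ger0_norm // ler_pdivrMr // mulrAC ler_pdivlMr // mul1r -natrM ler_nat.
    by rewrite mulnC.
  have := normc_1Bcexp_ge hh; rewrite (ger0_norm jq0) => h.
  apply: le_trans (_ : pi * (j%:R / q%:R) * (q%:R * j%:R^-1) <= _); last first.
    by rewrite ler_wpM2r // mulr_ge0 ?invr_ge0 // ltW.
  have -> : pi * (j%:R / q%:R) * (q%:R * j%:R^-1) = pi :> R by field; rewrite !gt_eqF.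
  by apply: le_trans (pi_ge2 R); rewrite ler1n.
have n0 := @normc_ge0 R (1 - cexp (k%:R / q%:R : R)).
have [h|h] := leqP (2 * k) q.
  apply: le_trans (key k k0 h) _; rewrite ler_wpM2l // ler_pM2l // lerDl invr_ge0 ltW //.
have e : normc (1 - cexp (k%:R / q%:R : R)) = normc (1 - cexp ((q - k)%:R / q%:R : R)).
  rewrite -[RHS]normc_1BcexpN natrB ?(ltnW kq) //.
  have -> : - ((q%:R - k%:R) / q%:R) = k%:R / q%:R - 1 :> R by field; rewrite gt_eqF.
  by rewrite cexpB cexp1 conjc1 mulr1.
rewrite e in n0 *.
have h' : (2 * (q - k) <= q)%N by move: h; clear; lia.
have h0 : (0 < q - k)%N by rewrite subn_gt0.
apply: le_trans (key _ h0 h') _; rewrite ler_wpM2l // ler_pM2l // lerDr invr_ge0 ltW //.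
Qed.

Lemma sum_inv_sym (q : nat) :
  \sum_(1 <= k < q) (k%:R^-1 + (q - k)%:R^-1) = 2 * harm q :> R.
Proof.
rewrite big_split /= [X in _ + X]big_nat_rev /= add1n.
have -> : \sum_(1 <= i < q) (q - (q.+1 - i.+1))%:R^-1 = harm q :> R.
  apply: eq_big_nat => i /andP[i1 i2]; congr (_%:R^-1); move: i1 i2; clear; lia.
by rewrite -/(harm q) mulr2n mulrDl mul1r.
Qed.

(** The Fourier coefficients of the indicator of [0, Y] modulo 4 (Y + 1). The modulus
    exceeds 2 Y enough to make v - u determined by its residue. *)
Definition le_coef (Y k : nat) : R[i] :=
  ((4 * Y.+1)%:R)^-1 * \sum_(0 <= j < Y.+1) cexp (j%:R * (- (k%:R / (4 * Y.+1)%:R)) : R).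

(** The condition u <= v splits into products of a function of u and a function of
    v. The coefficients have a sum of order log Y, so a bilinear sum with this side
    condition is hardly worse than one without. *)
Lemma le_separation (Y u v : nat) : (u <= Y)%N -> (v <= Y)%N ->
  (u <= v)%:R = \sum_(0 <= k < 4 * Y.+1) le_coef Y k *
     (cexp (- (k%:R * (u%:R / (4 * Y.+1)%:R))) * cexp (k%:R * (v%:R / (4 * Y.+1)%:R) : R)).
Proof.
move=> uY vY; set q := (4 * Y.+1)%N.
have q0 : (0 < q)%N by [].
have qn : q%:R != 0 :> R[i] by rewrite pnatr_eq0 -lt0n.
have qnR : q%:R != 0 :> R by rewrite pnatr_eq0 -lt0n.
transitivity (q%:R^-1 * \sum_(0 <= j < Y.+1) \sum_(0 <= k < q)
   cexp (k%:R * ((v%:R - (u + j)%:R) / q%:R : R))); last first.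
  rewrite exchange_big /= big_distrr /=; apply: eq_bigr => k _.
  rewrite /le_coef -/q -mulrA; congr (_ * _); rewrite big_distrl /=.
  apply: eq_bigr => j _; rewrite -!cexpD; congr cexp; rewrite natrD; ring.
have e (j : nat) : (j <= Y)%N -> \sum_(0 <= k < q) cexp (k%:R * ((v%:R - (u + j)%:R) / q%:R : R))
   = (v == (u + j)%N)%:R * q%:R.
  move=> jY; rewrite char_sum //; last 2 first.
  - by move: uY vY jY; rewrite /q; clear; lia.
  - by move: uY vY jY; rewrite /q; clear; lia.
  by case: eqP; rewrite ?mul1r ?mul0r.
rewrite (@eq_big_nat _ _ _ _ _ _ (fun j => (v == (u + j)%N)%:R * q%:R)); last first.
  by move=> j /andP[_ jY]; apply: e.
rewrite -big_distrl /= mulrCA mulVf // mulr1.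
have [uv|vu] := leqP u v.
  rewrite (bigD1_seq (v - u)%N) ?mem_index_iota ?iota_uniq //=; last first.
    by rewrite ltnS; apply: leq_trans vY; exact: leq_subr.
  rewrite subnKC // eqxx big1 ?addr0 // => j jn; case: eqP => // e'.
  by move: jn; rewrite e' addKn eqxx.
by rewrite big1 // => j _; case: eqP => // e'; move: vu; rewrite e' ltnNge leq_addr.
Qed.

Lemma sum_le_coef (Y : nat) :
  \sum_(0 <= k < 4 * Y.+1) normc (le_coef Y k) <= 1 + 4 * harm (4 * Y.+1).
Proof.
set q := (4 * Y.+1)%N; have q0 : (0 < q)%N by [].
have qp : 0 < q%:R :> R by rewrite ltr0n.
have nq : normc (q%:R^-1 : R[i]) = q%:R^-1 by rewrite normcV normc_nat.
rewrite big_ltn //; apply: lerD.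
  rewrite /le_coef -/q normcM nq ler_pdivrMl // mulr1.
  apply: le_trans (normc_sum _ _ _) _.
  apply: le_trans (_ : (Y.+1 - 0)%:R * 1 <= _).
    by apply: sum_le_const => j _; rewrite normc_cexp.
  by rewrite mulr1 subn0 ler_nat /q leq_pmull.
apply: le_trans (_ : \sum_(1 <= k < q) 2 * (k%:R^-1 + (q - k)%:R^-1) <= _); last first.
  by rewrite -big_distrr /= sum_inv_sym mulrA -natrM.
apply: ler_sum_nat => k hk.
have h := normc_1Bcexp_frac hk.
set w := normc _ in h; set s := _ + _ in h *.
have w0 : 0 < w.
  rewrite lt_def normc_ge0 andbT; apply/eqP => e; move: h.
  by rewrite e mul0r ler10.
rewrite /le_coef -/q normcM nq.
set G := \sum_(_ <= _ < _) _.
have G2 : w * normc G <= 2.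
  have -> : w = normc (1 - cexp (- (k%:R / q%:R)) : R[i]).
    by rewrite normc_1BcexpN.
  rewrite -normcM geom_cexp; apply: le_trans (normcB _ _) _.
  by rewrite -cexp0 !normc_cexp; lra.
have G0 := normc_ge0 G.
have s0 : 0 <= s by rewrite addr_ge0 ?invr_ge0.
rewrite ler_pdivrMl //.
apply: le_trans (_ : (w * (q%:R * s)) * normc G <= _).
  by rewrite -[leLHS]mul1r ler_wpM2r.
have -> : w * (q%:R * s) * normc G = q%:R * s * (w * normc G) by ring.
have -> : q%:R * (2 * s) = q%:R * s * 2 by ring.
by rewrite ler_wpM2l // mulr_ge0 // ltW.
Qed.

End Separation.

(** * The exponential sum over omega *)

Section OmegaSum.
Context {R : realType}.

Definition omega_const (l : R) : R :=
  let C := test_const (l ^+ 2) in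
  C * l ^+ 2 + C * l + (2 + C) * l ^+ 2 + (1 + 4 * l) * ((2 + C) * l ^+ 2).

(** Hyperbola rearrangement: pairs (a, b) grouped by their product. *)
Lemma sum_pairs_divisors (D1 D2 K : nat) (c : nat -> nat -> R[i]) (F : nat -> R[i]) :
  (D2 < K)%N ->
  \sum_(1 <= a < K) \sum_(1 <= b < K | in_range D1 D2 a b) c a b * F (a * b)%N =
  \sum_(D1.+1 <= n < D2.+1) F n * \sum_(1 <= a < K | (a %| n)%N) c a (n %/ a)%N.
Proof.
move=> D2K.
under [RHS]eq_bigr => n _ do rewrite big_distrr /= big_mkcond /=.
rewrite [RHS]exchange_big /=; apply: eq_big_nat => a /andP[a0 aK].
transitivity (\sum_(1 <= b < K) \sum_(D1.+1 <= n < D2.+1 | n == (a * b)%N) c a b * F n).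
  rewrite big_mkcond; apply: eq_bigr => b _; rewrite big_nat1_eq.
  by rewrite /in_range.
under [LHS]eq_bigr => b _ do rewrite big_mkcond /=.
rewrite [LHS]exchange_big /=; apply: eq_big_nat => n /andP[n1 n2].
have n0 : (0 < n)%N by apply: leq_ltn_trans n1.
case: ifP => [an|an]; last first.
  rewrite big1 // => b _; case: eqP => // e; move: an.
  by rewrite e dvdn_mulr.
transitivity (\sum_(1 <= b < K | b == (n %/ a)%N) c a b * F n).
  rewrite [RHS]big_mkcond; apply: eq_bigr => b _.
  by rewrite [in RHS]eq_sym -[in RHS](eqn_pmul2l a0) [(a * (n %/ a))%N]mulnC divnK.
have nK : (n %/ a < K)%N.
  by apply: leq_ltn_trans (leq_div n a) _; apply: leq_ltn_trans D2K.
by rewrite big_nat1_eq nK divn_gt0 // dvdn_leq //= mulrC.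
Qed.

(** The exponential sum over omega. With U = z^100 and Y = z^230, primes up to U give
    progression sums, primes in ]U, Y] a bilinear sum, and the primes above Y the full
    sum minus the prefix factorizations n = s r; there s <= U Y <= z^330, so that both
    s and r exceed z^90, and the condition that the primes of s precede those of r is
    separated by additive characters. The saving z^12 of the bilinear sums pays for
    three logarithms, each at most a constant times z. *)
Lemma exp_sum_omega (z l X kap : R) (L : nat) :
  0 <= l -> 100 <= z ->
  (forall n : nat, (0 < n)%N -> n%:R <= z ^+ 459 -> 1 + ln n%:R <= l * z) ->
  z ^+ 914 <= X -> X <= z ^+ 930 -> 0 <= kap <= 1 ->
  (Num.truncn (z ^+ 459) < 2 ^ L)%N -> L%:R <= l * z ->
  normc (\sum_((Num.truncn (z ^+ 455)).+1 <= n < (Num.truncn (z ^+ 459)).+1)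
     (omega n)%:R * cexp (X / (n%:R + kap))) * z ^+ 9 <= omega_const l * z ^+ 459.
Proof.
move=> l0 z100 hlog Xlo Xhi hkap D2K hL.
set D1 := Num.truncn _; set D2 := Num.truncn _ in D2K *; set K := (2 ^ L)%N in D2K *.
have z1 : 1 <= z by move: z100; clear; lra.
have zp j : 0 < z ^+ j by rewrite exprn_gt0 //; move: z100; clear; lra.
have z0 : 0 < z by move: z100; clear; lra.
have zge1 j : 1 <= z ^+ j by rewrite exprn_ege1.
have zmono i j : (i <= j)%N -> z ^+ i <= z ^+ j by move=> ij; rewrite ler_weXn2l.
have lz0 : 0 <= l * z by rewrite mulr_ge0 // ltW.
have hD1 : z ^+ 455 <= D1.+1%:R by apply: ltW; apply: truncnS_gt.
have hD2 : D2%:R <= z ^+ 459 by rewrite truncn_le ltW.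
have hk : log_sqr_bounded z (l ^+ 2).
  split=> // [|n n0 nz]; first exact: sqr_ge0.
  rewrite -exprMn ler_sqr ?nnegrE ?hlog // addr_ge0 // ln_ge0 // ler1n //.
set C := test_const (l ^+ 2); have C1 : 1 <= C by apply: test_const_ge1; apply: sqr_ge0.
have C0 : 0 <= C by apply: le_trans C1.
have C20 : 0 <= 2 + C by rewrite addr_ge0.
have l20 : 0 <= l ^+ 2 by apply: sqr_ge0.
pose U := Num.truncn (z ^+ 100); pose Y := Num.truncn (z ^+ 230).
have U0 : (0 < U)%N by rewrite truncn_gt0.
have Uhi : U%:R <= z ^+ 100 by rewrite truncn_le ltW.
have Ulo (a : nat) : (U < a)%N -> z ^+ 90 <= a%:R.
  move=> Ua; apply: le_trans (zmono 90%N 100%N isT) _.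
  by apply: le_trans (ltW (truncnS_gt _)) _; rewrite ler_nat.
have Yhi : Y%:R <= z ^+ 230 by rewrite truncn_le ltW.
have UY : (U <= Y)%N by apply: le_truncn; exact: zmono.
have UD1 : (U <= D1)%N by apply: le_truncn; exact: zmono.
have D2Y : (D2 < Y.+1 * Y.+1)%N.
  rewrite -(ltr_nat R) natrM; apply: le_lt_trans hD2 _.
  apply: le_lt_trans (zmono 459%N (230 + 230)%N isT) _; rewrite exprD.
  have h := truncnS_gt (z ^+ 230); rewrite -/Y in h.
  by apply: ltr_pM => //; exact: ltW.
have cofactor (a b : nat) (i : nat) : (i <= 330)%N -> a%:R <= z ^+ i -> in_range D1 D2 a b -> z ^+ 90 <= b%:R.
  move=> hi ha /andP[h _]; have h1 : z ^+ 455 <= a%:R * b%:R.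
    by apply: le_trans hD1 _; rewrite -natrM ler_nat.
  rewrite leNgt; apply/negP => hb.
  have h2 : a%:R * b%:R < z ^+ 330 * z ^+ 90.
    have [a0|a0] := eqVneq (a%:R : R) 0; first by rewrite a0 mul0r mulr_gt0.
    have ap : 0 < a%:R :> R by rewrite lt_def a0 ler0n.
    apply: le_lt_trans (_ : z ^+ 330 * b%:R < _); last by rewrite ltr_pM2l.
    by rewrite ler_wpM2r //; apply: le_trans ha _; exact: zmono.
  have := zmono 420%N 455%N isT; rewrite leNgt => /negP; apply.
  by apply: le_lt_trans h1 _; rewrite -[420%N]/(330 + 90)%N exprD.
(* c1, c2: the primes up to U and those in ]U, Y]; c4: the numbers free of
   primes above Y, which count negatively against the full sum. *)
pose g n : R[i] := cexp (X / (n%:R + kap)).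
pose S (c : nat -> nat -> R[i]) :=
  \sum_(1 <= a < K) \sum_(1 <= b < K | in_range D1 D2 a b) c a b * g (a * b)%N.
pose c1 (a b : nat) : R[i] := (prime a && (a <= U)%N)%:R.
pose c2 (a b : nat) : R[i] := (prime a && (U < a <= Y)%N)%:R.
pose c4 (a b : nat) : R[i] := [&& prefix_fact U a b, (max_pdiv a <= Y)%N & (max_pdiv b <= Y)%N]%:R.
have decomp : \sum_(D1.+1 <= n < D2.+1) (omega n)%:R * g n =
   S c1 + S c2 + \sum_(D1.+1 <= n < D2.+1) g n - S c4.
  rewrite /S !(@sum_pairs_divisors D1 D2 K _ g) // -!big_split /= -sumrB.
  apply: eq_big_nat => n /andP[n1 n2].
  have h := @omega_decomposition U Y K n U0 UY (leq_ltn_trans UD1 n1)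
     (leq_ltn_trans (n2 : (n <= D2)%N) D2K) (leq_ltn_trans (n2 : (n <= D2)%N) D2Y).
  move/(congr1 (fun m : nat => m%:R : R[i])): h; rewrite !natrD !natr_sum => h.
  have -> : (omega n)%:R = \sum_(1 <= p < K | (p %| n)%N) c1 p (n %/ p)%N
     + \sum_(1 <= p < K | (p %| n)%N) c2 p (n %/ p)%N + 1
     - \sum_(1 <= p < K | (p %| n)%N) c4 p (n %/ p)%N :> R[i].
    by rewrite /c1 /c2 /c4 -h addrK.
  by ring.
have b1 (b : bool) : normc (b%:R : R[i]) <= 1 by case: b; rewrite normc_nat ?ler01 ?lexx.
(* S c1 has no cancellation between different primes a: each progression sum
   saves z^24, and summing the lengths z^459 / a costs only a logarithm. *)
have harmU : harm U.+1 <= l * z.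
  apply: le_trans (harm_le _) _ => //; apply: hlog => //.
  rewrite -natr1; have := zmono 101%N 459%N isT; apply: le_trans; rewrite exprS.
  have : 100 * z ^+ 100 <= z * z ^+ 100 by rewrite ler_pM2r.
  by move: Uhi (zge1 100%N); set y := z ^+ 100; clear; lra.
have S1 : normc (S c1) * z ^+ 12 <= C * l ^+ 2 * (z ^+ 3 * z ^+ 459).
  rewrite /S.
  have h1 (a : nat) : (0 < a)%N -> normc (\sum_(1 <= b < K | in_range D1 D2 a b) c1 a b * g (a * b)%N)
      <= (a < U.+1)%:R * (C * L%:R * z ^+ 459 / a%:R / z ^+ 24).
    move=> a0; rewrite -big_distrr /= normcM ltnS.
    have [aU|aU] := leqP a U; last first.
      by rewrite andbF normc0 !mul0r.
    rewrite mul1r; have -> : \sum_(1 <= i < K | in_range D1 D2 a i) g (a * i)%N =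
        \sum_(1 <= i < 2 ^ L | in_range D1 D2 i a) cexp (X / ((i * a)%:R + kap)).
      by apply: eq_big => i; [rewrite in_rangeC|rewrite /g mulnC].
    have az : a%:R <= z ^+ 100 by apply: le_trans Uhi; rewrite ler_nat.
    have := progression_sum L hk Xlo Xhi hkap hD1 hD2 a0 az; rewrite -ler_pdivlMr // => h.
    apply: le_trans h; rewrite ler_piMl ?normc_ge0 //; exact: b1.
  have h2 : normc (\sum_(1 <= a < K) \sum_(1 <= b < K | in_range D1 D2 a b) c1 a b * g (a * b)%N)
     <= C * L%:R * z ^+ 459 / z ^+ 24 * harm U.+1.
    apply: le_trans (normc_sum _ _ _) _.
    apply: le_trans (_ : \sum_(1 <= a < K) (a < U.+1)%:R * (C * L%:R * z ^+ 459 / a%:R / z ^+ 24) <= _).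
      by apply: ler_sum_nat => a /andP[a0 _]; exact: h1.
    have UK : (U.+1 <= K)%N.
      by apply: leq_trans D2K; rewrite ltnS; apply: le_truncn; exact: zmono.
    rewrite (@big_cat_nat _ _ _ U.+1) //= [X in _ + X]big_nat [X in _ + X]big1 ?addr0; last first.
      by move=> a /andP[h _]; rewrite ltnNge h mul0r.
    rewrite big_distrr /= le_eqVlt; apply/orP; left; apply/eqP.
    apply: eq_big_nat => a /andP[_ aU]; rewrite aU mul1r; ring.
  have c0 : 0 <= C * z ^+ 459 / z ^+ 24.
    by apply: divr_ge0; [apply: mulr_ge0 => //; exact: ltW|exact: ltW].
  apply: le_trans (ler_wpM2r (ltW (zp 12%N)) h2) _.
  have h0 := @harm_ge0 R U.+1.
  apply: le_trans (_ : C * z ^+ 459 / z ^+ 24 * ((l * z) * (l * z)) * z ^+ 12 <= _).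
    apply: ler_wpM2r; first exact: ltW.
    have -> : C * L%:R * z ^+ 459 / z ^+ 24 * harm U.+1 = C * z ^+ 459 / z ^+ 24 * (L%:R * harm U.+1) by ring.
    by apply: ler_wpM2l => //; apply: ler_pM.
  have -> : C * z ^+ 459 / z ^+ 24 * ((l * z) * (l * z)) * z ^+ 12 =
     C * l ^+ 2 * z ^+ 459 * (z ^+ 2 * (z ^+ 12 / z ^+ 24)) by ring.
  have h3 : z ^+ 2 * (z ^+ 12 / z ^+ 24) <= z ^+ 3.
    rewrite -[leRHS]mulr1; apply: ler_pM => //; [exact: ltW|by apply: divr_ge0; exact: ltW|exact: zmono|].
    by rewrite ler_pdivrMr // mul1r zmono.
  have -> : C * l ^+ 2 * (z ^+ 3 * z ^+ 459) = C * l ^+ 2 * z ^+ 459 * z ^+ 3 by ring.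
  apply: ler_wpM2l => //.
  by apply: mulr_ge0; [exact: mulr_ge0|exact: ltW].
have S3 : normc (\sum_(D1.+1 <= n < D2.+1) g n) * z ^+ 12 <= C * l * (z ^+ 3 * z ^+ 459).
  have := progression_sum L hk Xlo Xhi hkap hD1 hD2 (isT : (0 < 1)%N) (zge1 100%N).
  have -> : \sum_(1 <= a < 2 ^ L | in_range D1 D2 a 1) cexp (X / ((a * 1)%:R + kap))
     = \sum_(D1.+1 <= n < D2.+1) g n.
    rewrite -/K (@sum_nat_subinterval _ 1 K D1.+1 D2.+1) //; last first.
      by move=> i _; rewrite /in_range muln1.
    by apply: eq_bigr => n _; rewrite muln1.
  rewrite divr1 => h.
  apply: le_trans (_ : normc (\sum_(D1.+1 <= n < D2.+1) g n) * z ^+ 24 <= _).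
    by rewrite ler_wpM2l ?normc_ge0 // zmono.
  apply: le_trans h _.
  have -> : C * l * (z ^+ 3 * z ^+ 459) = C * (l * z ^+ 3) * z ^+ 459 by ring.
  apply: ler_wpM2r; first exact: ltW.
  apply: ler_wpM2l => //.
  apply: le_trans hL _; apply: ler_wpM2l => //; rewrite -{1}[z]expr1; exact: zmono.
have bil (al be : nat -> R[i]) : (forall n, normc (al n) <= 1) -> (forall n, normc (be n) <= 1) ->
    (forall a b, al a != 0 -> be b != 0 -> in_range D1 D2 a b ->
     z ^+ 90 <= a%:R /\ z ^+ 90 <= b%:R) ->
    normc (S (fun a b => al a * be b)) * z ^+ 12 <= (2 + C) * l ^+ 2 * (z ^+ 2 * z ^+ 459).
  move=> h1 h2 h3; have := bilinear_sum L hk Xlo Xhi hkap hD1 hD2 h1 h2 h3.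
  move=> h; apply: le_trans h _; rewrite -/C.
  have -> : (2 + C) * l ^+ 2 * (z ^+ 2 * z ^+ 459) = (2 + C) * (l * z) ^+ 2 * z ^+ 459 by ring.
  apply: ler_wpM2r; first exact: ltW.
  apply: ler_wpM2l => //.
  by rewrite ler_sqr ?nnegrE.
have S2 : normc (S c2) * z ^+ 12 <= (2 + C) * l ^+ 2 * (z ^+ 3 * z ^+ 459).
  apply: le_trans (_ : (2 + C) * l ^+ 2 * (z ^+ 2 * z ^+ 459) <= _); last first.
    apply: ler_wpM2l; first exact: mulr_ge0.
    by apply: ler_wpM2r; [exact: ltW|exact: zmono].
  have -> : S c2 = S (fun a b => c2 a 0%N * 1).
    by apply: eq_bigr => a _; apply: eq_bigr => b _; rewrite mulr1.
  apply: (bil (fun a => c2 a 0%N) (fun=> 1)).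
  - by move=> n; exact: b1.
  - by move=> n; rewrite -cexp0 normc_cexp.
  - move=> a b; rewrite /c2; case h : (prime a && (U < a <= Y)%N); last by rewrite eqxx.
    case/and3P: h => _ Ua aY _ _ hr; split; first exact: Ulo.
    by apply: (cofactor a b 230%N) => //; apply: le_trans Yhi; rewrite ler_nat.
have S4 : normc (S c4) * z ^+ 12 <= (1 + 4 * l) * ((2 + C) * l ^+ 2) * (z ^+ 3 * z ^+ 459).
  (* The cofactor 1 satisfies the order condition, hence the value Y of v there. *)
  pose q := (4 * Y.+1)%N.
  pose v r := if r == 1%N then Y else pdiv r.
  pose al (k a : nat) : R[i] := [&& (U < a)%N, (a %/ max_pdiv a <= U)%N & (max_pdiv a <= Y)%N]%:R
     * cexp (- (k%:R * ((max_pdiv a)%:R / q%:R))).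
  pose be (k b : nat) : R[i] := ((0 < b)%N && (max_pdiv b <= Y)%N)%:R * cexp (k%:R * ((v b)%:R / q%:R)).
  have c4E a b : (0 < b)%N -> c4 a b = \sum_(0 <= k < q) le_coef Y k * (al k a * be k b).
    move=> bp; rewrite /c4 /prefix_fact.
    have [aY|aY] := leqP (max_pdiv a) Y; last first.
      rewrite andbF /= big1 // => k _.
      by rewrite /al [(max_pdiv a <= Y)%N]leqNgt aY !andbF !mul0r mulr0.
    have [bY|bY] := leqP (max_pdiv b) Y; last first.
      rewrite !andbF /= big1 // => k _.
      by rewrite /be [(max_pdiv b <= Y)%N]leqNgt bY !andbF !mul0r !mulr0.
    have vY : (v b <= Y)%N.
      rewrite /v; case: eqP => // b1'; apply: leq_trans bY.
      have b2 : (1 < b)%N by rewrite ltn_neqAle eq_sym bp andbT; apply/eqP.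
      by apply: prime_dvd_le_max_pdiv; rewrite ?pdiv_prime ?pdiv_dvd.
    have cr : ((b == 1%N) || (max_pdiv a <= pdiv b)%N) = (max_pdiv a <= v b)%N.
      by rewrite /v; case: eqP => //= _; rewrite aY.
    rewrite cr !andbT.
    case h : ((U < a)%N && (a %/ max_pdiv a <= U)%N); last first.
      rewrite andbA h /= big1 // => k _.
      by rewrite /al aY andbT h !mul0r mulr0.
    rewrite andbA h /= (@le_separation R Y _ _ aY vY); apply: eq_bigr => k _.
    by rewrite /al /be aY bY bp andbT h !mul1r.
  have -> : S c4 = \sum_(0 <= k < q) le_coef Y k * S (fun a b => al k a * be k b).
    rewrite /S; under [RHS]eq_bigr => k _ do rewrite big_distrr /=.
    rewrite [RHS]exchange_big /=; apply: eq_bigr => a _.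
    under [RHS]eq_bigr => k _ do rewrite big_distrr /=.
    rewrite [RHS]exchange_big /= [LHS]big_nat_cond [RHS]big_nat_cond.
    apply: eq_bigr => b /andP[/andP[bp _] _].
    rewrite c4E // big_distrl /=; apply: eq_bigr => k _; ring.
  have h1 k : normc (S (fun a b => al k a * be k b)) <= (2 + C) * l ^+ 2 * (z ^+ 2 * z ^+ 459) / z ^+ 12.
    rewrite ler_pdivlMr //; apply: bil.
    - by move=> n; rewrite /al normcM normc_cexp mulr1; exact: b1.
    - by move=> n; rewrite /be normcM normc_cexp mulr1; exact: b1.
    - move=> a b; rewrite /al.
      case h : [&& (U < a)%N, (a %/ max_pdiv a <= U)%N & (max_pdiv a <= Y)%N]; last by rewrite mul0r eqxx.
      case/and3P: h => Ua aU aY _ _ hr; split; first exact: Ulo.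
      apply: (cofactor a b 330%N) => //.
      have a0 : (0 < a)%N by apply: leq_ltn_trans Ua.
      rewrite -(divnK (max_pdiv_dvd a)) natrM -[330%N]/(100 + 230)%N exprD.
      apply: ler_pM => //; first by apply: le_trans Uhi; rewrite ler_nat.
      by apply: le_trans Yhi; rewrite ler_nat.
  have harmq : harm q <= l * z.
    apply: le_trans (harm_le _) _ => //; apply: hlog => //.
    rewrite natrM -natr1; have := zmono 231%N 459%N isT; apply: le_trans; rewrite exprS.
    have : 100 * z ^+ 230 <= z * z ^+ 230 by rewrite ler_pM2r.
    by move: Yhi (zge1 230%N); set y := z ^+ 230; clear; lra.
  have sumc : \sum_(0 <= k < q) normc (le_coef Y k : R[i]) <= (1 + 4 * l) * z.
    by apply: le_trans (sum_le_coef Y) _; rewrite mulrDl mul1r -/q; move: harmq z1; clear; lra.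
  set B := (2 + C) * l ^+ 2 * (z ^+ 2 * z ^+ 459) in h1.
  have B0 : 0 <= B.
    by apply: mulr_ge0; [exact: mulr_ge0|apply: mulr_ge0; exact: ltW].
  have B1 : 0 <= B / z ^+ 12 by apply: divr_ge0 => //; exact: ltW.
  have h2 : normc (\sum_(0 <= k < q) le_coef Y k * S (fun a b => al k a * be k b)) <=
     (1 + 4 * l) * z * (B / z ^+ 12).
    apply: le_trans (normc_sum _ _ _) _.
    apply: le_trans (_ : (\sum_(0 <= k < q) normc (le_coef Y k : R[i])) * (B / z ^+ 12) <= _).
      rewrite big_distrl /=; apply: ler_sum => k _; rewrite normcM.
      by apply: ler_wpM2l; [exact: normc_ge0|exact: h1].
    exact: ler_wpM2r.
  rewrite -ler_pdivlMr //; apply: le_trans h2 _.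
  rewrite le_eqVlt; apply/orP; left; apply/eqP; rewrite /B [z ^+ 3]exprS; ring.
rewrite -(ler_pM2r (zp 3%N)).
have -> : normc (\sum_(D1.+1 <= n < D2.+1) (omega n)%:R * g n) * z ^+ 9 * z ^+ 3 =
   normc (\sum_(D1.+1 <= n < D2.+1) (omega n)%:R * g n) * z ^+ 12 by rewrite -mulrA -exprD.
rewrite decomp.
have -> : omega_const l * z ^+ 459 * z ^+ 3 = C * l ^+ 2 * (z ^+ 3 * z ^+ 459) + C * l * (z ^+ 3 * z ^+ 459)
  + (2 + C) * l ^+ 2 * (z ^+ 3 * z ^+ 459) + (1 + 4 * l) * ((2 + C) * l ^+ 2) * (z ^+ 3 * z ^+ 459).
  by rewrite /omega_const -/C; ring.
apply: le_trans (_ : (normc (S c1) + normc (S c2) + normc (\sum_(D1.+1 <= n < D2.+1) g n)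
    + normc (S c4)) * z ^+ 12 <= _).
  apply: ler_wpM2r; first exact: ltW.
  apply: le_trans (normcB _ _) _; rewrite lerD2r.
  by apply: le_trans (normcD _ _) _; rewrite lerD2r; exact: normcD.
rewrite !mulrDl; move: S1 S2 S3 S4; clear.
set t1 := normc _ * _; set t2 := normc _ * _; set t3 := normc _ * _; set t4 := normc _ * _.
lra.
Qed.

End OmegaSum.

(** * Fractional parts and the Fejer kernel *)

Section Fractional.
Context {R : realType}.

Definition fracpart (t : R) : R := t - (Num.floor t)%:~R.

Lemma fracpart_itv t : 0 <= fracpart t < 1.
Proof.
have := floor_itv t; rewrite -[(_ + 1)%:~R]/((_ + 1)%:~R) intrD /fracpart => /andP[h1 h2].
by apply/andP; split; lra.
Qed.

Lemma fracpart_nat_div (k q : nat) : (k < q)%N -> fracpart (k%:R / q%:R) = k%:R / q%:R.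
Proof.
move=> kq; have q0 : 0 < q%:R :> R by rewrite ltr0n; apply: leq_ltn_trans kq.
rewrite /fracpart (@floor_def _ _ 0) ?subr0 //.
by rewrite divr_ge0 //= ?ltW // ltr_pdivrMr // mul1r ltr_nat.
Qed.

(** By this inequality an upper bound for the fractional part of t follows from a
    lower bound for that of -t, so a minorant suffices. *)
Lemma fracpart_add_opp t : fracpart t + fracpart (- t) <= 1.
Proof.
have h : - (Num.floor t) - 1 <= Num.floor (- t).
  rewrite real_floor_ge_int ?num_real // rmorphB rmorphN /=.
  by have /andP[_] := floor_itv t; rewrite intrD; lra.
have {}h : (- (Num.floor t) - 1)%:~R <= (Num.floor (- t))%:~R :> R by rewrite ler_int.
by rewrite rmorphB rmorphN /= in h; rewrite /fracpart; lra.
Qed.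

(** A Lipschitz minorant of the sawtooth: the jump at the integers is replaced by a
    slope -L. *)
Definition tooth (L : R) (t : R) : R := Num.min (fracpart t) (L * (1 - fracpart t)).

Lemma tooth_le L t : tooth L t <= fracpart t.
Proof. by rewrite /tooth ge_min lexx. Qed.

Lemma tooth_bounds L t : 0 <= L -> 0 <= tooth L t <= 1.
Proof.
move=> L0; have /andP[h1 h2] := fracpart_itv t.
rewrite le_min h1 mulr_ge0 ?subr_ge0 ?(ltW h2) //=.
by apply: le_trans (tooth_le _ _) _; exact: ltW.
Qed.

Lemma min_lip (L u v : R) : 1 <= L -> 0 <= v -> v <= u -> u <= 1 ->
  `|Num.min u (L * (1 - u)) - Num.min v (L * (1 - v))| <= L * (u - v) /\
  `|Num.min u (L * (1 - u)) - Num.min v (L * (1 - v))| <= L * (1 - (u - v)).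
Proof.
move=> L1 v0 vu u1.
have p1 : u - v <= L * (u - v) by rewrite ler_peMl // subr_ge0.
have p2 : v <= L * v by rewrite ler_peMl.
have p3 : 0 <= L * (1 - u) by rewrite mulr_ge0 ?subr_ge0 //; lra.
rewrite !ler_norml /Num.min; case: ifP => h1; case: ifP => h2.
all: move/negbT: h1 => h1 || idtac.
all: move/negbT: h2 => h2 || idtac.
all: rewrite -?leNgt in h1 h2.
all: rewrite !mulrBr !mulr1 in p1 p2 p3 h1 h2 *.
all: by split; apply/andP; split; lra.
Qed.

(** The tooth is a function on the circle, and the chord length |1 - e(t - s)|
    dominates the distance there. *)
Lemma tooth_lip (L t s : R) : 1 <= L ->
  `|tooth L t - tooth L s| <= L * normc (1 - cexp (t - s)).
Proof.
move=> L1.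
wlog st : t s / fracpart s <= fracpart t => [wl|].
  have [h|/ltW h] := leP (fracpart s) (fracpart t); first exact: wl.
  by rewrite distrC -normc_1BcexpN opprB; apply: wl.
have /andP[s0 s1] := fracpart_itv s; have /andP[t0 t1] := fracpart_itv t.
have [h1 h2] := min_lip L1 s0 st (ltW t1).
set w := fracpart t - fracpart s in h1 h2.
have w0 : 0 <= w by rewrite subr_ge0.
have w1 : w < 1 by rewrite /w; lra.
have piP := @pi_ge2 R.
have -> : cexp (t - s) = cexp w.
  have -> : t - s = w + (Num.floor t - Num.floor s)%:~R by rewrite /w /fracpart rmorphB /=; ring.
  by rewrite cexpD cexp_int mulr1.
have L0 : 0 <= L by lra.
have [hw|hw] := leP w (1 / 2).
  apply: le_trans h1 _; apply: ler_wpM2l => //.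
  have hh : `|w| <= 1 / 2 by rewrite ger0_norm.
  by have := normc_1Bcexp_ge hh; rewrite ger0_norm //; apply: le_trans; rewrite ler_peMl //; lra.
apply: le_trans h2 _; apply: ler_wpM2l => //.
have -> : cexp w = cexp (- (1 - w)) by rewrite opprB [in RHS]cexpB cexp1 conjc1 mulr1.
have w2 : 0 <= 1 - w by lra.
have hh : `|1 - w| <= 1 / 2 by rewrite ger0_norm //; lra.
rewrite normc_1BcexpN; have := normc_1Bcexp_ge hh; rewrite ger0_norm //; apply: le_trans.
by rewrite ler_peMl //; lra.
Qed.

Lemma sum_nat_R (n : nat) : \sum_(0 <= k < n) k%:R = n%:R * (n%:R - 1) / 2 :> R.
Proof.
elim: n => [|n ih]; first by rewrite big_geq // !mul0r.
by rewrite big_nat_recr //= ih -natr1; field.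
Qed.

(** The mean over the q-th parts of 1, which is the constant Fourier coefficient of
    the tooth modulo q. *)
Definition tooth_mean (L : R) (q : nat) : R := q%:R^-1 * \sum_(0 <= k < q) tooth L (k%:R / q%:R).

(** On [0, 1 - 1/L] the tooth is the identity, which has mean close to 1/2 there. *)
Lemma tooth_mean_ge (L N : nat) : (0 < L)%N -> (0 < N)%N ->
  1 / 2 - 1 / L%:R <= tooth_mean L%:R (L * N).
Proof.
move=> L0 N0; set q := (L * N)%N.
have Lp : 0 < L%:R :> R by rewrite ltr0n.
have Np : 0 < N%:R :> R by rewrite ltr0n.
have q0 : (0 < q)%N by rewrite muln_gt0 L0.
have qp : 0 < q%:R :> R by rewrite ltr0n.
have Nq : (N <= q)%N by rewrite leq_pmull.
rewrite /tooth_mean -ler_pdivrMl ?invr_gt0 // invrK.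
apply: le_trans (_ : \sum_(0 <= k < (q - N).+1) tooth L%:R (k%:R / q%:R) <= _); last first.
  rewrite [leRHS](@big_cat_nat _ _ _ (q - N).+1) //=; last first.
    by rewrite -subSn // leq_subLR -addn1 addnC leq_add.
  by rewrite lerDl sumr_ge0 // => k _; have /andP[] := @tooth_bounds L%:R (k%:R / q%:R) (ltW Lp).
have e (k : nat) : (k < (q - N).+1)%N -> tooth L%:R (k%:R / q%:R) = k%:R / q%:R.
  move=> hk; have kq : (k < q)%N.
    by apply: leq_trans hk _; rewrite -subSn // leq_subLR -addn1 addnC leq_add.
  rewrite /tooth fracpart_nat_div //; apply/min_idPl.
  apply: le_trans (_ : 1 <= _); first by rewrite ler_pdivrMr // mul1r ler_nat ltnW.
  have h : k%:R <= q%:R - N%:R :> R by rewrite -natrB // ler_nat.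
  have -> : L%:R * (1 - k%:R / q%:R) = (q%:R - k%:R) / N%:R :> R.
    by rewrite /q natrM; field; rewrite !gt_eqF.
  by rewrite ler_pdivlMr // mul1r; lra.
rewrite (@eq_big_nat _ _ _ _ _ _ (fun k => k%:R / q%:R : R)); last first.
  by move=> k /andP[_ hk]; exact: e.
rewrite -big_distrl /= sum_nat_R.
have -> : (q - N).+1%:R = q%:R - N%:R + 1 :> R by rewrite -natr1 natrB.
rewrite ler_pdivlMr //.
have -> : q%:R * (1 / 2 - 1 / L%:R) * q%:R = (q%:R ^+ 2 - 2 * (q%:R * N%:R)) / 2 :> R.
  by rewrite /q natrM; field; rewrite gt_eqF.
rewrite ler_pM2r ?invr_gt0 //.
have h : N%:R <= q%:R :> R by rewrite ler_nat.
have n2 : 0 <= N%:R ^+ 2 :> R by rewrite sqr_ge0.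
have -> : (q%:R - N%:R + 1) * (q%:R - N%:R + 1 - 1) = q%:R ^+ 2 - 2 * (q%:R * N%:R) + N%:R ^+ 2 + (q%:R - N%:R) :> R by ring.
by lra.
Qed.

End Fractional.

Section Fejer.
Context {R : realType}.

Lemma normc_weighted_cexpN (n1 n2 : nat) (w : nat -> nat) (f : nat -> R) :
  normc (\sum_(n1 <= d < n2) (w d)%:R * cexp (- f d)) =
  normc (\sum_(n1 <= d < n2) (w d)%:R * cexp (f d)).
Proof.
rewrite -[RHS]normc_conj rmorph_sum; congr normc; apply: eq_bigr => d _.
rewrite cexpN rmorphM; congr (_ * _).
by apply/esym; exact: (rmorph_nat (@conjc R)).
Qed.

(** The Fejer kernel of order H, as the square of a geometric sum of characters. *)
Definition fejer (H : nat) (t : R) : R := normc (\sum_(0 <= j < H) cexp (j%:R * t)) ^+ 2 / H%:R.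

Lemma fejer_ge0 H t : 0 <= fejer H t.
Proof. by rewrite divr_ge0 // sqr_ge0. Qed.

Lemma fejerE (H : nat) (t : R) :
  ((fejer H t)%:C)%C = \sum_(0 <= j1 < H) \sum_(0 <= j2 < H) cexp ((j1%:R - j2%:R) * t) / H%:R.
Proof.
rewrite /fejer rmorphM /= normc_sqr_sum_diag fmorphV rmorph_nat big_distrl /=.
apply: eq_bigr => j1 _; rewrite big_distrl /=; apply: eq_bigr => j2 _.
by rewrite -cexpB mulrBl.
Qed.

(** Sampling at the q-th parts is exact because the frequencies are below q / 2. *)
Lemma fejer_mean (H q : nat) (t : R) : (0 < H)%N -> (2 * H <= q)%N ->
  \sum_(0 <= k < q) fejer H (t - k%:R / q%:R) = q%:R.
Proof.
move=> H0 Hq; apply: complexI.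
have q0 : (0 < q)%N by apply: leq_trans Hq; rewrite muln_gt0.
have Hn : H%:R != 0 :> R[i] by rewrite pnatr_eq0 -lt0n.
rewrite rmorph_sum rmorph_nat /=.
under eq_bigr => k _ do rewrite fejerE.
rewrite exchange_big /=.
transitivity (\sum_(0 <= j1 < H) (q%:R / H%:R : R[i])); last first.
  by rewrite big_const_nat iter_addr_0 subn0 -[_ *+ H]mulr_natr divfK.
apply: eq_big_nat => j1 /andP[_ h1].
rewrite exchange_big /= (bigD1_seq j1) ?mem_index_iota ?iota_uniq //=.
have e (j2 : nat) : (j2 < H)%N -> \sum_(0 <= k < q) cexp ((j1%:R - j2%:R) * (t - k%:R / q%:R)) / H%:R =
    cexp ((j1%:R - j2%:R) * t) / H%:R * (if j2 == j1 then q%:R else 0).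
  move=> h2; rewrite -(@char_sum R q j2 j1 q0); last 2 first.
  - by move: h1 h2 Hq; clear; lia.
  - by move: h1 h2 Hq; clear; lia.
  rewrite big_distrr /=; apply: eq_bigr => k _; rewrite mulrAC -cexpD; congr (cexp _ / _).
  by rewrite mulrBr -[in RHS]opprB; ring.
rewrite e // eqxx subrr mul0r cexp0 mul1r big_nat_cond big1 ?addr0; last first.
  by move=> j2 /andP[/andP[_ h2] /negbTE hne]; rewrite e // hne mulr0.
by rewrite mulrC.
Qed.

(** (1 - e(t)) times the geometric sum is 1 - e(H t), which has norm at most 2. *)
Lemma fejer_concentration (H : nat) (t : R) : (0 < H)%N ->
  fejer H t * normc (1 - cexp t) ^+ 2 <= 4 / H%:R.
Proof.
move=> H0; have Hp : 0 < H%:R :> R by rewrite ltr0n.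
rewrite /fejer mulrAC -exprMn mulrC -normcM [_ * (1 - _)]mulrC geom_cexp mulrC.
rewrite ler_wpM2r ?invr_ge0 ?(ltW Hp) //.
have -> : 4 = 2 ^+ 2 :> R by ring.
rewrite ler_sqr ?nnegrE ?normc_ge0 //; apply: le_trans (normcB _ _) _.
by rewrite -cexp0 !normc_cexp; lra.
Qed.

(** Convolution with a Fejer kernel of order G^2 moves a function by at most its
    Lipschitz constant times the mean chord length under the kernel, which is O(1 / G)
    since the mean square is O(1 / G^2). *)
Lemma tooth_approx (L : R) (G q : nat) (t : R) : 1 <= L -> (0 < G)%N -> (2 * G ^ 2 <= q)%N ->
  `|tooth L t - q%:R^-1 * \sum_(0 <= k < q) tooth L (k%:R / q%:R) * fejer (G ^ 2) (t - k%:R / q%:R)|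
  <= L * (5 / 2) / G%:R.
Proof.
move=> L1 G0 Gq; set H := (G ^ 2)%N.
have H0 : (0 < H)%N by rewrite expn_gt0 G0.
have q0 : (0 < q)%N by apply: leq_trans Gq; rewrite muln_gt0.
have qp : 0 < q%:R :> R by rewrite ltr0n.
have Gp : 0 < G%:R :> R by rewrite ltr0n.
have L0 : 0 <= L by lra.
have -> : tooth L t = q%:R^-1 * \sum_(0 <= k < q) tooth L t * fejer H (t - k%:R / q%:R).
  by rewrite -big_distrr /= fejer_mean // mulrCA mulVf ?mulr1 // gt_eqF.
rewrite -mulrBr -sumrB normrM ger0_norm ?invr_ge0 ?(ltW qp) //.
rewrite ler_pdivrMl //; apply: le_trans (ler_norm_sum _ _ _) _.
apply: le_trans (_ : \sum_(0 <= k < q) L * (2 / G%:R + fejer H (t - k%:R / q%:R) / (2 * G%:R)) <= _).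
  apply: ler_sum_nat => k _; rewrite -mulrBl normrM (ger0_norm (fejer_ge0 _ _)).
  have h1 := tooth_lip t (k%:R / q%:R) L1.
  set u := t - k%:R / q%:R in h1 *; have f0 := fejer_ge0 H u.
  apply: le_trans (ler_wpM2r f0 h1) _; rewrite -mulrA; apply: ler_wpM2l => //.
  have h2 := fejer_concentration u H0; set e := normc _ in h2 *.
  have hG : H%:R = G%:R ^+ 2 :> R by rewrite /H natrX.
  (* The weight 1 / G balances the two terms, H being G ^ 2. *)
  have amgm : e <= G%:R / 2 * e ^+ 2 + 1 / (2 * G%:R).
    have : 0 <= (G%:R * e - 1) ^+ 2 / (2 * G%:R) by rewrite divr_ge0 ?sqr_ge0 // mulr_ge0 // ltW.
    have -> : (G%:R * e - 1) ^+ 2 / (2 * G%:R) = G%:R / 2 * e ^+ 2 - e + 1 / (2 * G%:R).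
      by field; rewrite gt_eqF.
    by lra.
  apply: le_trans (ler_wpM2r f0 amgm) _; rewrite mulrDl; apply: lerD.
    have -> : G%:R / 2 * e ^+ 2 * fejer H u = G%:R / 2 * (fejer H u * e ^+ 2) by ring.
    have g2 : 0 <= G%:R / 2 :> R by rewrite divr_ge0 // ltW.
    apply: le_trans (ler_wpM2l g2 h2) _; rewrite hG le_eqVlt; apply/orP; left; apply/eqP.
    by field; rewrite gt_eqF.
  by rewrite mul1r mulrC.
rewrite -big_distrr /= big_split /= -[X in _ * (_ + X)]big_distrl /= fejer_mean //.
rewrite big_const_nat iter_addr_0 subn0 -[_ *+ q]mulr_natl le_eqVlt; apply/orP; left; apply/eqP.
by field; rewrite gt_eqF.
Qed.

(** Summation by parts over a period: the increments of the tooth between q-th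
    parts add up to O(L), so the coefficient at frequency j is O(L / j). *)
Lemma tooth_fourier (L : R) (q j : nat) (th : R) : 1 <= L -> (0 < j)%N -> (2 * j <= q)%N ->
  th = j%:R / q%:R \/ th = - (j%:R / q%:R) ->
  normc (\sum_(0 <= k < q) ((tooth L (k%:R / q%:R))%:C)%C * cexp (k%:R * th)) <= 16 * L * q%:R / j%:R.
Proof.
move=> L1 j0 jq hth.
have q0 : (0 < q)%N by apply: leq_trans jq; rewrite muln_gt0.
have qp : 0 < q%:R :> R by rewrite ltr0n.
have jp : 0 < j%:R :> R by rewrite ltr0n.
have L0 : 0 <= L by lra.
pose f (k : nat) : R[i] := ((tooth L (k%:R / q%:R))%:C)%C.
pose fm (k : nat) : R[i] := ((tooth L ((k%:R - 1) / q%:R))%:C)%C.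
have fmS k : fm k.+1 = f k by rewrite /fm /f -natr1 addrK.
have wq : cexp (q%:R * th) = 1.
  have h : cexp (q%:R * (j%:R / q%:R) : R) = 1.
    by rewrite mulrCA divff ?gt_eqF // mulr1 cexp_nat.
  by case: hth => -> //; rewrite mulrN cexpN h conjc1.
have parts n : (1 - cexp th) * \sum_(0 <= k < n) f k * cexp (k%:R * th) =
    \sum_(0 <= k < n) (f k - fm k) * cexp (k%:R * th) + fm 0%N - fm n * cexp (n%:R * th).
  elim: n => [|n ih]; first by rewrite !big_geq // mulr0 add0r mul0r cexp0 mulr1 subrr.
  have e : n.+1%:R * th = n%:R * th + th by rewrite -natr1 mulrDl mul1r.
  by rewrite !big_nat_recr //= mulrDr ih fmS e cexpD; ring.
have fm0 : fm 0%N = fm q.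
  congr (_%:C)%C; apply/eqP; rewrite -subr_eq0 -normr_le0.
  apply: le_trans (tooth_lip _ _ L1) _.
  have -> : (0%:R - 1) / q%:R - (q%:R - 1) / q%:R = - 1 :> R by field; rewrite gt_eqF.
  by rewrite cexpN cexp1 conjc1 subrr normc0 mulr0.
have main := parts q; rewrite wq mulr1 fm0 addrK in main.
set S := \sum_(0 <= k < q) _ in main *.
have b1 : normc (1 - cexp th) * normc S <= 8 * L.
  rewrite -normcM main; apply: le_trans (normc_sum _ _ _) _.
  apply: le_trans (_ : (q - 0)%:R * (8 * L / q%:R) <= _); last first.
    by rewrite subn0 mulrC divfK // gt_eqF.
  apply: sum_le_const => k _; rewrite normcM normc_cexp mulr1 /f /fm -rmorphB normc_real.
  apply: le_trans (tooth_lip _ _ L1) _.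
  have -> : k%:R / q%:R - (k%:R - 1) / q%:R = q%:R^-1 :> R by field; rewrite gt_eqF.
  rewrite [8 * L]mulrC -mulrA; apply: ler_wpM2l => //.
  rewrite -cexp0; apply: le_trans (cexp_lip _ _) _.
  rewrite sub0r normrN ger0_norm ?invr_ge0 ?(ltW qp) //.
  rewrite ler_wpM2r ?invr_ge0 ?(ltW qp) //.
  by have := @pihalf_lt2 R; lra.
have b2 : 1 <= normc (1 - cexp th) * (q%:R * (2 / j%:R)).
  have -> : normc (1 - cexp th) = normc (1 - cexp (j%:R / q%:R : R)).
    by case: hth => ->; rewrite ?normc_1BcexpN.
  have hj : (0 < j < q)%N by move: j0 jq; clear; lia.
  apply: le_trans (normc_1Bcexp_frac hj) _.
  apply: ler_wpM2l; first exact: normc_ge0.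
  apply: ler_wpM2l; first exact: ltW.
  have : (q - j)%:R^-1 <= j%:R^-1 :> R.
    rewrite lef_pV2 ?posrE // ?ltr0n ?subn_gt0; last by case/andP: hj.
    by rewrite ler_nat; move: jq; clear; lia.
  by lra.
have S0 := normc_ge0 S.
apply: le_trans (_ : (normc (1 - cexp th) * (q%:R * (2 / j%:R))) * normc S <= _).
  by rewrite -[leLHS]mul1r ler_wpM2r.
have -> : normc (1 - cexp th) * (q%:R * (2 / j%:R)) * normc S =
  (q%:R * (2 / j%:R)) * (normc (1 - cexp th) * normc S) by ring.
have c0 : 0 <= q%:R * (2 / j%:R) :> R by rewrite mulr_ge0 ?divr_ge0 // ltW.
apply: le_trans (ler_wpM2l c0 b1) _.
by rewrite le_eqVlt; apply/orP; left; apply/eqP; field; rewrite gt_eqF.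
Qed.

(** The convolution is a trigonometric polynomial; its constant term gives the
    mean, and at frequency j its coefficient O(L / j) meets an exponential sum of size
    at most B. *)
Lemma tooth_weighted_sum (L B : R) (G q n1 n2 : nat) (w : nat -> nat) (t : nat -> R) :
  1 <= L -> (0 < G)%N -> (2 * G ^ 2 <= q)%N ->
  (forall j, (0 < j < G ^ 2)%N ->
     normc (\sum_(n1 <= d < n2) (w d)%:R * cexp (j%:R * t d)) <= B) ->
  `|\sum_(n1 <= d < n2) (w d)%:R * tooth L (t d)
     - tooth_mean L q * \sum_(n1 <= d < n2) (w d)%:R|
  <= L * (5 / 2) / G%:R * \sum_(n1 <= d < n2) (w d)%:R + 32 * L * B * harm (G ^ 2).
Proof.
move=> L1 G0 Gq hB; set H := (G ^ 2)%N in Gq hB *.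
have H0 : (0 < H)%N by rewrite expn_gt0 G0.
have q0 : (0 < q)%N by apply: leq_trans Gq; rewrite muln_gt0.
have qp : 0 < q%:R :> R by rewrite ltr0n.
have Hp : 0 < H%:R :> R by rewrite ltr0n.
have L0 : 0 <= L by lra.
set W := \sum_(n1 <= d < n2) (w d)%:R : R.
pose M := \sum_(n1 <= d < n2) (w d)%:R *
  (q%:R^-1 * \sum_(0 <= k < q) tooth L (k%:R / q%:R) * fejer H (t d - k%:R / q%:R)).
have step1 : `|\sum_(n1 <= d < n2) (w d)%:R * tooth L (t d) - M| <= L * (5 / 2) / G%:R * W.
  rewrite /M -sumrB /W big_distrr /=; apply: le_trans (ler_norm_sum _ _ _) _.
  apply: ler_sum_nat => d _; rewrite -mulrBr normrM ger0_norm // mulrC ler_wpM2r //.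
  exact: tooth_approx.
pose gh (j1 j2 : nat) : R[i] := q%:R^-1 * \sum_(0 <= k < q)
   ((tooth L (k%:R / q%:R))%:C)%C * cexp (k%:R * (- ((j1%:R - j2%:R) / q%:R))).
pose E (j1 j2 : nat) : R[i] := \sum_(n1 <= d < n2) (w d)%:R * cexp ((j1%:R - j2%:R) * t d).
have ME : (M%:C)%C = H%:R^-1 * \sum_(0 <= j1 < H) \sum_(0 <= j2 < H) gh j1 j2 * E j1 j2.
  rewrite /M rmorph_sum /=.
  transitivity (\sum_(n1 <= d < n2) \sum_(0 <= j1 < H) \sum_(0 <= j2 < H)
     H%:R^-1 * gh j1 j2 * ((w d)%:R * cexp ((j1%:R - j2%:R) * t d))).
    apply: eq_bigr => d _; rewrite rmorphM rmorph_nat rmorphM fmorphV rmorph_nat rmorph_sum /=.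
    under eq_bigr => k _ do rewrite rmorphM /= fejerE.
    under eq_bigr => k _.
      rewrite big_distrr /=; under eq_bigr => j1 _ do rewrite big_distrr /=.
      over.
    rewrite exchange_big /= big_distrr /= big_distrr /=; apply: eq_bigr => j1 _.
    rewrite exchange_big /= big_distrr /= big_distrr /=; apply: eq_bigr => j2 _.
    rewrite /gh big_distrr /= big_distrr /= big_distrr /= big_distrr /= big_distrl /=.
    apply: eq_bigr => k _.
    have -> : cexp ((j1%:R - j2%:R) * (t d - k%:R / q%:R)) =
        cexp ((j1%:R - j2%:R) * t d) * cexp (k%:R * (- ((j1%:R - j2%:R) / q%:R))).
      by rewrite -cexpD; congr cexp; ring.
    by ring.
  rewrite exchange_big /= big_distrr /=; apply: eq_bigr => j1 _.
  rewrite exchange_big /= big_distrr /=; apply: eq_bigr => j2 _.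
  by rewrite -big_distrr /= -mulrA.
have diag j : gh j j * E j j = ((tooth_mean L q * W)%:C)%C.
  rewrite /gh /E /tooth_mean /W rmorphM rmorphM fmorphV !rmorph_sum rmorph_nat /=; congr (_ * _ * _).
    by apply: eq_bigr => k _; rewrite subrr mul0r oppr0 mulr0 cexp0 mulr1.
  by apply: eq_bigr => d _; rewrite subrr mul0r cexp0 mulr1 rmorph_nat.
have B0 : (1 < H)%N -> 0 <= B.
  by move=> h; apply: le_trans (normc_ge0 _) (hB 1%N _).
have off j1 j2 : (j1 < H)%N -> (j2 < H)%N -> j1 != j2 ->
    normc (gh j1 j2 * E j1 j2) <= 16 * L * B * (((j1 - j2) + (j2 - j1))%N)%:R^-1.
  move=> h1 h2 hne; set j := ((j1 - j2) + (j2 - j1))%N.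
  have j0 : (0 < j)%N by move: hne; rewrite /j; clear; lia.
  have jH : (j < H)%N by move: h1 h2; rewrite /j; clear; lia.
  have jp : 0 < j%:R :> R by rewrite ltr0n.
  have sgn : (j1%:R - j2%:R = j%:R :> R) \/ (j1%:R - j2%:R = - j%:R :> R).
    have [h|h] := leqP j2 j1; [left|right].
      by rewrite -natrB //; congr (_%:R); rewrite /j; move: h; clear; lia.
    by rewrite -opprB -natrB ?(ltnW h) //; congr (- _%:R); rewrite /j; move: h; clear; lia.
  have hE : normc (E j1 j2) <= B.
    case: sgn => e; first by rewrite /E e; apply: hB; rewrite j0.
    have -> : normc (E j1 j2) = normc (\sum_(n1 <= d < n2) (w d)%:R * cexp (- (j%:R * t d))).
      by rewrite /E e; congr normc; apply: eq_bigr => d _; rewrite mulNr.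
    by rewrite normc_weighted_cexpN; apply: hB; rewrite j0.
  have hg : normc (gh j1 j2) <= 16 * L / j%:R.
    rewrite /gh normcM normcV normc_nat ler_pdivrMl //.
    have -> : q%:R * (16 * L / j%:R) = 16 * L * q%:R / j%:R :> R by ring.
    apply: tooth_fourier => //; first by move: jH Gq; clear; lia.
    by case: sgn => ->; [right|left; rewrite mulNr opprK].
  have -> : 16 * L * B * j%:R^-1 = 16 * L / j%:R * B by ring.
  by rewrite normcM; apply: ler_pM; rewrite ?normc_ge0.
have step2 : `|M - tooth_mean L q * W| <= 32 * L * B * harm H.
  rewrite -normc_real.
  have -> : ((M - tooth_mean L q * W)%:C)%C = (M%:C)%C - ((tooth_mean L q * W)%:C)%C by exact: rmorphB.
  rewrite ME.
  have -> : ((tooth_mean L q * W)%:C)%C = H%:R^-1 * \sum_(0 <= j1 < H) ((tooth_mean L q * W)%:C)%C.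
    rewrite big_const_nat iter_addr_0 subn0 -[X in _ = _ * X]mulr_natl mulrA mulVf ?mul1r //.
    by rewrite pnatr_eq0 -lt0n.
  rewrite -mulrBr -sumrB normcM normcV normc_nat ler_pdivrMl //.
  apply: le_trans (normc_sum _ _ _) _; rewrite -[H in H%:R]subn0.
  apply: sum_le_const => j1 /andP[_ h1].
  rewrite (bigD1_seq j1) ?mem_index_iota ?iota_uniq //= diag addrAC subrr add0r.
  pose T (m : nat) : R := if m == 0%N then 0 else 16 * L * `|B| / m%:R.
  have T0 m : 0 <= T m.
    by rewrite /T; case: ifP => // _; rewrite divr_ge0 // mulr_ge0 // mulr_ge0.
  apply: le_trans (normc_sum _ _ _) _.
  apply: le_trans (_ : \sum_(0 <= j2 < H) T ((j1 - j2) + (j2 - j1))%N <= _).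
    rewrite big_mkcond /=; apply: ler_sum_nat => j2 /andP[_ h2]; case: ifP => // hne.
    have hne' : j1 != j2 by rewrite eq_sym.
    apply: le_trans (off _ _ h1 h2 hne') _; rewrite /T ifF; last first.
      by move: hne'; clear; lia.
    rewrite ler_wpM2r ?invr_ge0 // ler_wpM2l ?mulr_ge0 //; exact: ler_norm.
  apply: le_trans (sum_dist_le T0 h1) _; rewrite {1}/T eqxx add0r.
  have [H1|H1] := leqP H 1%N.
    have -> : H = 1%N by apply/eqP; rewrite eqn_leq H1 H0.
    by rewrite /harm !big_geq // !mulr0.
  rewrite (@eq_big_nat _ _ _ _ _ _ (fun m => 16 * L * B * m%:R^-1)); last first.
    by move=> m /andP[m1 _]; rewrite /T gtn_eqF // ger0_norm ?B0.
  rewrite -big_distrr /= -/(harm H) le_eqVlt; apply/orP; left; apply/eqP; ring.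
have -> : \sum_(n1 <= d < n2) (w d)%:R * tooth L (t d) - tooth_mean L q * W =
  (\sum_(n1 <= d < n2) (w d)%:R * tooth L (t d) - M) + (M - tooth_mean L q * W) by ring.
by apply: le_trans (ler_normD _ _) _; apply: lerD.
Qed.

(** Equidistribution in mean of the fractional parts, from bounds on exponential
    sums with the same weights. *)
Lemma fracpart_weighted_sum (B : R) (L G n1 n2 : nat) (w : nat -> nat) (t : nat -> R) :
  (0 < L)%N -> (0 < G)%N ->
  (forall j, (0 < j < G ^ 2)%N ->
     normc (\sum_(n1 <= d < n2) (w d)%:R * cexp (j%:R * t d)) <= B) ->
  `|\sum_(n1 <= d < n2) (w d)%:R * (fracpart (t d) - 1 / 2)|
  <= (1 / L%:R + L%:R * (5 / 2) / G%:R) * \sum_(n1 <= d < n2) (w d)%:R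
     + 32 * L%:R * B * harm (G ^ 2).
Proof.
move=> L0 G0 hB; set W := \sum_(n1 <= d < n2) (w d)%:R : R.
have W0 : 0 <= W by apply: sumr_ge0.
have L1 : 1 <= L%:R :> R by rewrite ler1n.
pose q := (L * (2 * G ^ 2))%N.
have Gq : (2 * G ^ 2 <= q)%N by rewrite leq_pmull.
have N0 : (0 < 2 * G ^ 2)%N by rewrite muln_gt0 expn_gt0 G0.
have c0 := tooth_mean_ge L0 N0; rewrite -/q in c0.
pose c : R := tooth_mean L%:R q; rewrite -/c in c0.
have hB' j : (0 < j < G ^ 2)%N ->
     normc (\sum_(n1 <= d < n2) (w d)%:R * cexp (j%:R * (- t d))) <= B.
  move=> hj; under eq_bigr => d _ do rewrite mulrN.
  by rewrite normc_weighted_cexpN; exact: hB.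
have h1 := tooth_weighted_sum L1 G0 Gq hB.
have h2 := tooth_weighted_sum L1 G0 Gq hB'.
rewrite -/W -/c in h1 h2.
set ER := L%:R * (5 / 2) / G%:R * W in h1 h2 *.
have cW : (1 / 2 - 1 / L%:R) * W <= c * W by apply: ler_wpM2r => //; exact: c0.
have lo : \sum_(n1 <= d < n2) (w d)%:R * tooth L%:R (t d) <= \sum_(n1 <= d < n2) (w d)%:R * fracpart (t d).
  by apply: ler_sum => d _; rewrite ler_wpM2l // tooth_le.
have hi : \sum_(n1 <= d < n2) (w d)%:R * fracpart (t d) <= W - \sum_(n1 <= d < n2) (w d)%:R * tooth L%:R (- t d).
  rewrite /W -sumrB; apply: ler_sum => d _; rewrite -[X in X - _]mulr1 -mulrBr ler_wpM2l //.
  by have := fracpart_add_opp (t d); have := tooth_le L%:R (- t d); lra.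
have -> : \sum_(n1 <= d < n2) (w d)%:R * (fracpart (t d) - 1 / 2) =
   \sum_(n1 <= d < n2) (w d)%:R * fracpart (t d) - W / 2.
  rewrite /W big_distrl /= -sumrB; apply: eq_bigr => d _; ring.
rewrite [(1 / L%:R + _) * W]mulrDl -/ER.
move: h1 h2 cW lo hi; rewrite !ler_norml mulrBl.
set a1 := \sum_(_ <= _ < _) _; set a2 := \sum_(_ <= _ < _) _; set a3 := \sum_(_ <= _ < _) _.
set e := 32 * _ * _ * _; set cw := c * W; set lw := 1 / L%:R * W; clear.
move=> /andP[x1 x2] /andP[x3 x4] x5 x6 x7; apply/andP; split; lra.
Qed.

End Fejer.

(** * Grouping by quotient, and the series *)

Section Quotients.
Context {R : realType}.

Lemma prod_primes_dvd (n : nat) (s : seq nat) :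
  uniq s -> all prime s -> all (fun p => p %| n)%N s -> (\prod_(p <- s) p %| n)%N.
Proof.
elim: s => [|p s ih] /=; first by rewrite big_nil dvd1n.
move=> /andP[ps us] /andP[pp pps] /andP[pn pns].
rewrite big_cons Gauss_dvd ?pn ?ih //.
have {ih us pns} : all (fun q => q != p) s.
  by apply/allP => q qs; apply: contraNneq ps => <-.
elim: s pps {ps} => [|q s ih] /=; first by rewrite big_nil coprimen1.
move=> /andP[pq pps] /andP[qp qs]; rewrite big_cons coprimeMr ih // andbT.
by rewrite prime_coprime // dvdn_prime2 // eq_sym.
Qed.

(** n is at least the product of its prime factors, each of which is at least 2. *)
Lemma expn_omega_le (n : nat) : (0 < n)%N -> (2 ^ omega n <= n)%N.
Proof.
move=> n0; have /dvdn_leq -/(_ n0) : (\prod_(p <- primes n) p %| n)%N.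
  apply: prod_primes_dvd; first exact: primes_uniq.
    by apply/allP => p; rewrite mem_primes => /and3P[].
  by apply/allP => p; rewrite mem_primes => /and3P[].
apply: leq_trans; rewrite /omega.
have : all prime (primes n) by apply/allP => p; rewrite mem_primes => /and3P[].
elim: (primes n) => [|p s ih] /=; first by rewrite big_nil.
by move=> /andP[pp ps]; rewrite big_cons expnS leq_mul ?ih ?prime_gt1.
Qed.

Lemma ln2_ge_half : 1 / 2 <= ln 2 :> R.
Proof.
have h : -1 < - (1 / 2) :> R by lra.
have := le_ln1Dx h; have -> : 1 + - (1 / 2) = 2^-1 :> R by field.
by rewrite lnV ?posrE //; lra.
Qed.

Lemma omega_le_ln (n : nat) : (0 < n)%N -> (omega n)%:R <= 2 * ln n%:R :> R.
Proof.
move=> n0; have h : ln ((2 ^ omega n)%:R) <= ln n%:R :> R.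
  by rewrite ler_ln ?posrE ?ltr0n ?expn_gt0 // ler_nat expn_omega_le.
rewrite natrX lnXn // -[_ *+ omega n]mulr_natr in h.
have h2 : 1 / 2 * (omega n)%:R <= ln 2 * (omega n)%:R :> R.
  by apply: ler_wpM2r => //; exact: ln2_ge_half.
by move: (le_trans h2 h); lra.
Qed.

(** Induction on M: the n in ]x / (m+1), x / m] are those with quotient m. Stopping
    exactly at the quotient M leaves no boundary term. *)
Lemma sum_by_quotient (x : R) (f : nat -> R) (M : nat) : 0 <= x ->
  \sum_(1 <= n < (Num.truncn x).+1) f (Num.truncn (x / n%:R)) =
  \sum_(1 <= n < (Num.truncn (x / M.+1%:R)).+1) f (Num.truncn (x / n%:R)) +
  \sum_(1 <= m < M.+1) f m * ((Num.truncn (x / m%:R))%:R - (Num.truncn (x / m.+1%:R))%:R).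
Proof.
move=> x0; elim: M => [|M ih]; first by rewrite divr1 [X in _ = _ + X]big_geq ?addr0.
rewrite ih [X in _ = _ + X]big_nat_recr //=.
set v1 := Num.truncn (x / M.+1%:R); set v2 := Num.truncn (x / M.+2%:R).
have v21 : (v2 <= v1)%N.
  by apply: le_truncn; rewrite ler_wpM2l // lef_pV2 ?posrE // ler_nat.
rewrite (@big_cat_nat _ _ _ v2.+1 1 v1.+1) //=.
have -> : \sum_(v2.+1 <= n < v1.+1) f (Num.truncn (x / n%:R)) = f M.+1 * (v1%:R - v2%:R).
  transitivity (\sum_(v2.+1 <= n < v1.+1) f M.+1).
    apply: eq_big_nat => n /andP[h1 h2]; congr f.
    have n0 : 0 < n%:R :> R by rewrite ltr0n; apply: leq_ltn_trans h1.
    have h3 : n%:R <= x / M.+1%:R.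
      by apply: le_trans (_ : v1%:R <= _); rewrite ?ler_nat // truncn_le divr_ge0.
    have h4 : x / M.+2%:R < n%:R.
      by apply: lt_le_trans (truncnS_gt _) _; rewrite ler_nat.
    apply: truncn_def; rewrite ler_pdivlMr // ltr_pdivrMr //.
    by rewrite ler_pdivlMr // mulrC in h3; rewrite ltr_pdivrMr // mulrC in h4; rewrite h3 h4.
  by rewrite big_const_nat iter_addr_0 subSS -[_ *+ (v1 - v2)]mulr_natr natrB.
by rewrite -addrA [X in _ + X = _]addrC.
Qed.

Definition series_term (n : nat) : R := (omega n)%:R / (n%:R * (n%:R + 1)).
(** A discrete primitive for the tail of the series: its decrements dominate 2 ln n
    / (n (n + 1)), and omega n <= 2 ln n. *)
Definition tail_bound (n : nat) : R := 2 * (ln n%:R + 1) / n%:R.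

Lemma series_term_ge0 n : 0 <= series_term n.
Proof. by rewrite divr_ge0 // mulr_ge0 // addr_ge0. Qed.

Lemma tail_bound_ge0 n : 0 <= tail_bound n.
Proof.
case: n => [|n]; first by rewrite /tail_bound invr0 mulr0.
by rewrite divr_ge0 // mulr_ge0 // addr_ge0 // ln_ge0 // ler1n.
Qed.

Lemma series_term_le n : (0 < n)%N -> series_term n <= tail_bound n - tail_bound n.+1.
Proof.
move=> n0; have np : 0 < n%:R :> R by rewrite ltr0n.
have np1 : 0 < n%:R + 1 :> R by rewrite addr_gt0.
have ho := omega_le_ln n0.
have hl : ln n.+1%:R <= ln n%:R + n%:R^-1 :> R.
  have -> : n.+1%:R = n%:R * (1 + n%:R^-1) :> R by rewrite -natr1; field; rewrite gt_eqF.
  have ni : 0 < n%:R^-1 :> R by rewrite invr_gt0.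
  have h : -1 < n%:R^-1 :> R by lra.
  have h1 : 0 < 1 + n%:R^-1 :> R by lra.
  by rewrite lnM ?posrE // lerD2l; exact: le_ln1Dx.
rewrite /tail_bound /series_term -(natr1 n) in hl *.
set a := ln n%:R in ho hl *; set b := ln (n%:R + 1) in hl *.
apply: le_trans (_ : 2 * (a + 1) / n%:R - 2 * (a + n%:R^-1 + 1) / (n%:R + 1) <= _); last first.
  by rewrite lerD2l lerN2 ler_pM2r ?invr_gt0 // ler_pM2l // lerD2r.
have -> : 2 * (a + 1) / n%:R - 2 * (a + n%:R^-1 + 1) / (n%:R + 1) = 2 * a / (n%:R * (n%:R + 1)).
  by field; rewrite !gt_eqF.
by rewrite ler_wpM2r // invr_ge0 mulr_ge0 // ltW.
Qed.

Definition partial_sum (N : nat) : R := \sum_(1 <= n < N) series_term n.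

Lemma partial_sum_tail (M N : nat) : (0 < M)%N -> (M <= N)%N ->
  partial_sum M <= partial_sum N <= partial_sum M + tail_bound M.
Proof.
move=> M0 MN; rewrite /partial_sum (@big_cat_nat _ _ _ M 1 N) //=.
rewrite lerDl sumr_ge0 => [|n _]; last exact: series_term_ge0.
rewrite lerD2l /=.
apply: le_trans (_ : \sum_(M <= n < N) (tail_bound n - tail_bound n.+1) <= _).
  by apply: ler_sum_nat => n /andP[h _]; apply: series_term_le; apply: leq_trans h.
have -> : \sum_(M <= n < N) (tail_bound n - tail_bound n.+1) = tail_bound M - tail_bound N.
  rewrite -opprB -telescope_sumr // -sumrN; apply: eq_bigr => n _; by rewrite opprB.
by rewrite gerBl tail_bound_ge0.
Qed.

Lemma partial_sum_ndecr : nondecreasing_seq partial_sum.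
Proof.
move=> m n mn; case: m mn => [|m] mn; last by have /andP[] := @partial_sum_tail m.+1 n isT mn.
by rewrite {1}/partial_sum big_geq // sumr_ge0 // => i _; exact: series_term_ge0.
Qed.

Lemma partial_sum_cvg : cvgn partial_sum.
Proof.
apply: nondecreasing_is_cvgn; first exact: partial_sum_ndecr.
exists (partial_sum 1 + tail_bound 1) => _ [n _ <-].
case: n => [|n]; last by have /andP[] := @partial_sum_tail 1 n.+1 isT isT.
apply: le_trans (_ : partial_sum 1 <= _); first exact: partial_sum_ndecr.
by rewrite lerDl tail_bound_ge0.
Qed.

Lemma limn_partial_sum (M : nat) : (0 < M)%N ->
  partial_sum M <= limn partial_sum <= partial_sum M + tail_bound M.
Proof.
move=> M0; apply/andP; split.
  exact: nondecreasing_cvgn_le partial_sum_ndecr partial_sum_cvg M.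
apply: limr_le; first exact: partial_sum_cvg.
exists M => // n /= Mn.
by have /andP[] := @partial_sum_tail M n M0 Mn.
Qed.

End Quotients.

(** * Assembly *)

Section Assembly.
Context {R : realType}.

Definition log_bounded (l z : R) :=
  forall n : nat, (0 < n)%N -> n%:R <= z ^+ 459 -> 1 + ln n%:R <= l * z.

(** Logarithms of powers of z are bounded by multiples of z, so that they can be
    charged to the power savings. *)
Lemma log_parameters : exists2 l : R, 0 <= l & forall z : R, 100 <= z ->
  log_bounded l z /\ exists2 L : nat, (Num.truncn (z ^+ 459) < 2 ^ L)%N & L%:R <= l * z.
Proof.
(* Twice the constant 460 of the logarithm, as ln 2 >= 1/2, with some room. *)
exists (930%:R) => [|z z100]; first exact: ler0n.
have z1 : 1 <= z by move: z100; clear; lra.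
have z0 : 0 <= z by move: z100; clear; lra.
have h n : (0 < n)%N -> n%:R <= z ^+ 459 -> 1 + ln n%:R <= 460%:R * z.
  by move=> n0 hn; exact: ln_le_pow.
split.
  move=> n n0 hn; apply: le_trans (h n n0 hn) _.
  by apply: ler_wpM2r => //; rewrite ler_nat.
set D := Num.truncn _; have D0 : (0 < D)%N by rewrite truncn_gt0 exprn_ege1.
exists (trunc_log 2 D).+1; first exact: trunc_log_ltn.
set k := trunc_log 2 D.
have hD : D%:R <= z ^+ 459 by rewrite truncn_le exprn_ge0.
have h1 := h D D0 hD.
have h2 : ln ((2 ^ k)%:R) <= ln D%:R :> R.
  by rewrite ler_ln ?posrE ?ltr0n ?expn_gt0 // ler_nat trunc_logP.
rewrite natrX lnXn // -[_ *+ k]mulr_natr in h2.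
have h3 : 1 / 2 * k%:R <= ln 2 * k%:R :> R.
  by apply: ler_wpM2r => //; exact: ln2_ge_half.
have h4 := le_trans h3 h2.
have e : 930%:R * z = 2 * (460%:R * z) + 10%:R * z :> R by rewrite mulrA -natrM -mulrDl -natrD.
rewrite e -natr1; move: h1 h4 z1.
by set a := 460%:R * z; set b := k%:R; set c := ln _; clear; lra.
Qed.

Lemma omega_const_ge0 (l : R) : 0 <= l -> 0 <= omega_const l.
Proof.
move=> l0; have l20 : 0 <= l ^+ 2 by exact: sqr_ge0.
rewrite /omega_const; move: (test_const_ge1 l20); move: (test_const _) => C C1.
have C0 : 0 <= C by apply: le_trans C1.
have C2 : 0 <= 2 + C by apply: addr_ge0.
have l4 : 0 <= 1 + 4 * l by apply: addr_ge0 => //; apply: mulr_ge0.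
by apply: addr_ge0; [apply: addr_ge0; [apply: addr_ge0; apply: mulr_ge0|apply: mulr_ge0]|
  apply: mulr_ge0 => //; apply: mulr_ge0].
Qed.

(** With tooth slope L = z^4 and kernel order z^16, the approximation error is a
    proportion O(z^(-4)) of the total weight, which is at most z^459 ln x, and the
    exponential sums contribute z^4 log z times z^450. *)
Lemma frac_sum_bound (l z x kap : R) :
  0 <= l -> 100 <= z -> log_bounded l z -> (exists2 L : nat, (Num.truncn (z ^+ 459) < 2 ^ L)%N & L%:R <= l * z) ->
  x = z ^+ 914 -> 0 <= kap <= 1 ->
  `|\sum_((Num.truncn (z ^+ 455)).+1 <= m < (Num.truncn (z ^+ 459)).+1)
      (omega m)%:R * (fracpart (x / (m%:R + kap)) - 1 / 2)|
  <= (14 * ln x + 32 * omega_const l * l) * z ^+ 455.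
Proof.
move=> l0 z100 hlog [K D2K hK] xE hkap.
have z1 : 1 <= z by move: z100; clear; lra.
have zp j : 0 < z ^+ j by rewrite exprn_gt0 //; move: z100; clear; lra.
have z0 : 0 < z by move: z100; clear; lra.
have zge1 j : 1 <= z ^+ j by rewrite exprn_ege1.
have zmono i j : (i <= j)%N -> z ^+ i <= z ^+ j by move=> ij; rewrite ler_weXn2l.
set D1 := Num.truncn _; set D2 := Num.truncn _.
have hD2 : D2%:R <= z ^+ 459 by rewrite truncn_le ltW.
pose L := Num.truncn (z ^+ 4); pose G := Num.truncn (z ^+ 8).
have /andP[Llo Lhi] := truncn_half (zge1 4%N); rewrite -/L in Llo Lhi.
have /andP[Glo Ghi] := truncn_half (zge1 8%N); rewrite -/G in Glo Ghi.
have L0 : (0 < L)%N by rewrite truncn_gt0.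
have G0 : (0 < G)%N by rewrite truncn_gt0.
have Lp : 0 < L%:R :> R by rewrite ltr0n.
have Gp : 0 < G%:R :> R by rewrite ltr0n.
have x1 : 1 <= x by rewrite xE.
have lnx0 : 0 <= ln x by apply: ln_ge0.
have G2 : (G ^ 2)%:R <= z ^+ 16 :> R.
  rewrite natrX -[16%N]/(8 * 2)%N exprM.
  by rewrite ler_sqr ?nnegrE ?(ltW (zp _)).
set Co := omega_const l.
have hE j : (0 < j < G ^ 2)%N ->
    normc (\sum_(D1.+1 <= d < D2.+1) (omega d)%:R * cexp (j%:R * (x / (d%:R + kap)))) <= Co * z ^+ 450.
  move=> /andP[j0 jG]; have jp : 1 <= j%:R :> R by rewrite ler1n.
  have jz : j%:R <= z ^+ 16 :> R.
    by apply: le_trans G2; rewrite ler_nat ltnW.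
  have Xlo : z ^+ 914 <= j%:R * x by rewrite xE ler_peMl // ltW.
  have Xhi : j%:R * x <= z ^+ 930.
    have -> : z ^+ 930 = z ^+ 16 * x by rewrite xE -exprD.
    by apply: ler_wpM2r => //; lra.
  have := exp_sum_omega l0 z100 hlog Xlo Xhi hkap D2K hK.
  under eq_bigr => d _ do rewrite -mulrA.
  rewrite -/D1 -/D2 -/Co -[459%N]/(450 + 9)%N exprD mulrA.
  by rewrite ler_pM2r.
have main := fracpart_weighted_sum L0 G0 hE.
apply: le_trans main _.
set W := \sum_(_ <= _ < _) _.
have W0 : 0 <= W by apply: sumr_ge0.
have hW : W <= z ^+ 459 * (2 * ln x).
  apply: le_trans (_ : (D2.+1 - D1.+1)%:R * (2 * ln x) <= _).
    apply: sum_le_const => d /andP[d1 d2]; have d0 : (0 < d)%N by apply: leq_ltn_trans d1.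
    apply: le_trans (omega_le_ln d0) _; rewrite ler_pM2l // ler_ln ?posrE ?ltr0n //; last by lra.
    rewrite xE; apply: le_trans (zmono 459%N 914%N isT).
    by apply: le_trans hD2; rewrite ler_nat.
  apply: ler_wpM2r; first by rewrite mulr_ge0.
  by apply: le_trans hD2; rewrite ler_nat subSS leq_subr.
have hc : 1 / L%:R + L%:R * (5 / 2) / G%:R <= 7 / z ^+ 4.
  have h1 : 1 / L%:R <= 2 / z ^+ 4.
    by rewrite ler_pdivrMr // mulrAC ler_pdivlMr // mul1r; move: Llo; set y := z ^+ 4; clear; lra.
  have h2 : L%:R * (5 / 2) / G%:R <= 5 / z ^+ 4.
    rewrite ler_pdivrMr // mulrAC ler_pdivlMr //.
    apply: le_trans (_ : z ^+ 4 * (5 / 2) * z ^+ 4 <= _).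
      by do 2 (apply: ler_wpM2r; first by [exact: ltW|]).
    have -> : z ^+ 4 * (5 / 2) * z ^+ 4 = 5 * (z ^+ 8 / 2) by rewrite -[8%N]/(4 + 4)%N exprD; ring.
    by rewrite ler_pM2l.
  have -> : 7 / z ^+ 4 = 2 / z ^+ 4 + 5 / z ^+ 4 by rewrite -mulrDl; congr (_ / _); ring.
  exact: lerD.
have t1 : (1 / L%:R + L%:R * (5 / 2) / G%:R) * W <= 14 * ln x * z ^+ 455.
  apply: le_trans (_ : 7 / z ^+ 4 * (z ^+ 459 * (2 * ln x)) <= _).
    have q0 : 0 <= 1 / L%:R + L%:R * (5 / 2) / G%:R :> R.
      by rewrite addr_ge0 ?divr_ge0 ?mulr_ge0 ?divr_ge0.
    exact: ler_pM q0 W0 hc hW.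
  have : z ^+ 4 != 0 by rewrite gt_eqF.
  have -> : z ^+ 459 = z ^+ 4 * z ^+ 455 by rewrite -exprD.
  set y := z ^+ 4 => y0; rewrite le_eqVlt; apply/orP; left; apply/eqP; by field.
have Co0 : 0 <= Co by exact: omega_const_ge0.
have hh : harm (G ^ 2) <= l * z.
  apply: le_trans (harm_le _) _; first by rewrite expn_gt0 G0.
  apply: hlog; first by rewrite expn_gt0 G0.
  by apply: le_trans G2 _; exact: zmono.
have t2 : 32 * L%:R * (Co * z ^+ 450) * harm (G ^ 2) <= 32 * Co * l * z ^+ 455.
  apply: le_trans (_ : 32 * z ^+ 4 * (Co * z ^+ 450) * (l * z) <= _); last first.
    rewrite le_eqVlt; apply/orP; left; apply/eqP.
    have -> : z ^+ 455 = z ^+ 4 * z ^+ 450 * z by rewrite -exprD -exprSr.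
    ring.
  have c450 : 0 <= Co * z ^+ 450 by rewrite mulr_ge0 // ltW.
  apply: ler_pM => //; [by rewrite mulr_ge0 // mulr_ge0|exact: harm_ge0|].
  by apply: ler_wpM2r => //; rewrite ler_pM2l.
by rewrite [leRHS]mulrDl; apply: lerD.
Qed.

(** The n with quotient above z^459 and the quotients up to z^455 are counted
    trivially, each with at most z^455 terms; between them the fractional parts of
    x / m and x / (m + 1) have the same mean. *)
Lemma main_bound (l z x : R) :
  0 <= l -> 100 <= z -> log_bounded l z -> (exists2 L : nat, (Num.truncn (z ^+ 459) < 2 ^ L)%N & L%:R <= l * z) ->
  x = z ^+ 914 ->
  `|\sum_(1 <= n < (Num.truncn x).+1) (omega (Num.truncn (x / n%:R)))%:R - x * limn (@partial_sum R)|
  <= (34 * ln x + (64 * omega_const l * l + 2)) * z ^+ 455.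
Proof.
move=> l0 z100 hlog hL xE.
have z1 : 1 <= z by move: z100; clear; lra.
have zp j : 0 < z ^+ j by rewrite exprn_gt0 //; move: z100; clear; lra.
have zge1 j : 1 <= z ^+ j by rewrite exprn_ege1.
have zmono i j : (i <= j)%N -> z ^+ i <= z ^+ j by move=> ij; rewrite ler_weXn2l.
have xp : 0 < x by rewrite xE.
have x1 : 1 <= x by rewrite xE.
have lnx0 : 0 <= ln x by apply: ln_ge0.
pose D1 := Num.truncn (z ^+ 455); pose D2 := Num.truncn (z ^+ 459).
have hD1 : D1%:R <= z ^+ 455 by rewrite truncn_le ltW.
have hD2 : D2%:R <= z ^+ 459 by rewrite truncn_le ltW.
have D12 : (D1 <= D2)%N by apply: le_truncn; exact: zmono.
have xD2 : x / D2.+1%:R <= z ^+ 455.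
  rewrite ler_pdivrMr // xE -[914%N]/(455 + 459)%N exprD ler_pM2l //.
  by apply: ltW; exact: truncnS_gt.
have D2x : D2.+1%:R <= x.
  rewrite -natr1 xE; apply: le_trans (_ : z ^+ 459 + z ^+ 459 <= _); first by apply: lerD.
  apply: le_trans (zmono 460%N 914%N isT); rewrite [leRHS]exprS.
  have h : 100 * z ^+ 459 <= z * z ^+ 459 by rewrite ler_pM2r.
  by move: h (zp 459%N); set y := z ^+ 459; clear; lra.
have om_le (m : nat) : m%:R <= x -> (omega m)%:R <= 2 * ln x :> R.
  move=> mx; have [->|m0] := posnP m; first by rewrite mulr_ge0.
  apply: le_trans (omega_le_ln m0) _; rewrite ler_pM2l // ler_ln ?posrE ?ltr0n //.
rewrite (@sum_by_quotient R x (fun m => (omega m)%:R) D2 (ltW xp)).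
set S0 := \sum_(1 <= n < _) _.
have hS0 : 0 <= S0 <= 2 * ln x * z ^+ 455.
  rewrite sumr_ge0 //=.
  apply: le_trans (_ : ((Num.truncn (x / D2.+1%:R)).+1 - 1)%:R * (2 * ln x) <= _).
    apply: sum_le_const => n /andP[n0 _]; apply: om_le.
    have np : 1 <= n%:R :> R by rewrite ler1n.
    apply: le_trans (_ : x / n%:R <= _); first by rewrite truncn_le divr_ge0 // ltW.
    by rewrite ler_pdivrMr ?ler_peMr // ?(ltW xp) // (lt_le_trans _ np).
  rewrite subn1 /= mulrC ler_wpM2l ?mulr_ge0 //.
  by apply: le_trans xD2; rewrite truncn_le divr_ge0 // ltW.
have trE (y : R) : 0 <= y -> (Num.truncn y)%:R = y - fracpart y.
  move=> y0; rewrite /fracpart opprB addrC subrK truncn_floor y0.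
  by rewrite natr_absz ger0_norm // floor_ge0.
have -> : \sum_(1 <= m < D2.+1) (omega m)%:R * ((Num.truncn (x / m%:R))%:R - (Num.truncn (x / m.+1%:R))%:R)
   = x * partial_sum D2.+1 - \sum_(1 <= m < D2.+1) (omega m)%:R * (fracpart (x / m%:R) - fracpart (x / m.+1%:R)).
  rewrite /partial_sum big_distrr /= -sumrB; apply: eq_big_nat => m /andP[m0 _].
  have mp : 0 < m%:R :> R by rewrite ltr0n.
  rewrite !trE ?divr_ge0 ?(ltW xp) // /series_term -(natr1 m).
  set f1 := fracpart _; set f2 := fracpart _.
  by field; rewrite gt_eqF //= gt_eqF // addr_gt0.
have /andP[lim1 lim2] := @limn_partial_sum R D2.+1 isT.
set lam := limn _ in lim1 lim2 *; set P := partial_sum _ in lim1 lim2 *.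
have tailx : 0 <= x * (lam - P) <= (2 * ln x + 2) * z ^+ 455.
  rewrite mulr_ge0 ?subr_ge0 ?(ltW xp) //=.
  apply: le_trans (_ : x * tail_bound D2.+1 <= _); first by rewrite ler_pM2l // lerBlDl.
  rewrite /tail_bound.
  have -> : x * (2 * (ln D2.+1%:R + 1) / D2.+1%:R) = 2 * (ln D2.+1%:R + 1) * (x / D2.+1%:R) by ring.
  have ln0 : 0 <= ln D2.+1%:R :> R by apply: ln_ge0; rewrite ler1n.
  apply: ler_pM => //; rewrite ?mulr_ge0 ?addr_ge0 ?divr_ge0 ?(ltW xp) //.
  have : ln D2.+1%:R <= ln x by rewrite ler_ln ?posrE.
  by set y := ln _; set w := ln x; clear; lra.
rewrite (@big_cat_nat _ _ _ D1.+1 1 D2.+1) //=.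
set F1 := \sum_(1 <= m < D1.+1) _; set F2 := \sum_(D1.+1 <= m < D2.+1) _.
have fr01 (y : R) : 0 <= fracpart y < 1 by exact: fracpart_itv.
have hF1 : `|F1| <= 2 * ln x * z ^+ 455.
  apply: le_trans (ler_norm_sum _ _ _) _.
  apply: le_trans (_ : (D1.+1 - 1)%:R * (2 * ln x) <= _).
    apply: sum_le_const => m /andP[m0 mD].
    rewrite normrM ger0_norm // -[leRHS]mulr1; apply: ler_pM => //.
      apply: om_le; apply: le_trans D2x; rewrite ler_nat; apply: ltnW; apply: leq_trans mD _.
      by rewrite ltnS.
    have /andP[a1 a2] := fr01 (x / m%:R); have /andP[a3 a4] := fr01 (x / m.+1%:R).
    by rewrite ler_norml; apply/andP; split; move: a1 a2 a3 a4; set u := fracpart _; set v := fracpart _; clear; lra.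
  by rewrite subn1 /= mulrC ler_wpM2l // mulr_ge0.
have i0 : 0 <= (0 : R) <= 1 by rewrite lexx ler01.
have i1 : 0 <= (1 : R) <= 1 by rewrite lexx ler01.
(* The mean values 1/2 at kap = 0 and at kap = 1 cancel. *)
have p0 := frac_sum_bound l0 z100 hlog hL xE i0.
have p1 := frac_sum_bound l0 z100 hlog hL xE i1.
rewrite -/D1 -/D2 in p0 p1.
set B := (14 * ln x + 32 * omega_const l * l) * z ^+ 455 in p0 p1.
have F2E : F2 = \sum_(D1.+1 <= m < D2.+1) (omega m)%:R * (fracpart (x / (m%:R + 0)) - 1 / 2)
   - \sum_(D1.+1 <= m < D2.+1) (omega m)%:R * (fracpart (x / (m%:R + 1)) - 1 / 2).
  rewrite -sumrB; apply: eq_bigr => m _; rewrite addr0 natr1; ring.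
have hF2 : `|F2| <= B + B.
  by rewrite F2E; apply: le_trans (ler_normB _ _) _; apply: lerD.
have -> : S0 + (x * P - (F1 + F2)) - x * lam = S0 - x * (lam - P) - F1 - F2 by ring.
have eB : (34 * ln x + (64 * omega_const l * l + 2)) * z ^+ 455 =
   2 * ln x * z ^+ 455 + (2 * ln x + 2) * z ^+ 455 + 2 * ln x * z ^+ 455 + (B + B).
  by rewrite /B; ring.
rewrite eB; move: hS0 tailx hF1 hF2; rewrite !ler_norml.
set a := 2 * ln x * z ^+ 455; set b := (2 * ln x + 2) * z ^+ 455; set c := x * (lam - P).
clear; move=> /andP[q1 q2] /andP[q3 q4] /andP[q5 q6] /andP[q7 q8].
by apply/andP; split; lra.
Qed.

Lemma root_powE (x : R) (m n : nat) : 0 <= x ->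
  (x `^ (n%:R^-1)) ^+ m = x `^ (m%:R / n%:R).
Proof. by move=> x0; rewrite -powR_mulrn ?powR_ge0 // -powRrM mulrC. Qed.

Lemma root_powK (x : R) (n : nat) : 0 <= x -> (0 < n)%N -> (x `^ (n%:R^-1)) ^+ n = x.
Proof. by move=> x0 n0; rewrite root_powE // divff ?powRr1 // pnatr_eq0 -lt0n. Qed.

Lemma le_root (a x : R) (n : nat) : 0 <= x -> (0 < n)%N -> a ^+ n <= x -> a <= x `^ (n%:R^-1).
Proof.
move=> x0 n0 ax; rewrite leNgt; apply/negP => h.
have : (x `^ (n%:R^-1)) ^+ n < a ^+ n.
  have a0 : 0 <= a by apply: le_trans (ltW h); exact: powR_ge0.
  by rewrite ltr_pXn2r // nnegrE // powR_ge0.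
by rewrite root_powK // ltNge ax.
Qed.

Lemma ln_le_powR (x eps : R) : 0 < x -> 0 < eps -> ln x <= x `^ eps / eps.
Proof.
move=> x0 e0; rewrite ler_pdivlMr // mulrC -ln_powR.
by apply: ltW; apply: ln_sublinear; exact: powR_gt0.
Qed.

End Assembly.

Theorem theorem1p6 (R : realType) :
  cvgn (fun N : nat => \sum_(1 <= n < N) ((omega n)%:R / (n%:R * (n%:R + 1)) : R)) /\
  forall eps : R, 0 < eps ->
    exists C x0 : R, forall x : R, expR 1 <= x -> x0 <= x ->
      `| \sum_(1 <= n < (Num.truncn x).+1) (omega (Num.truncn (x / n%:R)))%:R
         - x * limn (fun N : nat => \sum_(1 <= n < N) ((omega n)%:R / (n%:R * (n%:R + 1)) : R)) |
      <= C * x `^ (455 / 914 + eps).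
Proof.
split; first exact: partial_sum_cvg.
move=> eps eps0; have [l l0 hl] := @log_parameters R.
pose M : R := 64 * omega_const l * l + 2.
exists (34 / eps + `|M|), (100 ^+ 914) => x xe x0x.
have x1 : 1 <= x by apply: le_trans xe; apply: le_trans (expR_ge1Dx 1); rewrite lerDl.
have xp : 0 < x by apply: lt_le_trans x1.
have z100 : 100 <= x `^ (914%:R^-1) by apply: le_root x0x => //; exact: ltW.
have zx : x = (x `^ (914%:R^-1)) ^+ 914 by rewrite root_powK // ltW.
have [hlog hL] := hl _ z100.
apply: le_trans (main_bound l0 z100 hlog hL zx) _.
rewrite root_powE ?(ltW xp) // -/M [x `^ (_ + eps)]powRD; last first.
  by rewrite (gt_eqF xp) implybT.
rewrite [X in _ <= _ * X]mulrC mulrA; apply: ler_wpM2r; first exact: powR_ge0.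
have xe1 : 1 <= x `^ eps by rewrite -(powRr0 x) ler_powR // ltW.
rewrite [leRHS]mulrDl; apply: lerD.
  rewrite -mulrA ler_pM2l // mulrC; exact: ln_le_powR.
by apply: le_trans (ler_norm M) _; rewrite ler_peMr.
Qed.
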